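(* Let $\mu>0$. The sequence $(\nu_N^{(\mu)})_{N\in\mathbb N}$ converges weakly to a Borel probability measure $\nu^{(\mu)}$ on $\mathcal T$ characterized by $$\nu^{(\mu)}\big(\mathcal B_{1/r}(T_0)\big)=e^{-\mu(r-1)}4^{-|T_0|}2^{K+1}\sum_{R=1}^K\binom KR\frac{\mu^{R-1}}{(R-1)!}$$ for every $T_0\in\mathcal T_{\rm fin}$ of height $r\ge1$, where $K=|D_r(T_0)|$.
   Context: Rooted planar trees (root of degree 1); $D_r(T)$ = vertices at height $r$; $|T|$ = number of edges; $h(T)$ = height. $\mathcal T$ = all finite and infinite (locally finite) trees with metric $\mathrm{dist}(T,T')=\inf\{1/r:B_r(T)=B_r(T')\}$, $B_r(T)$ the subtree spanned by vertices of height $\le r$, and $\mathcal B_{1/r}(T_0)=\{T:B_r(T)=T_0\}$ for $T_0$ of height $r$. $Z_N^{(\mu)}=\sum_{|T|=N}e^{-\mu h(T)}$ and $\nu_N^{(\mu)}(T)=e^{-\mu h(T)}/Z_N^{(\mu)}$ for $|T|=N$, viewed as a Borel probability measure on $\mathcal T$. *)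

(* Defs.v *)
From HB Require Import structures.
From mathcomp Require Import all_boot all_order all_algebra.
From mathcomp Require Import all_classical all_reals all_analysis.
From mathcomp Require Import finmap.
Set Implicit Arguments. Unset Strict Implicit. Unset Printing Implicit Defensive.
Import Order.TTheory GRing.Theory Num.Theory.
Local Open Scope classical_set_scope.
Local Open Scope ring_scope.

(* Rooted planar (ordered) locally finite trees, finite or infinite, whose
   root has degree 1, encoded in Ulam-Harris form: a vertex is the word
   [:: i1; ...; ik] of child indices along the path from the root, so the
   height of a vertex is the length of its word. *)
Record ptree := PTree {
  verts : set (seq nat);
  verts_root : verts [::];
  verts_prefix : forall w i, verts (rcons w i) -> verts w;
  verts_sibling : forall w i j, (j <= i)%N -> verts (rcons w i) -> verts (rcons w j);
  verts_locfin : forall w, exists n, forall i, verts (rcons w i) -> (i < n)%N;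
  verts_root_child : verts [:: 0%N];
  verts_root_deg1 : ~ verts [:: 1%N]
}.

Definition edge_tree_verts : set (seq nat) := fun w => w = [::] \/ w = [:: 0%N].

Lemma edge_tree_root : edge_tree_verts [::].
Proof. by left. Qed.

Lemma edge_tree_prefix w i : edge_tree_verts (rcons w i) -> edge_tree_verts w.
Proof. by case: w => [|a [|b w]] [] //= _; left. Qed.

Lemma edge_tree_sibling w i j : (j <= i)%N ->
  edge_tree_verts (rcons w i) -> edge_tree_verts (rcons w j).
Proof.
case: w => [|a [|b w]] ji [] //= [] i0; right.
by move: ji; rewrite i0 leqn0 => /eqP ->.
Qed.

Lemma edge_tree_locfin w : exists n, forall i, edge_tree_verts (rcons w i) -> (i < n)%N.
Proof. by exists 1%N => i; case: w => [|a [|b w]] [] //= [] ->. Qed.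

Lemma edge_tree_root_child : edge_tree_verts [:: 0%N].
Proof. by right. Qed.

Lemma edge_tree_root_deg1 : ~ edge_tree_verts [:: 1%N].
Proof. by case. Qed.

Definition edge_tree : ptree := PTree edge_tree_root edge_tree_prefix
  edge_tree_sibling edge_tree_locfin edge_tree_root_child edge_tree_root_deg1.

HB.instance Definition _ := gen_eqMixin ptree.
HB.instance Definition _ := gen_choiceMixin ptree.
HB.instance Definition _ := isPointed.Build ptree edge_tree.

Definition tfinite (T : ptree) : Prop := finite_set (verts T).

Definition tedges (T : ptree) : nat := ((#|` fset_set (verts T)|)%fset - 1)%N.

Definition theight (T : ptree) : nat := \max_(w <- fset_set (verts T)) size w.

Definition level (T : ptree) (r : nat) : set (seq nat) :=
  [set w | verts T w /\ size w = r].

Definition ball_eq (r : nat) (T T' : ptree) : Prop :=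
  forall w, (size w <= r)%N -> (verts T w <-> verts T' w).

Definition tdist {R : realType} (T T' : ptree) : R :=
  inf [set (r%:R)^-1 | r in [set r : nat | (0 < r)%N /\ ball_eq r T T']].

Definition topen {R : realType} (U : set ptree) : Prop :=
  forall T, U T -> exists2 e : R, 0 < e & forall T', tdist T T' < e -> U T'.

Definition tree_borel (R : realType) := g_sigma_algebraType (@topen R).

(* B_{1/r}(T0) = { T : B_r(T) = T0 }, with r = h(T0) *)
Definition tcyl (T0 : ptree) : set ptree :=
  [set T | forall w, verts T0 w <-> (verts T w /\ (size w <= theight T0)%N)].

Definition treesN (N : nat) : set ptree := [set T | tfinite T /\ tedges T = N].

Definition tweight {R : realType} (mu : R) (T : ptree) : R :=
  expR (- mu * (theight T)%:R).

Definition ZN {R : realType} (mu : R) (N : nat) : R :=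
  (\sum_(T \in treesN N) tweight mu T)%R.

Definition nuN {R : realType} (mu : R) (N : nat) (T : ptree) : R :=
  tweight mu T / ZN mu N.

Definition tcontinuous {R : realType} (f : ptree -> R) : Prop :=
  forall T (e : R), 0 < e -> exists2 d : R, 0 < d &
    forall T', tdist T T' < d -> `|f T - f T'| < e.

Definition tbounded {R : realType} (f : ptree -> R) : Prop :=
  exists M : R, forall T, `|f T| <= M.

(* weak convergence of nu_N^{(mu)} to nu: for every bounded continuous f,
   \int f d nu_N -> \int f d nu  (the integral against the finitely supported
   nu_N being the finite sum) *)
Definition weak_conv_nuN {R : realType} (mu : R)
    (nu : probability (tree_borel R) R) : Prop :=
  forall f : ptree -> R, tcontinuous f -> tbounded f ->
    (fun N => ((\sum_(T \in treesN N) f T * nuN mu N T)%R)%:E) @ \oo -->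
      (\int[nu]_(x in setT) (f x)%:E)%E.

Definition cyl_value {R : realType} (mu : R) (T0 : ptree) : R :=
  let r := theight T0 in
  let K := (#|` fset_set (level T0 r)|)%fset in
  expR (- mu * (r.-1)%:R) * (4 ^- tedges T0) * (2 ^+ K.+1) *
  \sum_(1 <= k < K.+1) ('C(K, k))%:R * mu ^+ k.-1 / (k.-1)`!%:R.

(* Main.v *)
Require Import Defs.
From HB Require Import structures.
From mathcomp Require Import all_boot all_order all_algebra.
From mathcomp Require Import all_classical all_reals all_analysis measurable_realfun.
From mathcomp Require Import finmap ring lra zify.
Set Implicit Arguments. Unset Strict Implicit. Unset Printing Implicit Defensive.
Import Order.TTheory GRing.Theory Num.Theory.
Import numFieldNormedType.Exports.
Local Open Scope classical_set_scope.
Local Open Scope ring_scope.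

(** Let [H_m] be the power series with [H_0 = 1], [H_(m+1) = 1 / (1 - X H_m)]; the coefficient of
    [X^n] in [H_m ^ k] counts the planar forests of height at most [m] with [k] roots and [n] edges.
    Summing by parts over the height, [nu_N (tcyl T0)] is up to an explicit factor the ratio
    [growth k (N - |T0|) / growth 1 (N - 1)], where [growth k n] weighs these forests by [q ^ height],
    [q = exp (- mu)], and [k] is the number of top vertices of [T0].  Put [V = 2 X H_m - 1]
    and [M = m + 2].  The Riccati equation of [V] gives a recursion in [k] for the coefficients of
    [V ^ k], whose case [k = 1] is a trigonometric sum dominated by [cos (pi / M) ^ (2 n)].  The sum
    over heights concentrates where [M] is close to [p ^ 4], [2 pi^2 n = mu p^12]; there the
    [k]-th coefficient ratio tends to [mu ^ (k - 1) / (k - 1)!], which yields the limits of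
    the cylinder probabilities.  The limiting values are consistent under one-level extensions (a
    Cauchy product and Vandermonde's identity), so nested subintervals of [0, 1[ of these lengths
    define a random tree with these cylinder probabilities.  Cylinders and the empty set form a pi-system
    generating the Borel sets, which gives uniqueness.  Finite trees are null for the limit, so a bounded
    continuous function is squeezed, up to a small error, between combinations of indicators of
    finite unions of cylinders on which it oscillates little; this gives weak convergence. *)

(** * Formal power series *)

(** The weight of height [m] behaves like [exp (- mu M - n pi^2 / M^2)]. At the saddle the exponent
    is of order [p^4] and its curvature of order [p^-4], so heights fluctuate on the scale [p^2]. A
    window of half-width [p^3] costs outside it a factor [exp (- mu p^2 / 2)], which beats every
    power of [p], while [M / p^4] still tends to 1 inside; the twelfth root makes all these scales
    integer powers. The total weight of the window is common to all [k] and cancels in the ratios,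
    so no asymptotics of [ZN] is required. The obstacle is to treat every power [k] uniformly over
    the window. The recursion for the powers of [V] is linear in the sequence of coefficients. It
    can thus be run separately on the leading eigenvalue, where it is exact, and on the remainder,
    where losing a factor [n] at each step is harmless because the second eigenvalue is
    exponentially smaller. On the leading term the factors [n] only multiply a discrete derivative
    or [tan (pi / M) ^ 2], and [n tan (pi / M) ^ 2 / M] tends to [mu / 2]. *)

Definition fps (R : Type) := nat -> R.

HB.instance Definition _ (R : Type) := gen_eqMixin (fps R).
HB.instance Definition _ (R : Type) := gen_choiceMixin (fps R).

Section FpsRing.
Variable R : comNzRingType.
Implicit Types f g h : fps R.

Definition fps_zero : fps R := fun=> 0.
Definition fps_opp f : fps R := fun n => - f n.
Definition fps_add f g : fps R := fun n => f n + g n.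
Definition fps_one : fps R := fun n => (n == 0%N)%:R.
Definition fps_mul f g : fps R := fun n => \sum_(i < n.+1) f i * g (n - i)%N.

Lemma fps_addA : associative fps_add.
Proof. by move=> f g h; apply/funext => n; rewrite /fps_add addrA. Qed.
Lemma fps_addC : commutative fps_add.
Proof. by move=> f g; apply/funext => n; rewrite /fps_add addrC. Qed.
Lemma fps_add0 : left_id fps_zero fps_add.
Proof. by move=> f; apply/funext => n; rewrite /fps_add add0r. Qed.
Lemma fps_addN : left_inverse fps_zero fps_opp fps_add.
Proof. by move=> f; apply/funext => n; rewrite /fps_add addNr. Qed.

HB.instance Definition _ := GRing.isZmodule.Build (fps R)
  fps_addA fps_addC fps_add0 fps_addN.

Definition fps_trunc n f : {poly R} := \poly_(i < n.+1) f i.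

(** Coefficients up to [n] only see truncations, so commutativity and associativity are inherited
    from polynomials. *)
Lemma fps_mulE f g n i : (i <= n)%N ->
  fps_mul f g i = (fps_trunc n f * fps_trunc n g)`_i.
Proof.
move=> le_in; rewrite coefM; apply: eq_bigr => j _.
have lejn : (j < n.+1)%N by apply: leq_trans (ltn_ord j) _.
have leijn : (i - j < n.+1)%N by rewrite ltnS (leq_trans (leq_subr _ _)).
by rewrite !coef_poly lejn leijn.
Qed.

Lemma fps_mulC : commutative fps_mul.
Proof. by move=> f g; apply/funext => n; rewrite !(fps_mulE _ _ (leqnn n)) mulrC. Qed.

Lemma fps_mulA : associative fps_mul.
Proof.
move=> f g h; apply/funext => n.
transitivity ((fps_trunc n f * (fps_trunc n g * fps_trunc n h))`_n).
  rewrite coefM; apply: eq_bigr => i _.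
  by rewrite -(fps_mulE _ _ (leq_subr i n)) coef_poly ltn_ord.
rewrite mulrA coefM; apply: eq_bigr => i _.
have lein : (i <= n)%N by rewrite -ltnS.
have leni : (n - i < n.+1)%N by rewrite ltnS leq_subr.
by rewrite (fps_mulE f g lein) coef_poly leni.
Qed.

Lemma fps_mul1 : left_id fps_one fps_mul.
Proof.
move=> f; apply/funext => n; rewrite /fps_mul big_ord_recl /= mul1r subn0 big1 ?addr0 //.
by move=> i _; rewrite /fps_one /= mul0r.
Qed.

Lemma fps_mulDl : left_distributive fps_mul fps_add.
Proof.
move=> f g h; apply/funext => n; rewrite /fps_mul /fps_add -big_split /=.
by apply: eq_bigr => i _; rewrite mulrDl.
Qed.

Lemma fps_1neq0 : fps_one != 0 :> fps R.
Proof. by apply/eqP => /(congr1 (fun f : fps R => f 0%N)) /eqP; rewrite oner_eq0. Qed.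

HB.instance Definition _ := GRing.Zmodule_isComNzRing.Build (fps R)
  fps_mulA fps_mulC fps_mul1 fps_mulDl fps_1neq0.

Lemma fps_coefD f g n : (f + g) n = f n + g n. Proof. by []. Qed.
Lemma fps_coefN f n : (- f) n = - f n. Proof. by []. Qed.
Lemma fps_coefB f g n : (f - g) n = f n - g n. Proof. by []. Qed.
Lemma fps_coef1 n : (1 : fps R) n = (n == 0%N)%:R. Proof. by []. Qed.
Lemma fps_coefM f g n : (f * g) n = \sum_(i < n.+1) f i * g (n - i)%N.
Proof. by []. Qed.

Lemma fps_coefMn f k n : (f *+ k) n = f n *+ k.
Proof. by elim: k => [|k IH]; rewrite ?mulr0n // !mulrS fps_coefD IH. Qed.

Lemma fps_coef_natM k f n : (k%:R * f) n = k%:R * f n.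
Proof. by rewrite mulr_natl fps_coefMn mulr_natl. Qed.

Lemma fps_coef_sum (I : Type) (r : seq I) (P : pred I) (F : I -> fps R) n :
  (\sum_(i <- r | P i) F i) n = \sum_(i <- r | P i) F i n.
Proof. by elim/big_rec2: _ => // i y x _ <-. Qed.

Definition fps_var : fps R := fun n => (n == 1%N)%:R.

Lemma fps_coefXM f n : (fps_var * f) n = if n is k.+1 then f k else 0.
Proof.
rewrite fps_coefM; case: n => [|n]; first by rewrite big_ord1 mul0r.
rewrite 2!big_ord_recl /= {1 2}/fps_var /= mul0r add0r mul1r subn1 big1 ?addr0 //.
by move=> i _; rewrite /fps_var mul0r.
Qed.

(** The operator [X d/dX]: a derivation which, unlike [d/dX], does not shift indices. *)
Definition fps_euler f : fps R := fun n => n%:R * f n.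

Lemma fps_eulerD f g : fps_euler (f + g) = fps_euler f + fps_euler g.
Proof. by apply/funext => n; rewrite /fps_euler fps_coefD mulrDr. Qed.

Lemma fps_eulerN f : fps_euler (- f) = - fps_euler f.
Proof. by apply/funext => n; rewrite /fps_euler !fps_coefN mulrN. Qed.

Lemma fps_euler_natr k : fps_euler k%:R = 0.
Proof.
apply/funext => n; rewrite /fps_euler fps_coefMn fps_coef1.
by case: n => [|n]; rewrite ?mul0r // mul0rn mulr0.
Qed.

Lemma fps_eulerM f g : fps_euler (f * g) = fps_euler f * g + f * fps_euler g.
Proof.
apply/funext => n; rewrite /fps_euler fps_coefD !fps_coefM mulr_sumr -big_split /=.
apply: eq_bigr => i _; have lein : (i <= n)%N by rewrite -ltnS.
rewrite -[n in n%:R](subnK lein) natrD; ring.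
Qed.

Lemma fps_eulerX : fps_euler fps_var = fps_var.
Proof.
by apply/funext => -[|[|n]]; rewrite /fps_euler /fps_var /= ?mulr0 ?mul1r.
Qed.

Lemma fps_eulerXn f k : fps_euler (f ^+ k.+1) = k.+1%:R * f ^+ k * fps_euler f.
Proof.
elim: k => [|k IH]; first by rewrite expr1 expr0 !mul1r.
rewrite exprS fps_eulerM IH -!natr1 exprS; ring.
Qed.

End FpsRing.

Section FpsGeo.
Variable R : realFieldType.
Implicit Types f g h : fps R.
Local Notation X := (fps_var R).

(* The expansion of [(1 - X f)^-k]; the truncated [k + j - 1] makes it [1] for [k = 0]. *)
Definition fps_negbin f k : fps R :=
  fun n => \sum_(j < n.+1) 'C(k + j - 1, j)%:R * (f ^+ j) (n - j)%N.

Definition fps_geo f := fps_negbin f 1.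

Lemma fps_negbin0 f : fps_negbin f 0 = 1.
Proof.
apply/funext => n; rewrite /fps_negbin fps_coef1 big_ord_recl /= bin0 mul1r expr0 subn0.
rewrite big1 ?addr0 // => i _.
by rewrite bin_small ?mul0r // /bump /=; lia.
Qed.

Lemma fps_negbin_coef0 f k : fps_negbin f k 0%N = 1.
Proof. by rewrite /fps_negbin big_ord1 /= bin0 mul1r expr0. Qed.

(** Pascal's rule, once the convolution of [f] with the powers [f ^+ j] has been regrouped into
    [f ^+ j.+1]. *)
Lemma fps_negbinS f k : (1 - X * f) * fps_negbin f k.+1 = fps_negbin f k.
Proof.
rewrite mulrBl mul1r -mulrA; apply/funext => -[|n].
  by rewrite fps_coefB fps_coefXM subr0 !fps_negbin_coef0.
rewrite fps_coefB fps_coefXM.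
have -> : (f * fps_negbin f k.+1) n =
    \sum_(j < n.+1) 'C(k + j, j)%:R * (f ^+ j.+1) (n - j)%N.
  rewrite fps_coefM.
  transitivity (\sum_(i < n.+1) \sum_(j < n.+1 | (j < (n - i).+1)%N)
      f i * ('C(k + j, j)%:R * (f ^+ j) (n - i - j)%N)).
    apply: eq_bigr => i _; rewrite /fps_negbin mulr_sumr.
    have lein : ((n - i).+1 <= n.+1)%N by rewrite ltnS leq_subr.
    rewrite (big_ord_widen_cond _ xpredT (fun j => f i * ('C(k.+1 + j - 1, j)%:R
      * (f ^+ j) (n - i - j)%N)) lein).
    by apply: eq_bigr => j _; rewrite addSn subn1.
  rewrite (exchange_big_dep xpredT) //=; apply: eq_bigr => j _.
  rewrite exprS fps_coefM mulr_sumr.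
  have lejn : ((n - j).+1 <= n.+1)%N by rewrite ltnS leq_subr.
  rewrite (big_ord_widen_cond _ xpredT
    (fun i => 'C(k + j, j)%:R * (f i * (f ^+ j) (n - j - i)%N)) lejn).
  apply: eq_big => [i /=|i _]; first by have := ltn_ord i; have := ltn_ord j; lia.
  by rewrite mulrCA -!subnDA [(i + j)%N]addnC.
rewrite /fps_negbin big_ord_recl [in RHS]big_ord_recl !bin0 -addrA; congr (_ + _).
rewrite -sumrB; apply: eq_bigr => i _; rewrite !lift0 subSS.
rewrite -mulrBl; congr (_ * _); apply/eqP; rewrite subr_eq -natrD; apply/eqP; congr _%:R.
rewrite (_ : k.+1 + i.+1 - 1 = (k + i).+1)%N; last lia.
rewrite (_ : k + i.+1 - 1 = k + i)%N; last lia.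
by rewrite binS.
Qed.

Lemma fps_geoK f : (1 - X * f) * fps_geo f = 1.
Proof. by rewrite fps_negbinS fps_negbin0. Qed.

Lemma fps_negbinE f k : fps_negbin f k = fps_geo f ^+ k.
Proof.
elim: k => [|k IH]; first by rewrite fps_negbin0 expr0.
by rewrite exprS -IH -(fps_negbinS f k) mulrA [_ * (1 - _)]mulrC fps_geoK mul1r.
Qed.

Lemma fps_geo_expE f k n : (fps_geo f ^+ k) n =
  \sum_(j < n.+1) 'C(k + j - 1, j)%:R * (f ^+ j) (n - j)%N.
Proof. by rewrite -fps_negbinE. Qed.

Lemma fps_geo_inj f g h : (1 - X * f) * g = (1 - X * f) * h -> g = h.
Proof.
by move=> /(congr1 (fun t => fps_geo f * t)); rewrite !mulrA mulrC
  [fps_geo f * _]mulrC fps_geoK mulr1 mul1r.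
Qed.

End FpsGeo.

(** * Height-restricted forests *)

(* [X H_m] is the generating function of the rooted planar trees with root of
   degree 1 and height at most [m + 1]. *)
Section HeightSeries.
Variable R : realFieldType.
Local Notation X := (fps_var R).

Fixpoint hser m : fps R := if m is m'.+1 then fps_geo (hser m') else 1.

Lemma hserS m : hser m.+1 = 1 + X * hser m * hser m.+1.
Proof. by have := fps_geoK (hser m); rewrite mulrBl mul1r => /(canRL (subrK _)). Qed.

Lemma hser_expS m k n : (hser m.+1 ^+ k) n =
  \sum_(j < n.+1) 'C(k + j - 1, j)%:R * (hser m ^+ j) (n - j)%N.
Proof. exact: fps_geo_expE. Qed.

Lemma hser_exp_ge0 m k n : 0 <= (hser m ^+ k) n.
Proof.
elim: m k n => [|m IH] k n; first by rewrite expr1n fps_coef1.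
by rewrite hser_expS sumr_ge0 // => j _; rewrite mulr_ge0.
Qed.

Lemma hser_ge0 m n : 0 <= hser m n.
Proof. by rewrite -[hser m]expr1 hser_exp_ge0. Qed.

(** As [m] grows this tends to [- sqrt (1 - 4 X)], the singular part of the Catalan series. *)
Definition vser m : fps R := 2%:R * X * hser m - 1.

Lemma vserS m : (1 + vser m.+1) * (1 - vser m) = 4%:R * X.
Proof.
rewrite /vser [hser m.+1]/=; move: (fps_geoK (hser m)).
set f := hser m; set g := fps_geo f => E.
transitivity (4%:R * X * ((1 - X * f) * g)); last by rewrite E mulr1.
ring.
Qed.

(* The addition formula behind [V = - tan t * cot (M t)], [4 X = 1 / cos^2 t]:
   the derivative in [X] of a cotangent is quadratic in it. *)
Lemma vser_riccati m : (m.+2)%:R * vser m ^+ 2 =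
  2%:R * (4%:R * X - 1) * fps_euler (vser m) - 4%:R * X * vser m - (m.+2)%:R * (4%:R * X - 1).
Proof.
elim: m => [|m IH].
  rewrite /vser /= mulr1 fps_eulerD fps_eulerN fps_eulerM fps_eulerX (fps_euler_natr _ 2).
  rewrite (fps_euler_natr _ 1); ring.
have E := vserS m.
have D : fps_euler (vser m.+1) * (1 - vser m) - (1 + vser m.+1) * fps_euler (vser m) = 4%:R * X.
  clear IH; move: (vser m.+1) (vser m) E => W V /(congr1 (@fps_euler R)).
  rewrite !fps_eulerM (fps_euler_natr _ 4) !fps_eulerD !fps_eulerN (fps_euler_natr _ 1) fps_eulerX.
  by rewrite (mul0r X) [0 + 4%:R * X]add0r => <-; ring.
set W := vser m.+1 in D E *; set V := vser m in D E IH *.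
set W' := fps_euler W in D *; set V' := fps_euler V in D IH *.
have eqV : 1 - V = 2%:R * (1 - X * hser m) by rewrite /V /vser; ring.
(* Multiplying by [(1 - V) ^+ 2] lets [W] and [W'] be expressed through [V] and [V']; the factor can
   be cancelled because [1 - V] is twice the invertible series [1 - X H_m]. *)
suff: (1 - V) * ((1 - V) * ((m.+3)%:R * W ^+ 2)) = (1 - V) * ((1 - V) *
    (2%:R * (4%:R * X - 1) * W' - 4%:R * X * W - (m.+3)%:R * (4%:R * X - 1))).
  have unit2 (a b : fps R) : 2%:R * a = 2%:R * b -> a = b.
    move=> ab; apply/funext => n; have := congr1 (fun f : fps R => f n) ab.
    by rewrite !fps_coef_natM => /mulfI; apply; rewrite pnatr_eq0.
  rewrite eqV -!mulrA => /unit2 /fps_geo_inj /unit2 /fps_geo_inj; by rewrite !mulrA.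
have DD : (1 - V) * ((1 - V) * W') = 4%:R * X * (1 - V) + 4%:R * X * V'.
  have DW : W' * (1 - V) = 4%:R * X + (1 + W) * V' by rewrite -D; ring.
  transitivity ((1 - V) * (W' * (1 - V))); first ring.
  rewrite DW; transitivity (4%:R * X * (1 - V) + (1 + W) * (1 - V) * V'); first ring.
  by rewrite E.
have EW : (1 - V) * W = 4%:R * X - 1 + V by rewrite -E; ring.
transitivity ((m.+3)%:R * ((1 - V) * W) ^+ 2); first ring.
transitivity (2%:R * (4%:R * X - 1) * ((1 - V) * ((1 - V) * W')) - 4%:R * X * (1 - V) * ((1 - V) * W)
   - (m.+3)%:R * (4%:R * X - 1) * (1 - V) ^+ 2); last ring.
rewrite DD EW.
have IH' : 2%:R * (4%:R * X - 1) * V' = (m.+2)%:R * V ^+ 2 + 4%:R * X * V + (m.+2)%:R * (4%:R * X - 1).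
  by rewrite IH; ring.
transitivity (2%:R * (4%:R * X - 1) * (4%:R * X * (1 - V)) + 4%:R * X * (2%:R * (4%:R * X - 1) * V')
  - 4%:R * X * (1 - V) * (4%:R * X - 1 + V) - (m.+3)%:R * (4%:R * X - 1) * (1 - V) ^+ 2); last ring.
by rewrite IH' -!natr1; ring.
Qed.

Lemma vser_exp_riccati m k : (k.+1)%:R * (m.+2)%:R * vser m ^+ k.+2 =
  2%:R * (4%:R * X - 1) * fps_euler (vser m ^+ k.+1) - (k.+1)%:R * 4%:R * X * vser m ^+ k.+1
  - (k.+1)%:R * (m.+2)%:R * (4%:R * X - 1) * vser m ^+ k.
Proof.
rewrite fps_eulerXn.
transitivity ((k.+1)%:R * vser m ^+ k * ((m.+2)%:R * vser m ^+ 2)).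
  by rewrite -[k.+2]addn2 exprD; ring.
by rewrite vser_riccati exprS; ring.
Qed.

Lemma vser_exp_coef m k n : (k.+1)%:R * (m.+2)%:R * (vser m ^+ k.+2) n.+1 =
  2%:R * (4%:R * n%:R * (vser m ^+ k.+1) n - (n.+1)%:R * (vser m ^+ k.+1) n.+1)
  - (k.+1)%:R * 4%:R * (vser m ^+ k.+1) n
  - (k.+1)%:R * (m.+2)%:R * (4%:R * (vser m ^+ k) n - (vser m ^+ k) n.+1).
Proof.
have := congr1 (fun f : fps R => f n.+1) (vser_exp_riccati m k).
set a := vser m ^+ k.+2; set b := vser m ^+ k.+1; set c := vser m ^+ k.
have -> : 2%:R * (4%:R * X - 1) * fps_euler b - (k.+1)%:R * 4%:R * X * b
  - (k.+1)%:R * (m.+2)%:R * (4%:R * X - 1) * c =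
  2%:R * (4%:R * (X * fps_euler b) - fps_euler b) - (k.+1)%:R * (4%:R * (X * b))
  - (k.+1)%:R * ((m.+2)%:R * (4%:R * (X * c) - c)) by ring.
rewrite -[_ * _ * a]mulrA !(fps_coefB, fps_coef_natM, fps_coefXM) /fps_euler => E.
rewrite -mulrA E; ring.
Qed.

End HeightSeries.

(** * Trigonometric formula and exponential bound for the coefficients of [H_m] *)

Section TrigSums.
Variable R : realType.
Implicit Types x y : R.

Lemma sin_natpi k : sin (k%:R * pi) = 0 :> R.
Proof.
elim: k => [|k IH]; first by rewrite mul0r sin0.
by rewrite -natr1 mulrDl mul1r sinD IH sinpi mulr0 mul0r addr0.
Qed.

Lemma cos_natSpi k : cos (k.+1%:R * pi) = - cos (k%:R * pi) :> R.
Proof. by rewrite -natr1 mulrDl mul1r cosD sinpi cospi; ring. Qed.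

Lemma sin_prosthaphaeresis x y : sin (x + y) + sin (x - y) = 2 * cos y * sin x.
Proof. by rewrite sinB sinD; ring. Qed.

Lemma sum_cos_half x n : 2 * sin (x / 2) * (\sum_(1 <= j < n.+1) cos (j%:R * x)) =
  sin ((n%:R + 2^-1) * x) - sin (x / 2).
Proof.
elim: n => [|n IH]; first by rewrite big_geq // mulr0 add0r [_^-1 * x]mulrC subrr.
rewrite big_nat_recr //= mulrDr IH.
have -> : (n.+1%:R + 2^-1) * x = n.+1%:R * x + x / 2 by ring.
have -> : (n%:R + 2^-1) * x = n.+1%:R * x - x / 2 by rewrite -natr1; field.
by rewrite sinB sinD; ring.
Qed.

Lemma sum_cos_pi M k : (0 < k < M.*2)%N ->
  \sum_(1 <= j < M) cos (k%:R * (j%:R * pi / M%:R)) = - (1 + cos (k%:R * pi)) / 2 :> R.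
Proof.
move=> /andP[k0 kM]; case: M kM => // M kM.
have M0 : M.+1%:R != 0 :> R by rewrite pnatr_eq0.
set x := k%:R * pi / M.+1%:R : R.
have E j : k%:R * (j%:R * pi / M.+1%:R) = j%:R * x by rewrite /x; ring.
under eq_bigr => j _ do rewrite E.
have s0 : sin (x / 2) != 0.
  rewrite gt_eqF // sin_gt0_pi // ?divr_gt0 ?mulr_gt0 ?pi_gt0 ?ltr0n //=.
  rewrite /x ltr_pdivrMr ?ltr0n // ltr_pdivrMr ?ltr0n // mulrC -mulrA ltr_pM2l ?pi_gt0 //.
  by rewrite -natrM ltr_nat mulnC muln2.
apply: (mulfI (mulf_neq0 (_ : 2 != 0) s0)); first by rewrite pnatr_eq0.
rewrite sum_cos_half (_ : (M%:R + 2^-1) * x = k%:R * pi - x / 2); last first.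
  have <- : M.+1%:R * x = k%:R * pi by rewrite /x mulrC divfK.
  by rewrite -natr1; field.
by rewrite sinB sin_natpi; field.
Qed.

(* The path graph on [m + 1] vertices has eigenvalues [2 cos (j pi / (m + 2))]. *)
Definition angle m j : R := j%:R * pi / m.+2%:R.

Lemma angleE m j : m.+2%:R * angle m j = j%:R * pi.
Proof. by rewrite /angle mulrC divfK // pnatr_eq0. Qed.

(** The number of walks of length [t] from the end of the path to its vertex [k], by the spectral
    decomposition of the adjacency matrix. *)
Definition pathsum m k t : R := 2 / m.+2%:R *
  \sum_(1 <= j < m.+2) sin (angle m j) * sin (k.+1%:R * angle m j) * (2 * cos (angle m j)) ^+ t.

Lemma pathsum_0 m k : (k <= m.+1)%N -> pathsum m k 0 = (k == 0%N)%:R.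
Proof.
move=> km; rewrite /pathsum.
under eq_bigr => j _.
  rewrite expr0 mulr1 (_ : sin _ * sin _ = (cos (k%:R * angle m j) - cos (k.+2%:R * angle m j)) / 2).
  over.
  rewrite (_ : k%:R * _ = k.+1%:R * angle m j - angle m j); last by rewrite -natr1; ring.
  rewrite (_ : k.+2%:R * _ = k.+1%:R * angle m j + angle m j); last by rewrite -natr1; ring.
  by rewrite cosB cosD; field.
have M0 : m.+2%:R != 0 :> R by rewrite pnatr_eq0.
have cos_k2 i : cos (i.+2%:R * pi) = cos (i%:R * pi) :> R by rewrite !cos_natSpi opprK.
rewrite -mulr_suml sumrB; case: k km => [|k] km.
  under eq_bigr => j _ do rewrite mul0r cos0.
  rewrite (@sum_cos_pi m.+2 2%N); last lia.
  rewrite cos_k2 mul0r cos0 big_const_nat iter_addr addr0 -mulr_natr mul1r subn1 /=.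
  have -> : m.+1%:R = m.+2%:R - 1 :> R by rewrite -[m.+2%:R]natr1 addrK.
  by field.
have [->|km'] := eqVneq k m.
  rewrite [X in _ - X](eq_big_nat _ _ (F2 := fun j => cos (m.+1%:R * angle m j))).
    by rewrite subrr mul0r mulr0.
  move=> j _; rewrite (_ : m.+3%:R * _ = j%:R * pi + angle m j); last first.
    by rewrite -(angleE m) -[m.+3%:R]natr1; ring.
  rewrite (_ : m.+1%:R * _ = j%:R * pi - angle m j); last first.
    by rewrite -(angleE m) -[m.+2%:R]natr1; ring.
  by rewrite cosB cosD sin_natpi !mul0r subr0 addr0.
rewrite !sum_cos_pi; [|lia..].
by rewrite cos_k2 subrr mul0r mulr0.
Qed.

Lemma pathsum_end m t : pathsum m m.+1 t = 0.
Proof.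
rewrite /pathsum big1_seq ?mulr0 // => j _.
by rewrite angleE sin_natpi mulr0 mul0r.
Qed.

Lemma pathsum_rec m k t : pathsum m k.+1 t.+1 = pathsum m k t + pathsum m k.+2 t.
Proof.
rewrite /pathsum -mulrDr -big_split /=; congr (_ * _); apply: eq_bigr => j _.
rewrite exprS (_ : k.+1%:R * angle m j = k.+2%:R * angle m j - angle m j); last first.
  by rewrite -[k.+2%:R]natr1; ring.
rewrite (_ : k.+3%:R * angle m j = k.+2%:R * angle m j + angle m j); last first.
  by rewrite -[k.+3%:R]natr1; ring.
by rewrite sinB sinD; ring.
Qed.

Lemma pathsum_rec0 m t : pathsum m 0 t.+1 = pathsum m 1 t.
Proof.
rewrite /pathsum; congr (_ * _); apply: eq_bigr => j _.
rewrite exprS mul1r (_ : 2 * angle m j = angle m j + angle m j); last ring.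
by rewrite sinD; ring.
Qed.

(** Vertex [k] is out of reach in fewer than [k] steps. *)
Lemma pathsum_lt m k t : (t < k <= m.+1)%N -> pathsum m k t = 0.
Proof.
elim: t k => [|t IH] k /andP[tk km]; case: k tk km => // k tk km.
  by rewrite pathsum_0.
have [->|km'] := eqVneq k m; first exact: pathsum_end.
rewrite pathsum_rec !IH ?addr0 //; lia.
Qed.

Lemma pathsum_diag m k : (k <= m)%N -> pathsum m k k = 1.
Proof.
elim: k => [|k IH] km; first by rewrite pathsum_0.
rewrite pathsum_rec IH 1?ltnW // pathsum_lt ?addr0 //; lia.
Qed.

(* Generating functions of the walks from the end of the path to its vertex [k]. *)
Fixpoint path_ser m k : fps R :=
  if k is k'.+1 then path_ser m k' * (if (k <= m)%N then hser R (m - k) else 0)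
  else hser R m.

Lemma path_ser_end m : path_ser m m.+1 = 0.
Proof. by rewrite /= ltnn mulr0. Qed.

Lemma path_ser_rec m k : (k < m.+1)%N -> path_ser m k =
  (if k is k'.+1 then path_ser m k' else 1) + fps_var R * path_ser m k.+1.
Proof.
case: k => [|k] km /=.
  case: m km => [|m] _; first by rewrite ltnn !mulr0 addr0.
  by rewrite subn1 /= -/(hser R m.+1) {1}hserS; ring.
rewrite -ltnS km; case: ltnP => [km'|mk]; last first.
  have -> : (m - k.+1 = 0)%N by lia.
  by rewrite /= !mulr0 addr0 mulr1.
have -> : (m - k.+1 = (m - k.+2).+1)%N by lia.
by rewrite {1}hserS; ring.
Qed.

(** [X] marks the backward steps, so [n] of them make a walk of length [2 n + k]. Both sides satisfy
    the same recursion, in which order [n] at [k] calls order [n] at [k - 1] and order [n - 1] at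
    [k + 1]; hence the nested inductions. *)
Lemma path_serE m n k : (k <= m)%N -> path_ser m k n = pathsum m k (n.*2 + k).
Proof.
elim: n k => [|n IHn] k.
  elim: k => [|k IHk] km; rewrite (path_ser_rec (_ : _ < m.+1)%N) // fps_coefD fps_coefXM addr0.
    by rewrite pathsum_diag.
  by rewrite IHk ?(ltnW km) // !add0n !pathsum_diag // ltnW.
elim: k => [|k IHk] km; rewrite (path_ser_rec (_ : _ < m.+1)%N) // fps_coefD fps_coefXM.
  rewrite fps_coef1 add0r addn0 doubleS pathsum_rec0.
  case: m km IHn => [|m] _ IHn; first by rewrite path_ser_end pathsum_end.
  by rewrite IHn // addn1.
rewrite IHk 1?ltnW // addnS pathsum_rec; congr (_ + _).
have [<-|km'] := eqVneq k.+1 m; first by rewrite path_ser_end pathsum_end.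
by rewrite IHn; [rewrite doubleS !addnS !addSn | lia].
Qed.

Lemma hser_trig m n : hser R m n = 2 / m.+2%:R *
  \sum_(1 <= j < m.+2) sin (angle m j) ^+ 2 * (4 * cos (angle m j) ^+ 2) ^+ n.
Proof.
have := path_serE n (leq0n m); rewrite addn0 /= => ->; rewrite /pathsum; congr (_ * _); apply: eq_bigr => j _.
rewrite mul1r -expr2 -mul2n exprM (_ : (2 * cos _) ^+ 2 = 4 * cos (angle m j) ^+ 2) //; ring.
Qed.

(** Bounds on these partial sums that are uniform in [n] stand in for the value of the series at
    [rho]. *)
Definition fps_psum (rho : R) (f : fps R) n := \sum_(i < n.+1) f i * rho ^+ i.

Lemma fps_psumM rho (f g : fps R) n A B : 0 <= rho -> 0 <= B -> (forall i, 0 <= f i) ->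
  fps_psum rho f n <= A -> (forall k, (k <= n)%N -> fps_psum rho g k <= B) ->
  fps_psum rho (f * g) n <= A * B.
Proof.
move=> rho0 B0 f0 fA gB.
pose sc (h : fps R) : fps R := fun i => h i * rho ^+ i.
(* Partial sums are the coefficients of the product with [1 / (1 - X)], so associativity leaves
   partial sums of [g] alone. *)
have psE h k : fps_psum rho h k = (sc h * (fun=> 1) : fps R) k.
  by rewrite fps_coefM; apply: eq_bigr => i _; rewrite mulr1.
have scM : sc (f * g) = sc f * sc g.
  apply/funext => k; rewrite /sc !fps_coefM mulr_suml; apply: eq_bigr => i _.
  have ik : (i <= k)%N by rewrite -ltnS.
  by rewrite -[in rho ^+ k](subnKC ik) exprD; ring.
rewrite psE scM -mulrA fps_coefM; apply: (@le_trans _ _ (\sum_(i < n.+1) sc f i * B)).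
  apply: ler_sum => i _; apply: ler_wpM2l; first by rewrite mulr_ge0 ?exprn_ge0.
  by rewrite -psE gB // leq_subr.
by rewrite -mulr_suml; apply: ler_wpM2r.
Qed.

(** The bound is the value at [1 / (4 cos t ^ 2)] of the rational function [H_m]. In
    [H_(m+1) = 1 + X H_m H_(m+1)] the factor [X] bounds a partial sum of order [n.+1] by partial
    sums of order at most [n], so no convergence is invoked. *)
Lemma hser_psum_le (t : R) m n : 0 < cos t ->
  (forall j, (0 < j < m.+3)%N -> 0 < sin (j%:R * t)) ->
  fps_psum (4 * cos t ^+ 2)^-1 (hser R m) n <= 2 * cos t * sin (m.+1%:R * t) / sin (m.+2%:R * t).
Proof.
move=> c0; have rho0 : 0 <= (4 * cos t ^+ 2)^-1 by rewrite invr_ge0 mulr_ge0 // sqr_ge0.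
elim: m n => [|m IHm] n sj.
  rewrite mul1r (_ : 2 * t = t + t); last ring.
  have st : 0 < sin t by have := sj 1%N isT; rewrite mul1r.
  rewrite sinD (_ : sin t * cos t + _ = 2 * cos t * sin t); last ring.
  rewrite divff ?mulf_neq0 ?gt_eqF // /fps_psum big_ord_recl /= fps_coef1 /= mul1r expr0.
  by rewrite big1 ?addr0 // => i _; rewrite fps_coef1 /= mul0r.
have B0 j : (0 < j)%N -> (j.+1 < m.+4)%N -> 0 <= 2 * cos t * sin (j%:R * t) / sin (j.+1%:R * t).
  move=> j0 jm; apply: divr_ge0; [apply: mulr_ge0; first by rewrite mulr_ge0 // ltW|];
    by apply: ltW; apply: sj; lia.
elim: n {-2}n (leqnn n) => [|n IHn] k.
  rewrite leqn0 => /eqP ->; rewrite /fps_psum big_ord1 expr0 mulr1.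
  have -> : hser R m.+1 0%N = 1 by rewrite hserS fps_coefD fps_coef1 -mulrA fps_coefXM addr0.
  rewrite ler_pdivlMr ?mul1r; last by apply: sj; lia.
  rewrite -sin_prosthaphaeresis (_ : m.+2%:R * t + t = m.+3%:R * t); last first.
    by rewrite -[m.+3%:R]natr1; ring.
  rewrite lerDl (_ : m.+2%:R * t - t = m.+1%:R * t); last by rewrite -[m.+2%:R]natr1; ring.
  by apply: ltW; apply: sj; lia.
rewrite leq_eqVlt => /orP[/eqP ->|]; last exact: IHn.
set rho := (_)^-1; rewrite hserS /fps_psum big_ord_recl /= fps_coefD fps_coef1 -mulrA fps_coefXM.
rewrite addr0 expr0 mulr1.
under eq_bigr => i _.
  rewrite fps_coefD fps_coef1 add0r fps_coefXM exprS mulrCA.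
  over.
rewrite -mulr_sumr.
have bd : fps_psum rho (hser R m * hser R m.+1) n <=
    (2 * cos t * sin (m.+1%:R * t) / sin (m.+2%:R * t)) * (2 * cos t * sin (m.+2%:R * t) / sin (m.+3%:R * t)).
  apply: (fps_psumM rho0 (B0 m.+2 _ _) (@hser_ge0 R m)); [by [] | lia | | ].
  - by apply: IHm => j jm; apply: sj; lia.
  - by move=> i ik; apply: IHn; lia.
have s2 : 0 < sin (m.+2%:R * t) by apply: sj; lia.
have s3 : 0 < sin (m.+3%:R * t) by apply: sj; lia.
apply: (le_trans (lerD (lexx _) (ler_wpM2l rho0 bd))).
suff -> : sin (m.+1%:R * t) = 2 * cos t * sin (m.+2%:R * t) - sin (m.+3%:R * t).
  rewrite le_eqVlt; apply/orP; left; apply/eqP; rewrite /rho eqxx mulr1n; field.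
  by rewrite !gt_eqF.
rewrite -sin_prosthaphaeresis (_ : m.+2%:R * t + t = m.+3%:R * t); last first.
  by rewrite -[m.+3%:R]natr1; ring.
by rewrite addrAC subrr add0r; congr sin; rewrite -[m.+2%:R]natr1; ring.
Qed.

Lemma cos_pi_div_gt0 m : 0 < cos (pi / m.+3%:R : R).
Proof.
apply: cos_gt0_pihalf; have pi0 : 0 < pi :> R := pi_gt0 R.
apply/andP; split; first by rewrite (@lt_le_trans _ _ 0) // ?oppr_lt0 ?divr_ge0 ?divr_gt0 ?ltW.
by rewrite ltr_pM2l // ltf_pV2 ?posrE ?ltr0n // ltr_nat.
Qed.

(* [H_m] is evaluated at the singularity of [H_(m+1)], where it equals [1 / X]. *)
Lemma hser_exp_le m k n :
  (hser R m ^+ k) n <= (4 * cos (pi / m.+3%:R) ^+ 2) ^+ (n + k).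
Proof.
set t := pi / m.+3%:R : R; have c0 : 0 < cos t := cos_pi_div_gt0 m.
have t0 : 0 < t by rewrite divr_gt0 ?pi_gt0 ?ltr0n.
have mt : m.+3%:R * t = pi by rewrite /t mulrC divfK // pnatr_eq0.
have sj j : (0 < j < m.+3)%N -> 0 < sin (j%:R * t).
  move=> /andP[j0 jm]; apply: sin_gt0_pi; rewrite mulr_gt0 ?ltr0n //=.
  by rewrite -mt ltr_pM2r // ltr_nat.
have s1 : 0 < sin t by have := sj 1%N isT; rewrite mul1r.
have BE : 2 * cos t * sin (m.+1%:R * t) / sin (m.+2%:R * t) = 4 * cos t ^+ 2.
  rewrite (_ : m.+1%:R * t = pi - (t + t)); last by rewrite -mt -[m.+3%:R]natr1 -[m.+2%:R]natr1; ring.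
  rewrite (_ : m.+2%:R * t = pi - t); last by rewrite -mt -[m.+3%:R]natr1; ring.
  rewrite !sinB sinpi cospi sinD; field.
  by rewrite gt_eqF // mul0r sub0r mulN1r opprK.
have E0 : 0 < 4 * cos t ^+ 2 by rewrite mulr_gt0 // exprn_gt0.
have psum_k i : fps_psum (4 * cos t ^+ 2)^-1 (hser R m ^+ k) i <= (4 * cos t ^+ 2) ^+ k.
  elim: k i => [|j IHj] i.
    rewrite !expr0 /fps_psum big_ord_recl /= fps_coef1 /= mul1r expr0.
    by rewrite big1 ?addr0 // => l _; rewrite fps_coef1 /= mul0r.
  rewrite [hser R m ^+ _]exprS [(4 * _) ^+ _]exprS; apply: (fps_psumM _ _ (@hser_ge0 R m)).
  - by rewrite invr_ge0 ltW.
  - by rewrite exprn_ge0 // ltW.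
  - by rewrite -[leRHS]BE; apply: hser_psum_le.
  - by [].
rewrite exprD mulrC -ler_pdivrMr ?exprn_gt0 // -exprVn.
apply: le_trans (psum_k n); rewrite /fps_psum big_ord_recr /= lerDr sumr_ge0 // => i _.
by rewrite mulr_ge0 ?hser_exp_ge0 // exprn_ge0 // invr_ge0 ltW.
Qed.

End TrigSums.

(** * Elementary inequalities for the cosine and the exponential *)

Section TrigIneq.
Variable R : realType.
Implicit Types x : R.

Lemma le_of_derive_ge0 (f df : R -> R) (b : R) : 0 <= b ->
  (forall x, is_derive x 1 f (df x)) -> (forall x, 0 <= x <= b -> 0 <= df x) -> f 0 <= f b.
Proof.
rewrite le_eqVlt => /orP[/eqP <- //|b0] fdf df0.
have [|c] := @MVT R f df 0 b b0.
  apply: derivable_within_continuous => x _; exact: (@ex_derive _ _ _ _ _ _ _ (fdf x)).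
rewrite in_itv /= => /andP[c0 cb] E.
by rewrite -subr_ge0 E subr0 mulr_ge0 ?df0 ?ltW ?c0.
Qed.

Lemma sin_le_id x : 0 <= x -> sin x <= x.
Proof.
move=> x0; pose f (y : R) := y - sin y.
suff: f 0 <= f x by rewrite /f sin0 subr0 subr_ge0.
apply: (@le_of_derive_ge0 f (fun y => 1 - cos y)) => // y _.
Qed.

Lemma mulr_cos_le_sin x : 0 <= x <= pi -> x * cos x <= sin x.
Proof.
move=> /andP[x0 xpi]; pose f (y : R) := sin y - y * cos y.
suff: f 0 <= f x by rewrite /f sin0 mul0r subr0 subr_ge0.
apply: (@le_of_derive_ge0 f (fun y => y * sin y)) => // y.
  apply: is_derive_eq; rewrite /GRing.scale /=; ring.
by move=> /andP[y0 yx]; rewrite mulr_ge0 // sin_ge0_pi // y0 (le_trans yx).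
Qed.

(** [cos y * exp (y ^ 2 / 2)] is nonincreasing, because [y cos y <= sin y]. *)
Lemma cos_le_expR x : 0 <= x <= pi -> cos x <= expR (- (x ^+ 2 / 2)).
Proof.
move=> /andP[x0 xpi]; pose f (y : R) := - (cos y * expR (y ^+ 2 / 2)).
suff: f 0 <= f x.
  rewrite /f lerN2 cos0 expr0n /= mul0r expR0 mul1r => h.
  by rewrite expRN -[leRHS]mul1r ler_pdivlMr ?expR_gt0.
apply: (@le_of_derive_ge0 f (fun y => (sin y - y * cos y) * expR (y ^+ 2 / 2))) => // y.
  rewrite /f; apply: is_derive_eq.
  by rewrite /GRing.scale /=; field.
move=> /andP[y0 yx]; rewrite mulr_ge0 ?expR_ge0 // subr_ge0 mulr_cos_le_sin // y0 /=.
exact: le_trans yx _.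
Qed.

Lemma cos2_le_expR x : 0 <= x <= pi / 2 -> cos x ^+ 2 <= expR (- x ^+ 2).
Proof.
move=> /andP[x0 xpi]; have pi0 : 0 < pi :> R := pi_gt0 R.
have c0 : 0 <= cos x by apply: cos_ge0_pihalf; rewrite xpi andbT; lra.
have -> : - x ^+ 2 = - (x ^+ 2 / 2) + - (x ^+ 2 / 2) by field.
by rewrite expRD -expr2 ler_pXn2r ?nnegrE ?expR_ge0 // cos_le_expR // x0; lra.
Qed.

Lemma expRN_le x k : 0 < x -> expR (- x) <= k`!%:R / x ^+ k.
Proof.
move=> x0; rewrite expRN -[leRHS]invf_div lef_pV2 ?posrE ?expR_gt0 ?divr_gt0 ?exprn_gt0 ?ltr0n ?fact_gt0 //.
case: k => [|k]; first by rewrite expr0 divr1; have := expR_ge1Dx x; lra.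
by apply: le_trans (expR_ge1Dxn k (ltW x0)); rewrite lerDr.
Qed.

(** [1 / (1 - x) = 1 + x / (1 - x) <= exp (x / (1 - x))], and [x / (1 - x) <= x + 2 x ^ 2] up to
    [1 / 2]. *)
Lemma expR_le_1B x : 0 <= x <= 2^-1 -> expR (- (x + 2 * x ^+ 2)) <= 1 - x.
Proof.
move=> /andP[x0 x1]; have y0 : 0 < 1 - x by lra.
have := expR_ge1Dx (x / (1 - x)).
have -> : 1 + x / (1 - x) = (1 - x)^-1 by field; lra.
move=> h; rewrite -[leRHS]invrK -(ler_pV2 _ _) ?inE ?unitfE ?invr_gt0 ?expR_gt0 ?gt_eqF ?expR_gt0 ?invr_gt0 //.
rewrite invrK -expRN opprK; apply: (le_trans h); rewrite ler_expR.
rewrite ler_pdivrMr //; have : 0 <= x ^+ 2 * (1 - 2 * x) by rewrite mulr_ge0 ?sqr_ge0; lra.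
lra.
Qed.

End TrigIneq.

(** * Forests weighted by their height *)

(* [growth q k n] is the sum over the planar forests of [n] edges with [k] roots
   of [q ^ height]. *)
Section Growth.
Variables (R : realFieldType) (q : R).

(** Height exactly [m] is counted by the difference of the coefficients of [H_m ^ k] and
    [H_(m-1) ^ k]; this is the sum by parts over the heights up to [L]. *)
Definition growth_upto L k n : R :=
  (1 - q) * \sum_(m < L) q ^+ m * (hser R m ^+ k) n + q ^+ L * (hser R L ^+ k) n.

Definition growth k n : R := growth_upto n k n.

Lemma hser_exp_coef0 m k : (hser R m ^+ k) 0%N = 1.
Proof.
case: m => [|m]; first by rewrite expr1n fps_coef1.
by rewrite hser_expS big_ord1 bin0 mul1r expr0 fps_coef1.
Qed.

Lemma growth_upto0 L k : growth_upto L k 0 = 1.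
Proof.
rewrite /growth_upto hser_exp_coef0 mulr1.
under eq_bigr => m _ do rewrite hser_exp_coef0 mulr1.
elim: L => [|L IH]; first by rewrite big_ord0 mulr0 add0r.
by rewrite big_ord_recr /= mulrDr exprS -[RHS]IH; ring.
Qed.

Lemma growth_uptoS L k n : growth_upto L.+1 k n.+1 =
  q * \sum_(j < n.+1) 'C(k + j, j.+1)%:R * growth_upto L j.+1 (n - j)%N.
Proof.
have hS m : (hser R m.+1 ^+ k) n.+1 =
    \sum_(j < n.+1) 'C(k + j, j.+1)%:R * (hser R m ^+ j.+1) (n - j)%N.
  rewrite hser_expS big_ord_recl /= expr0 fps_coef1 /= mulr0 add0r.
  by apply: eq_bigr => j _; rewrite /bump /= add1n subSS addnS subn1.
rewrite /growth_upto big_ord_recl /= expr1n fps_coef1 /= mulr0 add0r.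
rewrite -/(hser R L.+1) hS.
under eq_bigr => m _ do rewrite -/(hser R _.+1) hS /bump /= add1n exprS -mulrA.
rewrite -mulr_sumr mulrCA exprS -mulrA -mulrDr; congr (_ * _).
rewrite (_ : (1 - q) * _ = \sum_(j < n.+1) 'C(k + j, j.+1)%:R *
    ((1 - q) * \sum_(i < L) q ^+ i * (hser R i ^+ j.+1) (n - j)%N)); last first.
  transitivity (\sum_(i < L) \sum_(j < n.+1) 'C(k + j, j.+1)%:R *
      ((1 - q) * (q ^+ i * (hser R i ^+ j.+1) (n - j)%N))).
    rewrite mulr_sumr; apply: eq_bigr => i _; rewrite add0n !mulr_sumr.
    by apply: eq_bigr => j _; ring.
  by rewrite exchange_big; apply: eq_bigr => j _; rewrite -!mulr_sumr.
rewrite mulr_sumr -big_split /=; apply: eq_bigr => j _.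
by rewrite mulrDr; congr (_ + _); rewrite mulrCA.
Qed.

(** A forest with [n] edges has height at most [n], so any larger cutoff gives the same sum. *)
Lemma growth_upto_stable L k n : (n <= L)%N -> growth_upto L k n = growth k n.
Proof.
elim/ltn_ind: n L k => -[|n] IH L k nL; first by rewrite /growth !growth_upto0.
case: L nL => [//|L nL]; rewrite /growth [LHS]growth_uptoS [RHS]growth_uptoS.
apply: (congr1 (fun x => q * x)).
apply: eq_bigr => j _; congr (_ * _); have jn := leq_subr j n.
transitivity (growth j.+1 (n - j)%N); first by apply: IH; rewrite ?(leq_trans jn).
by symmetry; apply: IH.
Qed.

Lemma growth0 k : growth k 0 = 1. Proof. exact: growth_upto0. Qed.

Lemma growthS k n : growth k n.+1 =
  q * \sum_(j < n.+1) 'C(k + j, j.+1)%:R * growth j.+1 (n - j)%N.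
Proof.
rewrite [LHS]growth_uptoS; apply: (congr1 (fun x => q * x)); apply: eq_bigr => j _; congr (_ * _).
exact/growth_upto_stable/leq_subr.
Qed.

Lemma growth_gt0 k n : 0 < q -> (0 < k)%N -> 0 < growth k n.
Proof.
move=> q0; elim/ltn_ind: n k => -[|n] IH k k0; first by rewrite growth0.
rewrite growthS mulr_gt0 // big_ord_recl ltr_wpDr //.
  apply: sumr_ge0 => j _; rewrite mulr_ge0 // ltW //; apply: IH => //.
  exact: leq_subr.
rewrite mulr_gt0 ?ltr0n ?bin_gt0 ?addn0 //; apply: IH => //.
by rewrite subn0.
Qed.

End Growth.

(** * Coefficients of the powers of [V] and their recursion *)

Section PowerCoefs.
Variable R : realType.

Definition vcoef m k n : R := (vser R m ^+ k) n / 4 ^+ n.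

(** The binomial expansion of [(2 X H_m) ^ k = (1 + V) ^ k]; the factor [X ^ k] moves the index to
    [n + k]. *)
Lemma hser_exp_vcoef m k n : (hser R m ^+ k) n / 4 ^+ n =
  2 ^+ k * \sum_(i < k.+1) 'C(k, i)%:R * vcoef m i (n + k).
Proof.
have E : 2%:R ^+ k * (fps_var R ^+ k * hser R m ^+ k) = \sum_(i < k.+1) 'C(k, i)%:R * vser R m ^+ i.
  rewrite -!exprMn (_ : 2 * _ = 1 + vser R m); last by rewrite /vser; ring.
  rewrite addrC exprDn_comm; last exact: mulrC.
  rewrite -(big_mkord xpredT (fun i => (vser R m ^+ (k - i) * 1 ^+ i) *+ 'C(k, i))) big_nat_rev add0n.
  rewrite big_mkord; apply: eq_bigr => i _.
  have ik : (i <= k)%N by rewrite -ltnS.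
  by rewrite expr1n mulr1 subSS subKn // bin_sub // mulr_natl.
have shift (f : fps R) j : (fps_var R ^+ k * f) (j + k)%N = f j.
  elim: k {E} => [|i IH]; first by rewrite expr0 mul1r addn0.
  by rewrite exprS -mulrA addnS fps_coefXM.
have := congr1 (fun f : fps R => f (n + k)%N) E.
rewrite fps_coef_sum -natrX fps_coef_natM shift natrX => E'.
rewrite /vcoef; under eq_bigr => i _ do rewrite mulrA -fps_coef_natM.
rewrite -mulr_suml -E' exprD mulrA; have -> : 4 ^+ k = 2 ^+ k * 2 ^+ k :> R.
  by rewrite -exprMn; congr (_ ^+ _); ring.
by field; rewrite !expf_neq0 ?pnatr_eq0.
Qed.

Lemma vcoef_rec m k n : (k.+1)%:R * (m.+2)%:R * vcoef m k.+2 n.+1 =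
  2 * (n%:R * vcoef m k.+1 n - (n.+1)%:R * vcoef m k.+1 n.+1)
  - (k.+1)%:R * vcoef m k.+1 n - (k.+1)%:R * (m.+2)%:R * (vcoef m k n - vcoef m k n.+1).
Proof.
rewrite /vcoef mulrA vser_exp_coef [4 ^+ n.+1]exprS; field.
by rewrite expf_neq0 ?pnatr_eq0.
Qed.

Lemma vcoef0 m n : (0 < n)%N -> vcoef m 0 n = 0.
Proof. by case: n => // n _; rewrite /vcoef expr0 fps_coef1 mul0r. Qed.

Lemma vcoef1 m n : vcoef m 1 n.+1 = (m.+2)%:R^-1 *
  \sum_(1 <= j < m.+2) sin (angle R m j) ^+ 2 * (cos (angle R m j) ^+ 2) ^+ n.
Proof.
rewrite /vcoef expr1 /vser fps_coefB fps_coef1 subr0 -mulrA fps_coef_natM fps_coefXM hser_trig.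
under eq_bigr => j _ do rewrite exprMn mulrCA.
rewrite -mulr_sumr exprS; field.
by rewrite -(natrD _ 2 m) pnatr_eq0 expf_neq0 ?pnatr_eq0.
Qed.

(* The recursion [vcoef_rec] in [k], started at the sequence [u]. *)
Fixpoint vrec (M : R) (u : nat -> R) k : nat -> R :=
  match k with
  | 0 => fun=> 0
  | k'.+1 => match k' with
    | 0 => u
    | k''.+1 => fun n =>
        2 / (k'%:R * M) * ((n.-1)%:R * vrec M u k' n.-1 - n%:R * vrec M u k' n)
        - vrec M u k' n.-1 / M - (vrec M u k'' n.-1 - vrec M u k'' n)
    end
  end.

Lemma vrecSS M u k n : vrec M u k.+2 n =
  2 / (k.+1%:R * M) * ((n.-1)%:R * vrec M u k.+1 n.-1 - n%:R * vrec M u k.+1 n)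
  - vrec M u k.+1 n.-1 / M - (vrec M u k n.-1 - vrec M u k n).
Proof. by []. Qed.

Lemma nat_ind2 (P : nat -> Prop) : P 0%N -> P 1%N -> (forall k, P k -> P k.+1 -> P k.+2) -> forall k, P k.
Proof.
move=> P0 P1 PS k; suff: P k /\ P k.+1 by case.
by elim: k => [|k [? ?]]; split => //; apply: PS.
Qed.

(** The bound [k < n] keeps every index reached by the recursion positive, where the coefficients of
    [V ^+ 0] vanish as [vrec] assumes. *)
Lemma vcoefE m k n : (k < n)%N -> vcoef m k n = vrec m.+2%:R (vcoef m 1) k n.
Proof.
elim/nat_ind2: k n => [n|//|k IH0 IH1 [|n] //] kn; first exact: vcoef0.
rewrite vrecSS -!IH1 -?IH0 //; [|lia..].
have M0 : m.+2%:R != 0 :> R by rewrite pnatr_eq0.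
have k0 : k.+1%:R != 0 :> R by rewrite pnatr_eq0.
apply: (mulfI (mulf_neq0 k0 M0)); rewrite vcoef_rec /=.
set M := m.+2%:R in M0 *; set K := k.+1%:R in k0 *; set N := n.+1%:R.
clearbody M K N; by field; rewrite k0 M0.
Qed.

(** Lets the leading term of [vcoef m 1] and the remainder go through the recursion separately. *)
Lemma vrec_linear M c u v k n :
  vrec M (fun i => c * u i + v i) k n = c * vrec M u k n + vrec M v k n.
Proof.
elim/nat_ind2: k n => [n|n|k IH0 IH1 n]; [by rewrite /= mulr0 addr0|by []|].
by rewrite !vrecSS !IH0 !IH1; ring.
Qed.

Lemma vrec_ext M u v k n : (forall i, (0 < i)%N -> u i = v i) -> (k < n)%N ->
  vrec M u k n = vrec M v k n.
Proof.
move=> uv; elim/nat_ind2: k n => [n|n|k IH0 IH1 [|n]] // kn; first exact: uv (ltnW kn).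
by rewrite !vrecSS !IH0 ?IH1 //; lia.
Qed.

Lemma vrec_step_le (K M N n B1 B0 a a' b b' : R) : 1 <= K -> 1 <= M -> 0 <= n <= N -> 1 <= N ->
  `|a| <= B1 -> `|a'| <= B1 -> `|b| <= B0 -> `|b'| <= B0 ->
  `|2 / (K * M) * (n * a - N * a') - a / M - (b - b')| <= 4 * N * B1 + B1 + 2 * B0.
Proof.
move=> K1 M1 /andP[n0 nN] N1 aB aB' bB bB'.
have M0 : 0 < M by lra.
have KM : 1 <= K * M by rewrite -[leLHS]mul1r ler_pM.
have c1 : `|2 / (K * M) * (n * a - N * a')| <= 4 * N * B1.
  rewrite normrM; have -> : 4 * N * B1 = 2 * (N * B1 + N * B1) by ring.
  apply: ler_pM => //.
    have KM0 : 0 < K * M by lra.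
    rewrite ger0_norm; last by rewrite divr_ge0 // ltW.
    rewrite ler_pdivrMr //.
    by rewrite ler_peMr.
  apply: (le_trans (ler_normB _ _)); have N0 : 0 <= N by lra.
  by rewrite !normrM (ger0_norm n0) (ger0_norm N0); apply: lerD; apply: ler_pM.
have c2 : `|a / M| <= B1.
  have Mi0 : 0 <= M^-1 by rewrite invr_ge0 ltW.
  rewrite normrM (ger0_norm Mi0).
  rewrite ler_pdivrMr // (le_trans aB) // ler_peMr // (le_trans _ aB) //.
have c3 : `|b - b'| <= 2 * B0.
  by apply: (le_trans (ler_normB _ _)); lra.
apply: (le_trans (ler_normB _ _)); apply: lerD => //.
by apply: (le_trans (ler_normB _ _)); apply: lerD.
Qed.

Lemma vrec_bound_le (nu : R) k j l a b : 0 <= nu <= 1 -> (j <= l)%N -> (b <= a)%N ->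
  7 ^+ k * j%:R ^+ k * nu ^+ a <= 7 ^+ k * l%:R ^+ k * nu ^+ b.
Proof.
move=> /andP[nu0 nu1] jl ba.
apply: ler_pM; rewrite ?exprn_ge0 ?mulr_ge0 ?exprn_ge0 //; last exact: ler_wiXn2l.
by rewrite ler_wpM2l ?exprn_ge0 // lerXn2r ?nnegrE ?ler_nat // ler0n.
Qed.

(** Each step costs at most a factor [7 n] and one unit of the exponent: with [B1 = 7 N B0] the
    recursion gives at most [(28 + 7 + 2) N ^ 2 B0], below [49 N ^ 2 B0]. This crude bound is only
    meant for the remainder. *)
Lemma vrec_le (M : R) u (nu : R) k n : 1 <= M -> 0 <= nu <= 1 ->
  (forall i, (0 < i)%N -> `|u i| <= nu ^+ (i - 1)) -> (k < n)%N ->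
  `|vrec M u k n| <= 7 ^+ k * n%:R ^+ k * nu ^+ (n - k).-1.
Proof.
move=> M1 nu01 hu; have /andP[nu0 nu1] := nu01; have M0 : 0 < M by lra.
have Mi : 0 <= M^-1 <= 1 by rewrite invr_ge0 ltW //= invf_le1.
elim/nat_ind2: k n => [n|n n1|k IH0 IH1 [//|n] kn].
- by rewrite /= normr0 mulr_ge0 // ?exprn_ge0 // mulr_ge0 // exprn_ge0.
- apply: (le_trans (hu _ (ltnW n1))); rewrite /= !expr1.
  apply: (@le_trans _ _ (nu ^+ (n - 1).-1)); first by rewrite ler_wiXn2l // leq_pred.
  rewrite ler_peMl ?exprn_ge0 //.
  have : 1 <= n%:R :> R by rewrite ler1n ltnW.
  lra.
have [nk d1 d2 d3 d4] : [/\ (k.+1 < n)%N, ((n.+1 - k.+2).-1 <= (n - k.+1).-1)%N,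
    ((n.+1 - k.+2).-1 <= (n.+1 - k.+1).-1)%N, ((n.+1 - k.+2).-1 <= (n - k).-1)%N &
    ((n.+1 - k.+2).-1 <= (n.+1 - k).-1)%N] by clear -kn; split; lia.
set N := n.+1%:R : R; set e := nu ^+ (n.+1 - k.+2).-1.
have N1 : 1 <= N by rewrite /N ler1n.
have e0 : 0 <= e by rewrite exprn_ge0.
have nN : n%:R <= N by rewrite ler_nat.
set B1 := 7 ^+ k.+1 * N ^+ k.+1 * e; set B0 := 7 ^+ k * N ^+ k * e.
have b1n : `|vrec M u k.+1 n| <= B1.
  by apply: le_trans (IH1 n nk) _; apply: vrec_bound_le nu01 _ d1; exact: leqnSn.
have b1S : `|vrec M u k.+1 n.+1| <= B1.
  by apply: le_trans (IH1 n.+1 (ltnW nk)) _; apply: vrec_bound_le nu01 _ d2; exact: leqnn.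
have b0n : `|vrec M u k n| <= B0.
  by apply: le_trans (IH0 n (ltnW nk)) _; apply: vrec_bound_le nu01 _ d3; exact: leqnSn.
have b0S : `|vrec M u k n.+1| <= B0.
  by apply: le_trans (IH0 n.+1 (ltnW (ltnW nk))) _; apply: vrec_bound_le nu01 _ d4; exact: leqnn.
have B10 : 0 <= B1 by apply: le_trans b1n.
have B00 : 0 <= B0 by apply: le_trans b0n.
rewrite vrecSS [n.+1.-1]/=.
apply: (le_trans (vrec_step_le _ M1 _ N1 b1n b1S b0n b0S)); rewrite ?ler1n ?ler0n //.
have E1 : B1 = 7 * N * B0 by rewrite /B1 /B0 !exprS; ring.
have -> : 7 ^+ k.+2 * N ^+ k.+2 * e = 49 * N ^+ 2 * B0 by rewrite /B0 !exprS expr0; ring.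
have h1 : B0 <= N * B0 by rewrite ler_peMl.
have h2 : N * B0 <= N * (N * B0) by rewrite ler_peMl // mulr_ge0 // (le_trans ler01).
have h3 : N ^+ 2 * B0 = N * (N * B0) by ring.
have h4 : 4 * N * B1 = 28 * (N * (N * B0)) by rewrite E1; ring.
have h5 : B1 = 7 * (N * B0) by rewrite E1; ring.
rewrite -[49 * _ * _]mulrA h3; lra.
Qed.

(* [vrec] applied to [la ^+ n] is [la ^+ n] times a polynomial in [n]; here [s = 1 / la]. *)
Fixpoint vpol (M s : R) k : R -> R :=
  match k with
  | 0 => fun=> 0
  | k'.+1 => match k' with
    | 0 => fun=> 1
    | k''.+1 => fun x =>
        2 / (k'%:R * M) * (s * ((x - 1) * vpol M s k' (x - 1)) - x * vpol M s k' x)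
        - s * vpol M s k' (x - 1) / M - (s * vpol M s k'' (x - 1) - vpol M s k'' x)
    end
  end.

Lemma vrec_geo (M la : R) k n : la != 0 -> (k < n)%N ->
  vrec M (fun i => la ^+ i) k n = la ^+ n * vpol M la^-1 k n%:R.
Proof.
move=> la0; elim/nat_ind2: k n => [n|n|k IH0 IH1 [|n]] // kn; [by rewrite /= mulr0|by rewrite /= mulr1|].
rewrite vrecSS !IH1 -?IH0 ?IH0 //; [|lia..].
rewrite /= -[in _.+1%:R - 1]natr1 addrK exprS.
rewrite -/(vpol M la^-1 k.+1); set a := 2 / _.
set f := vpol _ _ k.+1; set g := vpol _ _ k; set N := n.+1%:R.
have E : la^-1 * la = 1 by rewrite mulVf.
set li := la^-1 in E *.
transitivity (la ^+ n * ((a * ((li * la) * (n%:R * f n%:R) - la * (N * f N))) - (li * la) * f n%:R / M -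
  ((li * la) * g n%:R - la * g N))); last ring.
by rewrite E; ring.
Qed.

End PowerCoefs.

Lemma cvg_exp (R : realType) (T : Type) (F : set_system T) {FF : Filter F} (f : T -> R) (l : R) k :
  f x @[x --> F] --> l -> f x ^+ k @[x --> F] --> l ^+ k.
Proof. by move=> fl; apply: (@cvg_comp _ _ _ f (fun x => x ^+ k) _ _ _ fl); exact: exprn_continuous. Qed.

Lemma cvg_near_eq (R : realType) (T : Type) (F : set_system T) {FF : Filter F} (f g : T -> R) (l : R) :
  (\forall x \near F, f x = g x) -> f x @[x --> F] --> l -> g x @[x --> F] --> l.
Proof.
move=> fg; apply: cvg_trans; apply: near_eq_cvg.
by apply: filterS fg => x ->.
Qed.

(** * Saddle point asymptotics *)

Section Window.
Variables (R : realType) (mu : R) (hmu : 0 < mu).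

(* The heights which dominate are [p ^ 4 (1 + O (1 / p))], where
   [2 pi ^ 2 n = mu p ^ 12] is the saddle point equation. *)
Definition wscale n : R := (2 * pi ^+ 2 * n%:R / mu) `^ 12^-1.

Lemma wscale_ge0 n : 0 <= wscale n. Proof. exact: powR_ge0. Qed.

Lemma wscale_exp n : wscale n ^+ 12 = 2 * pi ^+ 2 * n%:R / mu.
Proof.
have A0 : 0 <= 2 * pi ^+ 2 * n%:R / mu.
  by rewrite divr_ge0 ?(ltW hmu) // mulr_ge0 // mulr_ge0 // sqr_ge0.
by rewrite -powR_mulrn ?wscale_ge0 // /wscale -powRrM mulVf ?pnatr_eq0 // powRr1.
Qed.

Lemma wscale_natE n : n%:R = mu / (2 * pi ^+ 2) * wscale n ^+ 12.
Proof. have p0 : pi != 0 :> R by rewrite gt_eqF // pi_gt0.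
have m0 : mu != 0 by rewrite gt_eqF.
by rewrite wscale_exp; move: (pi : R) p0 => P p0; field; rewrite ?p0 ?m0. Qed.

Lemma wscale_dvg : wscale n @[n --> \oo] --> +oo.
Proof.
apply/cvgryPge => A.
have [N HN] : exists N : nat, mu / (2 * pi ^+ 2) * `|A| ^+ 12 < N%:R.
  by exists (Num.bound (mu / (2 * pi ^+ 2) * `|A| ^+ 12)); apply/archi_boundP;
    rewrite mulr_ge0 ?exprn_ge0 // divr_ge0 ?(ltW hmu) // mulr_ge0 ?sqr_ge0.
near=> n.
have Nn : (N <= n)%N by near: n; exact: nbhs_infty_ge.
rewrite (le_trans (ler_norm A)) // leNgt; apply/negP => pA.
have : wscale n ^+ 12 <= `|A| ^+ 12 by rewrite lerXn2r ?nnegrE ?wscale_ge0 // ltW.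
have c0 : 0 < mu / (2 * pi ^+ 2) by rewrite divr_gt0 // mulr_gt0 // exprn_gt0 // pi_gt0.
rewrite -(ler_pM2l c0) -wscale_natE leNgt (lt_le_trans HN) //.
by rewrite ler_nat.
Unshelve. all: by end_near. Qed.

Lemma wscale_ge A : \forall n \near \oo, A <= wscale n.
Proof. by have /cvgryPge := wscale_dvg; apply. Qed.

Lemma wscaleV0 : (wscale n)^-1 @[n --> \oo] --> (0 : R).
Proof.
apply/gtr0_cvgV0; last exact: wscale_dvg.
near=> n; apply: (@lt_le_trans _ _ 1) => //.
by near: n; exact: wscale_ge.
Unshelve. all: by end_near. Qed.

(** It is centred on [m + 3] rather than [M = m + 2], because [m + 3] is the denominator in
    [hser_exp_le], the bound used outside the window. *)
Definition win n m := `|m.+3%:R - wscale n ^+ 4| <= wscale n ^+ 3.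

(** A limit along this filter is a limit in [n] that is uniform over the window, so the usual
    calculus of limits keeps track of the uniformity. *)
Definition winF : set_system (nat * nat) :=
  [set A | \forall n \near \oo, forall m, win n m -> A (n, m)].

Global Instance winF_filter : Filter winF.
Proof.
split.
- by apply: nearW.
- move=> A B hA hB; rewrite /winF /=; near=> n => m hm; split.
  + by move: m hm; near: n.
  + by move: m hm; near: n.
- move=> A B AB hA; rewrite /winF /=; near=> n => m hm; apply: AB.
  by move: m hm; near: n.
Unshelve. all: by end_near. Qed.

Lemma winF_sub (P Q : nat * nat -> Prop) : (forall z, P z -> Q z) ->
  (\forall z \near winF, P z) -> \forall z \near winF, Q z.
Proof. by move=> PQ; exact: filterS. Qed.

Lemma near_winF (P : nat * nat -> Prop) :
  (\forall n \near \oo, forall m, win n m -> P (n, m)) -> \forall z \near winF, P z.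
Proof. by []. Qed.

Lemma cvg_winF_dist (g : nat * nat -> R) (l e : R) : g z @[z --> winF] --> l -> 0 < e ->
  \forall z \near winF, `|g z - l| < e.
Proof. by move=> /cvgrPdist_lt h e0; have := h e e0; apply: filterS => z; rewrite distrC. Qed.

Lemma cvg_fst_winF : z.1 @[z --> winF] --> \oo.
Proof. by move=> A hA; apply: filterS hA => n An m _. Qed.

Lemma near_winF_fst (P : nat -> Prop) : (\forall n \near \oo, P n) -> \forall z \near winF, P z.1.
Proof. by move=> hP; exact: (cvg_fst_winF hP). Qed.

Lemma near_winF_win : \forall z \near winF, win z.1 z.2.
Proof. by apply: near_winF; apply: nearW. Qed.

Lemma cvg_winF_fst (f : nat -> R) (l : R) : f n @[n --> \oo] --> l -> f z.1 @[z --> winF] --> l.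
Proof. by move=> fl; apply: (cvg_comp _ _ cvg_fst_winF fl). Qed.

Lemma near_wscale_gt0 : \forall z \near winF, 1 <= wscale z.1.
Proof. exact: (near_winF_fst (wscale_ge 1)). Qed.

Definition wu (z : nat * nat) := (wscale z.1)^-1.
Definition wM (z : nat * nat) : R := z.2.+2%:R.
Local Notation u := wu.
Local Notation M := wM.

Lemma cvg_u : u z @[z --> winF] --> (0 : R).
Proof. exact: (cvg_winF_fst wscaleV0). Qed.

Lemma cvg_Mu4 : M z * u z ^+ 4 @[z --> winF] --> (1 : R).
Proof.
have H : M z * u z ^+ 4 + u z ^+ 4 @[z --> winF] --> (1 : R).
  apply: (@squeeze_cvgr _ _ _ _ (fun z => 1 - u z) (fun z => 1 + u z)).
  - near=> z; have p1 : 1 <= wscale z.1 by near: z; exact: near_wscale_gt0.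
    have : win z.1 z.2 by near: z; exact: near_winF_win.
    rewrite /win /wu /wM; set p := wscale z.1 in p1 *; have p0 : p != 0 by rewrite gt_eqF // (lt_le_trans ltr01).
    have -> : z.2.+2%:R * p^-1 ^+ 4 + p^-1 ^+ 4 = z.2.+3%:R / p ^+ 4 :> R.
      by rewrite -[z.2.+3%:R]natr1; field.
    have p40 : 0 < p ^+ 4 by rewrite exprn_gt0 // (lt_le_trans ltr01).
    rewrite ler_distl => /andP[h1 h2]; rewrite ler_pdivlMr // ler_pdivrMr //.
    have -> : (1 - p^-1) * p ^+ 4 = p ^+ 4 - p ^+ 3 by field.
    have -> : (1 + p^-1) * p ^+ 4 = p ^+ 4 + p ^+ 3 by field.
    by rewrite h1 h2.
  - by rewrite -[X in _ --> X](subr0 1); apply: cvgB; [exact: cvg_cst|exact: cvg_u].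
  - by rewrite -[X in _ --> X](addr0 1); apply: cvgD; [exact: cvg_cst|exact: cvg_u].
have U : u z ^+ 4 @[z --> winF] --> (0 : R).
  rewrite (_ : 0 = 0 ^+ 4); last by rewrite expr0n.
  by apply: cvg_exp; exact: cvg_u.
rewrite -[X in _ --> X](subr0 1); apply: (cvg_near_eq _ (cvgB H U)).
by apply: nearW => z /=; rewrite addrK.
Unshelve. all: by end_near. Qed.

Lemma near_u_gt0 : \forall z \near winF, 0 < u z.
Proof.
by apply: filterS near_wscale_gt0 => z p1; rewrite invr_gt0 (lt_le_trans ltr01).
Qed.

Lemma cvg_MV : (M z)^-1 @[z --> winF] --> (0 : R).
Proof.
have H : u z ^+ 4 * (M z * u z ^+ 4)^-1 @[z --> winF] --> (0 : R).
  rewrite (_ : 0 = 0 ^+ 4 * 1^-1); last by rewrite expr0n mul0r.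
  apply: cvgM; first by apply: cvg_exp; exact: cvg_u.
  by apply: cvgV; [rewrite oner_eq0 | exact: cvg_Mu4].
apply: cvg_near_eq H; apply: filterS near_u_gt0 => z u0.
have M0 : M z != 0 by rewrite pnatr_eq0.
have u1 : u z != 0 by rewrite gt_eqF.
by move: (M z) (u z) M0 u1 => M' u' M0 u1; field; rewrite ?M0 ?u1.
Qed.

Definition wth z : R := pi / M z.
Local Notation th := wth.

Lemma th_gt0 z : 0 < th z. Proof. by rewrite divr_gt0 ?pi_gt0 ?ltr0n. Qed.

Lemma th_le z : th z <= pi / 2.
Proof. by rewrite ler_pM2l ?pi_gt0 // lef_pV2 ?posrE ?ltr0n // ler_nat. Qed.

Lemma cvg_th : th z @[z --> winF] --> (0 : R).
Proof.
by rewrite -[X in _ --> X](mulr0 pi); apply: cvgM; [exact: cvg_cst|exact: cvg_MV].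
Qed.

Lemma cvg_cos : cos (th z) @[z --> winF] --> (1 : R).
Proof. by rewrite -cos0; apply: (@cvg_comp _ _ _ th cos _ _ _ cvg_th); exact: continuous_cos. Qed.

Lemma cvg_sinc : sin (th z) / th z @[z --> winF] --> (1 : R).
Proof.
have pi0 := pi_gt0 R.
apply: (@squeeze_cvgr _ _ _ _ (fun z => cos (th z)) (fun=> 1)); [|exact: cvg_cos|exact: cvg_cst].
apply: nearW => z; have t0 := th_gt0 z; have t1 := th_le z.
rewrite ler_pdivlMr // ler_pdivrMr // mul1r; apply/andP; split; last by rewrite sin_le_id // ltW.
by rewrite mulrC mulr_cos_le_sin // ltW //=; lra.
Qed.

Definition wlam (z : nat * nat) : R := cos (pi / z.2.+2%:R) ^+ 2.
(** For [M > 2] this is [tan (pi / M) ^ 2]. *)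
Definition wtau z : R := (wlam z)^-1 - 1.

Lemma near_M_ge k : \forall z \near winF, (k <= z.2)%N.
Proof.
have k0 : 0 < k.+2%:R^-1 :> R by rewrite invr_gt0 ltr0n.
have := cvg_winF_dist cvg_MV k0; apply: winF_sub => z; rewrite subr0.
rewrite ger0_norm ?invr_ge0 // /wM ltf_pV2 ?posrE ?ltr0n // ltr_nat => h; lia.
Qed.

Lemma near_wlam_gt0 : \forall z \near winF, 0 < wlam z.
Proof.
apply: filterS (near_M_ge 1) => -[n [//|m]] _; rewrite exprn_gt0 //; exact: cos_pi_div_gt0.
Qed.

Lemma wlam_ge0 z : 0 <= wlam z. Proof. exact: sqr_ge0. Qed.

Lemma cvg_wlam : wlam z @[z --> winF] --> (1 : R).
Proof. by rewrite -(expr1n R 2); apply: cvg_exp; exact: cvg_cos. Qed.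

Lemma cvg_wlamV : (wlam z)^-1 @[z --> winF] --> (1 : R).
Proof. by rewrite -[X in _ --> X]invr1; apply: cvgV; [rewrite oner_eq0|exact: cvg_wlam]. Qed.

Lemma cvg_wtau : wtau z @[z --> winF] --> (0 : R).
Proof. by rewrite -(subrr (1 : R)); apply: cvgB; [exact: cvg_wlamV|exact: cvg_cst]. Qed.

Lemma cvg_wtauM2 : wtau z * M z ^+ 2 @[z --> winF] --> (pi ^+ 2 : R).
Proof.
have H : pi ^+ 2 * (sin (th z) / th z) ^+ 2 * (wlam z)^-1 @[z --> winF] --> (pi ^+ 2 * 1 ^+ 2 * 1 : R).
  apply: cvgM; last exact: cvg_wlamV.
  by apply: cvgM; [exact: cvg_cst|apply: cvg_exp; exact: cvg_sinc].
rewrite expr1n !mulr1 in H; apply: cvg_near_eq H; apply: filterS near_wlam_gt0 => z l0.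
have M0 : M z != 0 by rewrite pnatr_eq0.
have p0 : pi != 0 :> R by rewrite gt_eqF // pi_gt0.
have l1 : wlam z != 0 by rewrite gt_eqF.
have -> : wtau z = sin (th z) ^+ 2 / wlam z.
  rewrite sin2cos2 /wtau -/(wlam z); move: (wlam z) l1 => l l1; field; exact: l1.
set s := sin (th z); rewrite /wth; move: (M z) (pi : R) (wlam z) s M0 p0 l1 => M' P l s M0 p0 l1.
by field; rewrite ?M0 ?p0 ?l1.
Qed.

(** The saddle point equation: [n tau / M] is close to [n pi ^ 2 / M ^ 3]. Only through this limit
    does [mu] enter the limits of the coefficient ratios. *)
Lemma cvg_ratio : z.1.+1%:R * wtau z / M z @[z --> winF] --> (mu / 2 : R).
Proof.
have H : mu / (2 * pi ^+ 2) * (wtau z * M z ^+ 2) * ((M z * u z ^+ 4)^-1) ^+ 3 + wtau z * (M z)^-1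
    @[z --> winF] --> (mu / (2 * pi ^+ 2) * (pi ^+ 2) * (1^-1) ^+ 3 + 0 * 0 : R).
  apply: cvgD; last by apply: cvgM; [exact: cvg_wtau | exact: cvg_MV].
  apply: cvgM; first by apply: cvgM; [exact: cvg_cst | exact: cvg_wtauM2].
  by apply: cvg_exp; apply: cvgV; [rewrite oner_eq0 | exact: cvg_Mu4].
have p0 : pi != 0 :> R by rewrite gt_eqF // pi_gt0.
rewrite (_ : _ + 0 * 0 = mu / 2) in H; last first.
  by move: (pi : R) p0 => P p0; rewrite invr1 expr1n; field; rewrite ?p0.
apply: cvg_near_eq H; apply: filterS near_u_gt0 => z u0.
rewrite -[z.1.+1%:R]natr1 (wscale_natE z.1) -[wscale z.1]invrK -/(u z).
have M0 : M z != 0 by rewrite pnatr_eq0.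
have u1 : u z != 0 by rewrite gt_eqF.
move: (pi : R) (M z) (u z) (wtau z) p0 M0 u1 => P M' u' t p0 M0 u1.
by field; rewrite ?p0 ?M0 ?u1.
Qed.

Implicit Types f : R -> nat * nat -> R.

Definition wbnd (g : nat * nat -> R) := exists C : R, \forall z \near winF, `|g z| <= C.

Lemma wbnd_cvg (g : nat * nat -> R) (l : R) : g z @[z --> winF] --> l -> wbnd g.
Proof.
move=> gl; exists (`|l| + 1).
have := cvg_winF_dist gl ltr01; apply: winF_sub => z h.
rewrite -[g z](subrK l) addrC; apply: (le_trans (ler_normD _ _)).
by rewrite lerD2l ltW.
Qed.

Lemma wbnd_cst c : wbnd (fun=> c).
Proof. by exists `|c|; apply: nearW. Qed.

Lemma wbndD (g1 g2 : nat * nat -> R) : wbnd g1 -> wbnd g2 -> wbnd (fun z => g1 z + g2 z).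
Proof.
move=> [C1 h1] [C2 h2]; exists (C1 + C2); apply: filterS2 h1 h2 => z a b.
by apply: (le_trans (ler_normD _ _)); rewrite lerD.
Qed.

Lemma wbndM (g1 g2 : nat * nat -> R) : wbnd g1 -> wbnd g2 -> wbnd (fun z => g1 z * g2 z).
Proof.
move=> [C1 h1] [C2 h2]; exists (C1 * C2); apply: filterS2 h1 h2 => z a b.
by rewrite normrM ler_pM.
Qed.

Lemma cvg0_wbnd (g1 g2 : nat * nat -> R) : g1 z @[z --> winF] --> (0 : R) -> wbnd g2 ->
  g1 z * g2 z @[z --> winF] --> (0 : R).
Proof.
move=> h1 [C h2].
have C0 : 0 <= `|C| := normr_ge0 C.
have E : `|g1 z| * `|C| @[z --> winF] --> (0 : R).
  by rewrite -(mul0r `|C|); apply: cvgM; [rewrite -(normr0 R); apply: cvg_norm|exact: cvg_cst].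
apply: (@squeeze_cvgr _ _ _ _ (fun z => - (`|g1 z| * `|C|)) (fun z => `|g1 z| * `|C|)) => //.
  apply: filterS h2 => z hz; rewrite -ler_norml normrM ler_wpM2l //.
  by rewrite (le_trans hz) // ler_norm.
by rewrite -(oppr0 R); apply: cvgN.
Qed.

Definition wdiff f : R -> nat * nat -> R := fun x z => z.1.+1%:R * (f (x - 1) z - f x z).

(* [wdiff] is the backward difference rescaled by [n], which keeps every power of [x / n] bounded. *)
Definition wreg f := forall i c, wbnd (fun z => iter i wdiff f (z.1%:R + c) z).

Lemma wreg_cst c : wreg (fun _ _ => c).
Proof.
move=> [|i] d; first exact: wbnd_cst.
have E j : iter j.+1 wdiff (fun _ _ => c) = fun _ _ => 0.
  elim: j => [|j IH]; first by rewrite /= /wdiff; apply/funext => x; apply/funext => z; rewrite subrr mulr0.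
  by rewrite iterS IH /wdiff; apply/funext => x; apply/funext => z; rewrite subrr mulr0.
by rewrite E; exact: wbnd_cst.
Qed.

Lemma wreg_shift f : wreg f -> wreg (fun x => f (x - 1)).
Proof.
move=> rf i c; have E : iter i wdiff (fun x => f (x - 1)) = fun x => iter i wdiff f (x - 1).
  by elim: i => // i IH; rewrite !iterS IH.
by rewrite E; have := rf i (c - 1); under eq_fun do rewrite addrA.
Qed.

Lemma wreg_diff f : wreg f -> wreg (wdiff f).
Proof. by move=> rf i c; have := rf i.+1 c; rewrite iterSr. Qed.

Lemma wregD f (g : R -> nat * nat -> R) : wreg f -> wreg g -> wreg (fun x z => f x z + g x z).
Proof.
move=> rf rg i c.
have E : iter i wdiff (fun x z => f x z + g x z) = fun x z => iter i wdiff f x z + iter i wdiff g x z.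
  elim: i => // i IH; rewrite !iterS IH; apply/funext => x; apply/funext => z.
  by rewrite /wdiff; ring.
by rewrite E; apply: wbndD.
Qed.

Lemma wregZ a f : wbnd a -> wreg f -> wreg (fun x z => a z * f x z).
Proof.
move=> ba rf i c.
have E : iter i wdiff (fun x z => a z * f x z) = fun x z => a z * iter i wdiff f x z.
  elim: i => // i IH; rewrite !iterS IH; apply/funext => x; apply/funext => z.
  by rewrite /wdiff; ring.
by rewrite E; apply: wbndM.
Qed.

Lemma wreg_eq f (g : R -> nat * nat -> R) : (forall x z, f x z = g x z) -> wreg f -> wreg g.
Proof. by move=> fg; suff -> : f = g by []; apply/funext => x; apply/funext => z. Qed.

Lemma wscale_natV : (z.1.+1%:R)^-1 @[z --> winF] --> (0 : R).
Proof.
apply: (@cvg_winF_fst (fun n => n.+1%:R^-1)).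
have := @cvg_harmonic R; exact.
Qed.

Lemma cvg_natc c : (z.1%:R + c) / z.1.+1%:R @[z --> winF] --> (1 : R).
Proof.
have H : 1 + (c - 1) * (z.1.+1%:R)^-1 @[z --> winF] --> (1 + (c - 1) * 0 : R).
  by apply: cvgD; [exact: cvg_cst|apply: cvgM; [exact: cvg_cst|exact: wscale_natV]].
rewrite mulr0 addr0 in H; apply: cvg_near_eq H; apply: nearW => z.
have n0 : z.1.+1%:R != 0 :> R by rewrite pnatr_eq0.
rewrite -[z.1%:R](addrK 1) natr1; move: (z.1.+1%:R : R) n0 => n n0.
by field.
Qed.

Definition wmulX f : R -> nat * nat -> R := fun x z => x / z.1.+1%:R * f x z.

(** Leibniz' rule with an affine factor, whose second difference is zero. *)
Lemma iter_wdiff_mulX f i : iter i wdiff (wmulX f) = fun x z => x / z.1.+1%:R * iter i wdiff f x z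
  - i%:R * (if i is j.+1 then iter j wdiff f (x - 1) z else 0).
Proof.
elim: i => [|i IH]; first by apply/funext => x; apply/funext => z; rewrite mulr0 subr0.
rewrite iterS IH; apply/funext => x; apply/funext => z; rewrite /wdiff.
have n0 : z.1.+1%:R != 0 :> R by rewrite pnatr_eq0.
case: i {IH} => [|i].
  by rewrite /= /wdiff; move: (z.1.+1%:R : R) n0 => n n0; field.
rewrite -[i.+2%:R]natr1 !iterS /wdiff -/wdiff.
by move: (z.1.+1%:R : R) n0 => n n0; field.
Qed.

Lemma wreg_mulX f : wreg f -> wreg (wmulX f).
Proof.
move=> rf i c; rewrite iter_wdiff_mulX.
apply: wbndD; first by apply: wbndM; [exact: wbnd_cvg (cvg_natc c) | exact: rf].
case: i => [|i]; first by under eq_fun do rewrite mul0r oppr0; exact: wbnd_cst.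
under eq_fun do rewrite -mulNr.
by apply: wbndM; [exact: wbnd_cst|under eq_fun do rewrite -addrA; exact: rf].
Qed.

Definition wpol k : R -> nat * nat -> R := fun x z => vpol (M z) (wlam z)^-1 k x.

(** Writing [1 / lam = 1 + tau] splits each expression [g (x - 1) / lam - g x] into
    [tau * g (x - 1)] and a difference. After rescaling by [n], every coefficient converges along
    the window and only [n tau / M] has a nonzero limit. *)
Lemma wpolSS k x z : wpol k.+2 x z = 2 / k.+1%:R *
   (z.1.+1%:R * wtau z / M z * wmulX (wpol k.+1) (x - 1) z + (M z)^-1 * wdiff (wmulX (wpol k.+1)) x z)
   - (wlam z)^-1 / M z * wpol k.+1 (x - 1) z
   - (wtau z * wpol k (x - 1) z + (z.1.+1%:R)^-1 * wdiff (wpol k) x z).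
Proof.
have n0 : z.1.+1%:R != 0 :> R by rewrite pnatr_eq0.
have M0 : M z != 0 by rewrite pnatr_eq0.
have k0 : k.+1%:R != 0 :> R by rewrite pnatr_eq0.
have -> : wpol k.+2 x z = 2 / (k.+1%:R * M z) * ((wlam z)^-1 * ((x - 1) * wpol k.+1 (x - 1) z)
   - x * wpol k.+1 x z) - (wlam z)^-1 * wpol k.+1 (x - 1) z / M z
   - ((wlam z)^-1 * wpol k (x - 1) z - wpol k x z) by [].
rewrite /wdiff /wmulX /wtau.
move: (z.1.+1%:R : R) (M z) (k.+1%:R : R) (wlam z)^-1 n0 M0 k0 => n M' K l n0 M0 k0.
move: (wpol k.+1 (x - 1) z) (wpol k.+1 x z) (wpol k (x - 1) z) (wpol k x z) => a b c d.
by field; rewrite ?n0 ?M0 ?k0.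
Qed.

Lemma wbnd_coefs : [/\ wbnd (fun z => z.1.+1%:R * wtau z / M z), wbnd (fun z => (M z)^-1),
  wbnd (fun z => (wlam z)^-1 / M z), wbnd wtau & wbnd (fun z => (z.1.+1%:R)^-1)].
Proof.
split; [exact: wbnd_cvg cvg_ratio | exact: wbnd_cvg cvg_MV | | exact: wbnd_cvg cvg_wtau |
  exact: wbnd_cvg wscale_natV].
by apply: wbndM; [exact: wbnd_cvg cvg_wlamV | exact: wbnd_cvg cvg_MV].
Qed.

Lemma wreg_pol k : wreg (wpol k).
Proof.
have [b1 b2 b3 b4 b5] := wbnd_coefs.
elim/nat_ind2: k => [||k IH0 IH1]; [exact: wreg_cst|exact: wreg_cst|].
apply: (wreg_eq (fun x z => esym (wpolSS k x z))).
have wregN f : wreg f -> wreg (fun x z => - f x z).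
  by move=> rf; apply: (wreg_eq _ (wregZ (wbnd_cst (-1)) rf)) => x z; rewrite mulN1r.
have rX := wreg_mulX IH1.
apply: wregD; first apply: wregD.
- apply: (wregZ (wbnd_cst _)); apply: wregD; apply: wregZ => //.
    exact: (wreg_shift rX).
  exact: wreg_diff.
- by apply: wregN; apply: wregZ => //; exact: (wreg_shift IH1).
- apply: wregN; apply: wregD; apply: wregZ => //; [exact: (wreg_shift IH0)|exact: wreg_diff].
Qed.

(** In the limit the recursion becomes [L (k + 2) = mu / (k + 1) * L (k + 1)] with [L 1 = 1]. The
    free shift [c] lets the induction evaluate at [x - 1]. *)
Lemma cvg_pol k c : wpol k.+1 (z.1%:R + c) z @[z --> winF] --> (mu ^+ k / k`!%:R : R).
Proof.
elim: k c => [|k IH] c; first by rewrite expr0 divr1; exact: cvg_cst.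
have reg1 := wreg_pol k.+1; have reg0 := wreg_pol k.
have H : 2 / k.+1%:R *
   (z.1.+1%:R * wtau z / M z * ((z.1%:R + (c - 1)) / z.1.+1%:R * wpol k.+1 (z.1%:R + (c - 1)) z)
     + (M z)^-1 * wdiff (wmulX (wpol k.+1)) (z.1%:R + c) z)
   - (M z)^-1 * ((wlam z)^-1 * wpol k.+1 (z.1%:R + (c - 1)) z)
   - (wtau z * wpol k (z.1%:R + (c - 1)) z + (z.1.+1%:R)^-1 * wdiff (wpol k) (z.1%:R + c) z)
   @[z --> winF] --> (2 / k.+1%:R * (mu / 2 * (1 * (mu ^+ k / k`!%:R)) + 0) - 0 - (0 + 0) : R).
  apply: cvgB; first apply: cvgB.
  - apply: cvgM; first exact: cvg_cst.
    apply: cvgD; last by apply: cvg0_wbnd; [exact: cvg_MV|exact: (wreg_diff (wreg_mulX reg1) 0)].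
    apply: cvgM; first exact: cvg_ratio.
    by apply: cvgM; [exact: cvg_natc|exact: IH].
  - apply: cvg0_wbnd; first exact: cvg_MV.
    by apply: wbndM; [exact: wbnd_cvg cvg_wlamV|exact: (reg1 0)].
  - apply: cvgD; apply: cvg0_wbnd; [exact: cvg_wtau|exact: (reg0 0)|exact: wscale_natV|].
    exact: (wreg_diff reg0 0).
rewrite (_ : _ - (0 + 0) = mu ^+ k.+1 / (k.+1)`!%:R) in H; last first.
  rewrite factS natrM exprS.
  have k0 : k.+1%:R != 0 :> R by rewrite pnatr_eq0.
  have f0 : k`!%:R != 0 :> R by rewrite pnatr_eq0 -lt0n fact_gt0.
  move: (k.+1%:R : R) (k`!%:R : R) k0 f0 => K f K0 f0.
  by field; rewrite ?K0 ?f0.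
apply: cvg_near_eq H; apply: nearW => z; rewrite wpolSS -[_ + c - 1]addrA /wmulX.
move: (wdiff _) (wdiff _) => a b; ring.
Qed.

End Window.

Lemma cvg_bigsum (R : realType) (T : Type) (F : set_system T) {FF : Filter F} (I : Type) (r : seq I)
  (f : I -> T -> R) (l : I -> R) : (forall i, f i x @[x --> F] --> l i) ->
  \sum_(i <- r) f i x @[x --> F] --> \sum_(i <- r) l i.
Proof.
move=> fl; elim: r => [|i r IH].
  by rewrite big_nil; under eq_fun do rewrite big_nil; exact: cvg_cst.
by rewrite big_cons; under eq_fun do rewrite big_cons; apply: cvgD.
Qed.

(** * Coefficient asymptotics, uniform over the window *)

Section WindowAsymptotics.
Variables (R : realType) (mu : R) (hmu : 0 < mu).
Local Notation M := (@wM R).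
Local Notation u := (wu mu).
Local Notation lam := (@wlam R).
Local Notation tau := (@wtau R).
Local Notation F := (winF mu).

(** The two extreme terms of [vcoef1] add up to [wamp * lam ^+ n], because
    [sin (pi / M) ^ 2 = tau * lam]. *)
Definition wamp (z : nat * nat) : R := 2 * tau z / M z.

(* The eigenvalue [j = 1] and its mirror image [j = M - 1] give the main term. *)
Lemma vcoef1_main n m k : (1 < m)%N -> 2^-1 <= lam (n, m) -> (0 < k)%N ->
  `|vcoef R m 1 k - wamp (n, m) * lam (n, m) ^+ k| <= (lam (n, m) ^+ 2) ^+ (k - 1).
Proof.
case: k => // k; case: m => [//|m] m1 l2 _; rewrite subn1 [k.+1.-1]/= vcoef1.
set t := pi / m.+3%:R : R; set l := lam (n, m.+1) in l2 *.
have lE : l = cos t ^+ 2 by [].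
have t0 : 0 < t by rewrite divr_gt0 ?pi_gt0 ?ltr0n.
have M0 : m.+3%:R != 0 :> R by rewrite pnatr_eq0.
have mt : m.+3%:R * t = pi by rewrite /t mulrC divfK.
have l1 : l <= 1 by rewrite lE cos2sin2 gerBl sqr_ge0.
have aE j : angle R m.+1 j = j%:R * t by rewrite /angle mulrA.
rewrite big_nat_recr // big_ltn //.
rewrite !aE mul1r (_ : m.+2%:R * t = pi - t); last by rewrite -mt -[m.+3%:R]natr1; ring.
rewrite sinB cosB sinpi cospi !mul0r.
rewrite (_ : (0 - -1 * sin t) ^+ 2 = sin t ^+ 2); last ring.
rewrite (_ : (-1 * cos t + 0) ^+ 2 = cos t ^+ 2); last ring.
have l0 : l != 0 by rewrite gt_eqF // (lt_le_trans _ l2) // invr_gt0.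
have -> : wamp (n, m.+1) = 2 * (l^-1 - 1) / m.+3%:R by [].
rewrite sin2cos2 -lE; set S := \sum_(_ <= _ < _) _.
rewrite [X in _ * X - _](_ : _ = (1 - l) * l ^+ k + S + (1 - l) * l ^+ k) //.
rewrite (_ : _ - _ = m.+3%:R^-1 * S); last first.
  by rewrite exprS; move: (l ^+ k) (m.+3%:R : R) M0 => x y y0; field; rewrite ?y0 ?l0.
have S0 : 0 <= S by apply: sumr_ge0 => j _; apply: mulr_ge0; [|apply: exprn_ge0]; exact: sqr_ge0.
rewrite ger0_norm; last by rewrite mulr_ge0 // invr_ge0.
rewrite mulrC ler_pdivrMr ?ltr0n // mulrC.
apply: (@le_trans _ _ (\sum_(2 <= j < m.+2) (l ^+ 2) ^+ k)); last first.
  rewrite sumr_const_nat -[leLHS]mulr_natl; have y0 : 0 <= (l ^+ 2) ^+ k by apply: exprn_ge0; exact: sqr_ge0.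
  apply: (ler_wpM2r y0); rewrite ler_nat; lia.
apply: ler_sum_nat => j /andP[j2 jm].
rewrite -[leRHS]mul1r aE; apply: ler_pM; [exact: sqr_ge0|by apply: exprn_ge0; exact: sqr_ge0| |].
  by rewrite sin2cos2 gerBl sqr_ge0.
rewrite lerXn2r ?nnegrE ?sqr_ge0 //.
(* [cos (2 t) = 2 l - 1], and [(2 l - 1) ^ 2 <= l ^ 2] as soon as [1 / 3 <= l <= 1]. *)
have c2 : cos (2 * t) ^+ 2 <= l ^+ 2.
  rewrite (_ : 2 * t = t + t); last ring.
  rewrite cosD -!expr2 sin2cos2 -lE -subr_ge0.
  rewrite (_ : _ - _ = (1 - l) * (3 * l - 1)); last ring.
  by rewrite mulr_ge0; lra.
apply: le_trans c2; rewrite -subr_ge0.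
(* Both angles lie in [[0, pi]]: once the extreme indices are split off, [2 <= j <= M - 2]. *)
have -> : cos (2 * t) ^+ 2 - cos (j%:R * t) ^+ 2 = sin (j%:R * t + 2 * t) * sin (j%:R * t - 2 * t).
  rewrite sinD sinB; set a := sin (j%:R * t); set b := sin (2 * t).
  rewrite [RHS](_ : _ = a ^+ 2 * cos (2 * t) ^+ 2 - cos (j%:R * t) ^+ 2 * b ^+ 2); last ring.
  by rewrite /a /b !sin2cos2; ring.
rewrite -mulrDl -mulrBl -natrD -natrB //.
by apply: mulr_ge0; apply: sin_ge0_pi; rewrite mulr_ge0 ?(ltW t0) //= -mt ler_wpM2r ?(ltW t0) // ler_nat; lia.
Qed.

Lemma vcoef_main n m k N : (1 < m)%N -> 2^-1 <= lam (n, m) -> (k < N)%N ->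
  `|vcoef R m k N - wamp (n, m) * lam (n, m) ^+ N * wpol k N%:R (n, m)| <=
    7 ^+ k * N%:R ^+ k * (lam (n, m) ^+ 2) ^+ (N - k).-1.
Proof.
move=> m1 l2 kN; set a := wamp _; set l := lam _ in l2 *.
have l0 : l != 0 by rewrite gt_eqF // (lt_le_trans _ l2) // invr_gt0.
pose e i := vcoef R m 1 i - a * l ^+ i.
rewrite vcoefE // (@vrec_ext _ _ _ (fun i => a * l ^+ i + e i)) //; last first.
  by move=> i _; rewrite /e addrC subrK.
rewrite vrec_linear vrec_geo // mulrA -/(wpol k) -[vpol _ _ _ _]/(wpol k N%:R (n, m)) addrAC subrr add0r.
have l1 : l <= 1 by rewrite /l /wlam cos2sin2 gerBl sqr_ge0.
apply: vrec_le => //; first by rewrite ler1n.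
- by rewrite sqr_ge0 /= expr_le1 // (le_trans _ l2).
- by move=> i i0; rewrite /e; exact: vcoef1_main.
Qed.

Lemma near_wlam_ge : \forall z \near F, 2^-1 <= lam z.
Proof.
have h := cvg_winF_dist (cvg_wlam hmu) (_ : 0 < 2^-1).
have {h} := h ltac:(by rewrite invr_gt0); apply: winF_sub => z.
by rewrite ltr_distl => /andP[h _]; apply/ltW; apply: le_lt_trans h; lra.
Qed.

Lemma cvg_natu12 : z.1.+1%:R * u z ^+ 12 @[z --> F] --> (mu / (2 * pi ^+ 2) : R).
Proof.
have H : mu / (2 * pi ^+ 2) + u z ^+ 12 @[z --> F] --> (mu / (2 * pi ^+ 2) + 0 ^+ 12 : R).
  by apply: cvgD; [exact: cvg_cst|apply: cvg_exp; exact: cvg_u].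
rewrite expr0n addr0 in H; apply: cvg_near_eq H; apply: filterS (near_u_gt0 hmu) => z u0.
have u1 : u z != 0 by rewrite gt_eqF.
have p0 : pi != 0 :> R by rewrite gt_eqF // pi_gt0.
rewrite -[z.1.+1%:R]natr1 (wscale_natE hmu z.1) -[wscale mu z.1]invrK -/(wu mu z).
by move: (pi : R) p0 (u z) u1 => P p0 v v0; field; rewrite ?p0 ?v0.
Qed.

Lemma wlam_exp_le n m : lam (n, m) ^+ n <= expR (- (n%:R * (pi / m.+2%:R) ^+ 2)).
Proof.
have t0 : 0 <= pi / m.+2%:R :> R by rewrite divr_ge0 ?ltW ?pi_gt0.
rewrite -mulrN expRM_natl lerXn2r ?nnegrE ?wlam_ge0 ?expR_ge0 //.
by apply: cos2_le_expR; rewrite t0 /=; exact: (th_le R (n, m)).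
Qed.

Lemma cvg_wlam_exp_small i : z.1.+1%:R ^+ i * M z ^+ 3 * lam z ^+ z.1 @[z --> F] --> (0 : R).
Proof.
(* [n ^ i * M ^ 3] is of order [p ^ (12 i + 12)] and [lam ^ n] is at most the exponential of minus a
   quantity of order [p ^ 4]; the power [3 i + 4] of the latter leaves [p ^- 4]. *)
pose J := (3 * i + 4)%N.
have p0 : pi != 0 :> R by rewrite gt_eqF // pi_gt0.
pose b z := J`!%:R * (z.1.+1%:R * u z ^+ 12) ^+ i * (M z * u z ^+ 4) ^+ 3 *
  ((z.1.+1%:R * u z ^+ 12 - u z ^+ 12)^-1 * (M z * u z ^+ 4) ^+ 2 / pi ^+ 2) ^+ J * u z ^+ 4.
have cb : b z @[z --> F] --> (0 : R).
  rewrite (_ : 0 = J`!%:R * (mu / (2 * pi ^+ 2)) ^+ i * 1 ^+ 3 *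
    ((mu / (2 * pi ^+ 2) - 0 ^+ 12)^-1 * 1 ^+ 2 / pi ^+ 2) ^+ J * 0 ^+ 4); last by rewrite [0 ^+ 4]expr0n mulr0.
  apply: cvgM; last by apply: cvg_exp; exact: cvg_u.
  apply: cvgM; first apply: cvgM; first apply: cvgM; first exact: cvg_cst.
  - by apply: cvg_exp; exact: cvg_natu12.
  - by apply: cvg_exp; exact: cvg_Mu4.
  - apply: cvg_exp; apply: cvgM; last exact: cvg_cst.
    apply: cvgM; last by apply: cvg_exp; exact: cvg_Mu4.
    apply: cvgV; last by apply: cvgB; [exact: cvg_natu12|apply: cvg_exp; exact: cvg_u].
    by rewrite expr0n subr0 mulf_neq0 ?gt_eqF // invr_gt0 mulr_gt0 // exprn_gt0 // pi_gt0.
apply: (@squeeze_cvgr _ _ _ _ (fun=> 0) b) => //; last exact: cvg_cst.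
have n_gt0 : \forall z \near F, (0 < z.1)%N.
  by apply: (@near_winF_fst R mu (fun n => 0 < n)%N); exact: nbhs_infty_ge.
apply: filterS2 (near_u_gt0 hmu) n_gt0 => -[n m] u0 n1; rewrite [(n, m).1]/= in n1 *.
rewrite [X in X && _]mulr_ge0 ?[X in _ && X]/=; [|by rewrite mulr_ge0 ?exprn_ge0|by rewrite exprn_ge0 ?wlam_ge0].
have t0 : 0 < n%:R * (pi / m.+2%:R) ^+ 2 :> R.
  by rewrite mulr_gt0 ?ltr0n // exprn_gt0 // divr_gt0 ?pi_gt0 ?ltr0n.
have h := le_trans (wlam_exp_le n m) (expRN_le J t0).
apply: (@le_trans _ _ (n.+1%:R ^+ i * M (n, m) ^+ 3 * (J`!%:R / (n%:R * (pi / m.+2%:R) ^+ 2) ^+ J))).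
  by rewrite ler_wpM2l // mulr_ge0 ?exprn_ge0.
rewrite le_eqVlt; apply/orP; left; apply/eqP; rewrite /b /=.
have u1 : u (n, m) != 0 by rewrite gt_eqF.
have n0 : n%:R != 0 :> R by rewrite pnatr_eq0 -lt0n.
have M0 : M (n, m) != 0 by rewrite pnatr_eq0.
rewrite -/(wM R (n, m)); set v := u (n, m) in u1 *.
rewrite (_ : n.+1%:R * v ^+ 12 - v ^+ 12 = n%:R * v ^+ 12); last by rewrite -[n.+1%:R]natr1; ring.
rewrite (_ : (n%:R * v ^+ 12)^-1 * _ ^+ 2 / pi ^+ 2 = (n%:R * (pi / M (n, m)) ^+ 2)^-1 * v ^- 4); last first.
  move: (pi : R) p0 (M (n, m)) M0 (n%:R : R) n0 => P p0 M' M0 n' n0.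
  by field; rewrite ?p0 ?M0 ?u1 ?n0.
rewrite -/(wM R (n, m)) -/(M (n, m)); set x := n%:R * _; set M' := M (n, m).
have E : (v ^+ 12) ^+ i * (v ^+ 4) ^+ 3 * v ^+ 4 * (v ^- 4) ^+ J = 1.
  rewrite exprVn -!exprM -!exprD (_ : (12 * i + 4 * 3 + 4)%N = (4 * J)%N); last by rewrite /J; lia.
  by rewrite divff // expf_neq0.
have -> : (x ^+ J)^-1 = x^-1 ^+ J by rewrite exprVn.
have -> : (x^-1 * v ^- 4) ^+ J = x^-1 ^+ J * (v ^- 4) ^+ J by rewrite exprMn.
have -> : (n.+1%:R * v ^+ 12) ^+ i = n.+1%:R ^+ i * (v ^+ 12) ^+ i by rewrite exprMn.
have -> : (M' * v ^+ 4) ^+ 3 = M' ^+ 3 * (v ^+ 4) ^+ 3 by rewrite exprMn.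
move: E (M' ^+ 3) (n.+1%:R ^+ i) (J`!%:R : R) (x^-1 ^+ J).
move: ((v ^+ 12) ^+ i) (v ^+ 4) (v ^- 4 ^+ J) => a1 a3 a4 E b1 b2 b3 b4.
by transitivity (b2 * b1 * (b3 * b4) * (a1 * a3 ^+ 3 * a3 * a4)); [rewrite E mulr1|ring].
Qed.

Lemma near_wtauM2_gt0 : \forall z \near F, 0 < tau z * M z ^+ 2.
Proof.
have p0 : 0 < pi ^+ 2 :> R by rewrite exprn_gt0 // pi_gt0.
have := cvg_winF_dist (cvg_wtauM2 hmu) p0; apply: winF_sub => z.
by rewrite ltr_distl subrr => /andP[].
Qed.

Definition vlim k : R := if k is j.+1 then mu ^+ j / j`!%:R else 0.

(** Displays the error of [vcoef_main] as the main term times factors that converge, among which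
    [N ^+ k * x ^+ 3 * l ^+ n.+1] tends to zero by [cvg_wlam_exp_small]. *)
Lemma vcoef_bound_alg k n (s N l t x : R) : l != 0 -> t != 0 -> x != 0 -> N != 0 ->
  7 ^+ k * s ^+ k * (l ^+ 2) ^+ n = 7 ^+ k / 2 * (s / N) ^+ k * (N ^+ k * x ^+ 3 * l ^+ n.+1)
    * (t * x ^+ 2)^-1 * l^-1 ^+ 2 * (2 * t / x * l ^+ n.+1).
Proof.
move=> l0 t0 x0 N0; have Nk : N ^+ k != 0 by rewrite expf_neq0.
rewrite -exprM mulnC exprM (exprMn k s) [l ^+ n.+1]exprS.
have -> : N^-1 ^+ k = (N ^+ k)^-1 by rewrite exprVn.
move: (7 ^+ k : R) (s ^+ k) (N ^+ k) Nk (l ^+ n) => a b c c0 d.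
by field; rewrite ?l0 ?t0 ?x0 ?c0.
Qed.

Lemma cvg_vcoef_ratio k c : (k <= c)%N ->
  vcoef R z.2 k (z.1 + c) / (wamp z * lam z ^+ z.1) @[z --> F] --> vlim k.
Proof.
move=> kc; have n_gt0 : \forall z \near F, (0 < z.1)%N.
  by apply: (@near_winF_fst R mu (fun n => 0 < n)%N); exact: nbhs_infty_ge.
case: k kc => [|k] kc.
  apply: (@cvg_near_eq _ _ _ _ (fun=> 0)); last exact: cvg_cst.
  by apply: filterS n_gt0 => z n0; rewrite vcoef0 ?mul0r // (leq_trans n0) // leq_addr.
pose err z := (vcoef R z.2 k.+1 (z.1 + c) - wamp z * lam z ^+ (z.1 + c) * wpol k.+1 (z.1 + c)%:R z)
  / (wamp z * lam z ^+ z.1).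
pose b z := 7 ^+ k.+1 / 2 * ((z.1%:R + c%:R) / z.1.+1%:R) ^+ k.+1 *
  (z.1.+1%:R ^+ k.+1 * M z ^+ 3 * lam z ^+ z.1) * (tau z * M z ^+ 2)^-1 * (lam z)^-1 ^+ 2.
have cb : b z @[z --> F] --> (0 : R).
  rewrite (_ : 0 = 7 ^+ k.+1 / 2 * 1 ^+ k.+1 * 0 * (pi ^+ 2)^-1 * 1 ^+ 2); last by rewrite mulr0 !mul0r.
  apply: cvgM; last by apply: cvg_exp; exact: cvg_wlamV.
  apply: cvgM; last first.
    by apply: cvgV; [rewrite expf_neq0 // gt_eqF // pi_gt0|exact: cvg_wtauM2].
  apply: cvgM; last exact: cvg_wlam_exp_small.
  apply: cvgM; first exact: cvg_cst.
  by apply: cvg_exp; exact: cvg_natc.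
have cerr : err z @[z --> F] --> (0 : R).
  apply: (@squeeze_cvgr _ _ _ _ (fun z => - b z) b) => //; last by rewrite -(oppr0 R); apply: cvgN.
  near=> z; rewrite -ler_norml.
  have t0 : 0 < tau z * M z ^+ 2 by near: z; exact: near_wtauM2_gt0.
  have l2 : 2^-1 <= lam z by near: z; exact: near_wlam_ge.
  have n0 : (0 < z.1)%N by near: z.
  have m1 : (1 < z.2)%N by near: z; exact: near_M_ge.
  rewrite (surjective_pairing z) in t0 l2 *; move: (z.1) (z.2) t0 l2 n0 m1 => n m t0 l2 n0 m1.
  have M0 : 0 < M (n, m) by rewrite ltr0n.
  have tau0 : 0 < tau (n, m) by rewrite -(pmulr_lgt0 _ (exprn_gt0 2 M0)).
  have l0 : 0 < lam (n, m) by rewrite (lt_le_trans _ l2) // invr_gt0.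
  have a1 : 0 < wamp (n, m) by rewrite divr_gt0 // mulr_gt0.
  have a0 : 0 < wamp (n, m) * lam (n, m) ^+ n by rewrite mulr_gt0 // exprn_gt0.
  have l1 : lam (n, m) <= 1 by rewrite /wlam cos2sin2 gerBl sqr_ge0.
  rewrite /err normrM [X in _ * X]ger0_norm; last by rewrite invr_ge0 ltW.
  rewrite ler_pdivrMr //= (le_trans (vcoef_main m1 l2 _)) //; first by rewrite -[k.+1]add0n -addSn leq_add.
  (* Here [k.+1 <= c] matters: the exponent [(n + c - k.+1).-1] is then at least [n - 1]. *)
  apply: (@le_trans _ _ (7 ^+ k.+1 * (n + c)%:R ^+ k.+1 * (lam (n, m) ^+ 2) ^+ (n - 1))).
    have s0 : 0 <= lam (n, m) ^+ 2 by exact: sqr_ge0.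
    have s1 : lam (n, m) ^+ 2 <= 1 by rewrite expr_le1 // ltW.
    apply: ler_wpM2l; first by rewrite mulr_ge0 ?exprn_ge0.
    apply: (ler_wiXn2l s0 s1).
    by rewrite -subn1 leq_sub2r // -addnBA // leq_addr.
  rewrite le_eqVlt; apply/orP; left; apply/eqP; rewrite /b /wamp /=.
  case: n n0 {a0 a1} t0 l2 tau0 l0 l1 M0 => // n _ t0 l2 tau0 l0 l1 M0.
  rewrite subn1 [n.+1.-1]/= natrD; apply: vcoef_bound_alg; rewrite ?gt_eqF //.
have H : lam z ^+ c * wpol k.+1 (z.1%:R + c%:R) z + err z @[z --> F] --> (1 ^+ c * vlim k.+1 + 0 : R).
  apply: cvgD => //; apply: cvgM; first by apply: cvg_exp; exact: cvg_wlam.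
  exact: cvg_pol.
rewrite expr1n mul1r addr0 in H; apply: cvg_near_eq H.
apply: filterS2 near_wtauM2_gt0 near_wlam_ge => z t0 l2.
have M0 : 0 < M z by rewrite ltr0n.
have tau0 : 0 < tau z by rewrite -(pmulr_lgt0 _ (exprn_gt0 2 M0)).
have l0 : lam z != 0 by rewrite gt_eqF // (lt_le_trans _ l2) // invr_gt0.
have a0 : wamp z != 0 by rewrite gt_eqF // divr_gt0 // mulr_gt0.
rewrite /err natrD exprD; have L0 := expf_neq0 z.1 l0.
move: (wamp z) a0 (lam z ^+ z.1) L0 (lam z ^+ c) => a a0 L L0 L'.
by field; rewrite ?a0 ?L0.
Unshelve. all: by end_near. Qed.

Definition hlim k : R := 2 ^+ k * \sum_(i < k.+1) 'C(k, i)%:R * vlim i.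

Lemma cvg_hser_ratio k e :
  (hser R z.2 ^+ k) (z.1 + e)%N / 4 ^+ (z.1 + e) / (wamp z * lam z ^+ z.1) @[z --> F] --> hlim k.
Proof.
have H : 2 ^+ k * \sum_(i < k.+1) 'C(k, i)%:R *
   (vcoef R z.2 i (z.1 + (e + k)) / (wamp z * lam z ^+ z.1)) @[z --> F] --> hlim k.
  apply: cvgM; first exact: cvg_cst.
  apply: (@cvg_bigsum _ _ _ _ _ _
    (fun (i : 'I_k.+1) z => 'C(k, i)%:R * (vcoef R z.2 i (z.1 + (e + k)) / (wamp z * lam z ^+ z.1)))) => i.
  apply: cvgM; first exact: cvg_cst.
  by apply: cvg_vcoef_ratio; rewrite (leq_trans (_ : i <= k)%N) ?leq_addl // -ltnS.
apply: cvg_near_eq H; apply: nearW => z.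
rewrite [in RHS]hser_exp_vcoef -[RHS]mulrA [in RHS]mulr_suml; congr (_ * _); apply: eq_bigr => i _.
by rewrite addnA mulrA.
Qed.

End WindowAsymptotics.

(** * Summation over the heights *)

Section GrowthAsymptotics.
Variables (R : realType) (mu : R) (hmu : 0 < mu).
Local Notation q := (expR (- mu)).
Local Notation p := (wscale mu).
Local Notation F := (winF mu).
Local Notation lam := (@wlam R).

(** With [P = s ^ 4], the function [x + P ^ 3 / (2 x ^ 2)] has its minimum [3 / 2 * P] at [x = P],
    and exceeds it by exactly [(x - P) ^ 2 * (2 x + P) / (2 x ^ 2)]. Up to [2 P] the hypothesis
    bounds [x - P]; beyond, [x - P >= x / 2] does. *)
Lemma saddle_gap (s x : R) : 1 <= s -> 0 < x -> s ^+ 3 < `|x - s ^+ 4| ->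
  3 / 2 * s ^+ 4 + s ^+ 2 / 2 <= x + s ^+ 12 / (2 * x ^+ 2).
Proof.
move=> s1 x0 sx; set P := s ^+ 4 in sx *; have s0 : 0 < s by lra.
have s2 : 0 < s ^+ 2 by rewrite exprn_gt0.
have P0 : 0 < P by rewrite exprn_gt0.
have x2 : 0 < 2 * x ^+ 2 by rewrite mulr_gt0 // exprn_gt0.
rewrite -subr_ge0.
have -> : x + s ^+ 12 / (2 * x ^+ 2) - (3 / 2 * P + s ^+ 2 / 2) =
   ((x - P) ^+ 2 * (2 * x + P) - s ^+ 2 * x ^+ 2) / (2 * x ^+ 2).
  by rewrite /P; field; rewrite gt_eqF.
rewrite divr_ge0 ?(ltW x2) // subr_ge0.
have [xP|Px] := leP x (2 * P).
  apply: (@le_trans _ _ (s ^+ 6 * (2 * x))).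
    rewrite (_ : s ^+ 2 * x ^+ 2 = s ^+ 2 * x * x); last ring.
    rewrite (_ : s ^+ 6 * (2 * x) = s ^+ 2 * x * (2 * P)); last by rewrite /P; ring.
    by rewrite ler_wpM2l // mulr_ge0 ?(ltW s2) ?(ltW x0).
  apply: ler_pM; rewrite ?exprn_ge0 ?mulr_ge0 ?(ltW s0) ?(ltW x0) //; last by rewrite lerDl ltW.
  rewrite (_ : s ^+ 6 = (s ^+ 3) ^+ 2); last ring.
  rewrite -(real_normK (num_real (x - P))) lerXn2r ?nnegrE ?exprn_ge0 ?normr_ge0 ?(ltW s0) //.
  exact: ltW.
have sP : s ^+ 2 <= P by rewrite /P ler_weXn2l.
apply: (@le_trans _ _ ((x ^+ 2 / 4) * (4 * P))).
  rewrite (_ : _ * (4 * P) = P * x ^+ 2); last by field.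
  by rewrite ler_wpM2r // sqr_ge0.
apply: ler_pM; [by rewrite divr_ge0 ?sqr_ge0|by rewrite mulr_ge0 // ltW| |lra].
rewrite (_ : x ^+ 2 / 4 = (x / 2) ^+ 2); last by field.
by rewrite lerXn2r ?nnegrE; lra.
Qed.

Lemma hser_exp_norm_le n m k e : (hser R m ^+ k) (n + e)%N / 4 ^+ (n + e) <=
  4 ^+ k * expR (- (n%:R * (pi / m.+3%:R) ^+ 2)).
Proof.
have c0 : 0 < cos (pi / m.+3%:R : R) := cos_pi_div_gt0 R m.
have pi0 : 0 < pi :> R := pi_gt0 R.
rewrite ler_pdivrMr ?exprn_gt0 // (le_trans (hser_exp_le _ _ _ _)) //.
rewrite exprMn [4 ^+ (n + e + k)]exprD.
rewrite (_ : 4 ^+ (n + e) * 4 ^+ k * _ = 4 ^+ k * 4 ^+ (n + e) * (cos (pi / m.+3%:R) ^+ 2) ^+ (n + e + k)); last ring.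
rewrite [leRHS]mulrAC ler_wpM2l ?mulr_ge0 ?exprn_ge0 // -addnA exprD -mulrN expRM_natl.
set c := cos _ ^+ 2.
have c2 : 0 <= c <= 1 by rewrite sqr_ge0 /c cos2sin2 gerBl sqr_ge0.
have [cc0 cc1] := andP c2.
apply: (@le_trans _ _ (c ^+ n * 1)).
  by apply: ler_wpM2l; [exact: exprn_ge0|exact: exprn_ile1].
rewrite mulr1 lerXn2r ?nnegrE ?expR_ge0 //; apply: cos2_le_expR.
rewrite divr_ge0 ?(ltW pi0) //= ler_pM2l // lef_pV2 ?posrE ?ltr0n // ler_nat //.
Qed.

(** The factor [expR (3 * mu)] pays for replacing [m] by [m + 3], the variable of [saddle_gap], in
    [q ^+ m]. *)
Definition out_bound k n : R :=
  4 ^+ k * expR (3 * mu) * expR (- mu * (3 / 2 * p n ^+ 4 + p n ^+ 2 / 2)).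

Lemma out_bound_ge0 k n : 0 <= out_bound k n.
Proof. by rewrite !mulr_ge0 ?exprn_ge0 ?expR_ge0. Qed.

Lemma out_window_le n m k e : 1 <= p n -> ~~ win mu n m ->
  q ^+ m * ((hser R m ^+ k) (n + e)%N / 4 ^+ (n + e)) <= out_bound k n.
Proof.
move=> p1; rewrite /win -ltNge => hw.
apply: (le_trans (ler_wpM2l (exprn_ge0 m (expR_ge0 _)) (hser_exp_norm_le n m k e))).
rewrite mulrCA /out_bound -mulrA; apply: ler_wpM2l; first exact: exprn_ge0.
rewrite -expRM_natl -!expRD ler_expR.
have x0 : 0 < m.+3%:R :> R by rewrite ltr0n.
have := saddle_gap p1 x0 hw; rewrite -(ler_pM2l hmu).
rewrite (wscale_natE hmu n) -[m%:R](addrK 3) -natrD addn3.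
have p0 : pi != 0 :> R by rewrite gt_eqF // pi_gt0.
have x1 := gt_eqF x0.
move: (pi : R) p0 (m.+3%:R : R) x1 (p n) => P p0 x x1 s h.
rewrite (_ : mu / (2 * P ^+ 2) * s ^+ 12 * (P / x) ^+ 2 = mu * (s ^+ 12 / (2 * x ^+ 2))); last first.
  by field; rewrite ?p0 ?x1.
lra.
Qed.

(** Heights in the window are of order [p ^ 4] and [n] is of order [p ^ 12], so the sum over [m < n]
    contains the whole window. *)
Lemma near_win_lt : \forall n \near \oo, forall m, win mu n m -> (m < n)%N.
Proof.
have pi0 : 0 < pi :> R := pi_gt0 R.
near=> n => m; rewrite /win ler_distl => /andP[_ h].
have p1 : 1 <= p n by near: n; exact: wscale_ge.
have pA : 4 * pi ^+ 2 / mu <= p n by near: n; exact: wscale_ge.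
rewrite -(ltr_nat R); apply: (@lt_le_trans _ _ m.+3%:R); first by rewrite ltr_nat; lia.
apply: (le_trans h); rewrite (wscale_natE hmu n).
have s0 : 0 < p n by lra.
have h1 : p n ^+ 4 + p n ^+ 3 <= 2 * p n ^+ 4.
  have h34 : p n ^+ 3 <= p n ^+ 4 by rewrite ler_weXn2l.
  lra.
apply: (le_trans h1).
rewrite (_ : mu / (2 * pi ^+ 2) * p n ^+ 12 = (mu / (4 * pi ^+ 2)) * p n ^+ 8 * (2 * p n ^+ 4)); last first.
  have p0 : pi != 0 :> R by rewrite gt_eqF.
  by move: (pi : R) p0 (p n) => P p0 s; field; rewrite ?p0.
rewrite ler_peMl ?mulr_ge0 ?exprn_ge0 ?(ltW s0) //.
have c0 : 0 < 4 * pi ^+ 2 / mu by rewrite divr_gt0 // mulr_gt0 // exprn_gt0.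
rewrite -invf_div ler_pdivlMl // mulr1 (le_trans pA) // -[leLHS]expr1 ler_weXn2l //.
Unshelve. all: by end_near. Qed.

Definition wweight n m : R := q ^+ m * (wamp R (n, m) * lam (n, m) ^+ n).
(** The common normalisation for all [k]. It cancels in ratios, so a lower bound that dominates the
    terms outside the window is all that is asked of it. *)
Definition wtotal n : R := \sum_(0 <= m < n | win mu n m) wweight n m.

(** [wamp] is equivalent to [2 pi ^ 2 / M ^ 3], that is to [2 pi ^ 2 * p ^- 12], and
    [2 pi ^ 2 > 1]. *)
Lemma near_wamp_ge : \forall n \near \oo, forall m, win mu n m -> wu mu (n, m) ^+ 12 <= wamp R (n, m).
Proof.
have pi0 : 0 < pi :> R := pi_gt0 R.
have H : (wtau R z * wM R z ^+ 2) * 2 * ((wM R z * wu mu z ^+ 4)^-1) ^+ 3 @[z --> F] --> (pi ^+ 2 * 2 * 1^-1 ^+ 3 : R).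
  apply: cvgM; first by apply: cvgM; [exact: cvg_wtauM2|exact: cvg_cst].
  by apply: cvg_exp; apply: cvgV; [rewrite oner_eq0|exact: cvg_Mu4].
rewrite invr1 expr1n mulr1 in H.
have P1 : 0 < pi ^+ 2 * 2 - 1 :> R.
  have := pi_ge2 R => h; have : 2 * 2 <= pi ^+ 2 :> R by rewrite expr2 ler_pM.
  lra.
have : \forall z \near F, wu mu z ^+ 12 <= wamp R z; last by [].
have h := cvg_winF_dist H P1; apply: filterS2 h (near_u_gt0 hmu) => z.
rewrite ltr_distl => /andP[h _] u0.
have M0 : 0 < wM R z by rewrite ltr0n.
have -> : wamp R z = wtau R z * wM R z ^+ 2 * 2 * (wM R z * wu mu z ^+ 4)^-1 ^+ 3 * wu mu z ^+ 12.
  rewrite /wamp; have M1 := gt_eqF M0; have u1 := gt_eqF u0.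
  by move: (wM R z) (wu mu z) (wtau R z) M1 u1 => x v t x1 v1; field; rewrite ?x1 ?v1.
apply: ler_peMl; first by rewrite exprn_ge0 // ltW.
by move: h; rewrite opprB addrC subrK => /ltW.
Qed.

Lemma near_wweight_gt0 : \forall n \near \oo, forall m, win mu n m -> 0 < wweight n m.
Proof.
have H1 := near_wamp_ge.
have H2 : \forall n \near \oo, forall m, win mu n m -> 2^-1 <= lam (n, m) := near_wlam_ge hmu.
near=> n => m hm.
have p1 : 1 <= p n by near: n; exact: wscale_ge.
have A : forall m, win mu n m -> wu mu (n, m) ^+ 12 <= wamp R (n, m) by near: n.
have L : forall m, win mu n m -> 2^-1 <= lam (n, m) by near: n.
have a := A m hm; have l := L m hm.
rewrite mulr_gt0 ?exprn_gt0 ?expR_gt0 // mulr_gt0 //.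
  by rewrite (lt_le_trans _ a) // exprn_gt0 // invr_gt0 (lt_le_trans _ p1).
by rewrite exprn_gt0 // (lt_le_trans _ l) // invr_gt0.
Unshelve. all: by end_near. Qed.

(** A single height, the integer part of [p ^ 4], already supplies this bound. *)
Lemma near_wtotal_ge : \forall n \near \oo,
  (p n)^-1 ^+ 12 * expR (- mu * (3 / 2 * p n ^+ 4 + pi ^+ 2)) <= wtotal n.
Proof.
have pi0 : 0 < pi :> R := pi_gt0 R.
have Hlt := near_win_lt; have Ha := near_wamp_ge; have Hw := near_wweight_gt0.
near=> n.
have p2 : 2 <= p n by near: n; exact: wscale_ge.
have pA : 2 * pi ^+ 2 <= p n by near: n; exact: wscale_ge.
have s0 : 0 < p n by lra.
have p4 : 0 < p n ^+ 4 by rewrite exprn_gt0.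
set m := Num.trunc (p n ^+ 4).
have /andP[m1 m2] := truncn_itv (ltW p4); rewrite -/m in m1 m2.
have hm : win mu n m.
  rewrite /win ler_distl.
  have : 2 ^+ 3 <= p n ^+ 3 by rewrite lerXn2r ?nnegrE // ltW.
  rewrite (_ : 2 ^+ 3 = 8 :> R) => [h8|]; last ring.
  by move: m1 m2; rewrite -!natr1 => m1 m2; apply/andP; split; lra.
have nlt : forall m, win mu n m -> (m < n)%N by near: n.
have nw : forall m, win mu n m -> 0 < wweight n m by near: n.
have na : forall m, win mu n m -> wu mu (n, m) ^+ 12 <= wamp R (n, m) by near: n.
have mn := nlt m hm.
apply: (@le_trans _ _ (wweight n m)); last first.
  rewrite /wtotal big_mkord (bigD1 (Ordinal mn)) //= lerDl sumr_ge0 // => i /andP[wi _].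
  by apply/ltW/nw.
have am := na m hm.
rewrite /wweight [leRHS]mulrCA; apply: ler_pM; rewrite ?exprn_ge0 ?expR_ge0 ?invr_ge0 ?(ltW s0) //.
rewrite (_ : - mu * _ = - mu * p n ^+ 4 + - mu * (p n ^+ 4 / 2 + pi ^+ 2)); last by field.
rewrite expRD; apply: ler_pM; rewrite ?expR_ge0 //.
  by rewrite -expRM_natl ler_expR [leRHS]mulrC !mulNr lerN2 ler_pM2l.
set x := pi ^+ 2 / p n ^+ 8.
have p8 : 0 < p n ^+ 8 by rewrite exprn_gt0.
have x0 : 0 <= x by rewrite divr_ge0 ?sqr_ge0 // ltW.
have pp8 : p n <= p n ^+ 8 by rewrite -[leLHS]expr1 ler_weXn2l //; lra.
have x1 : x <= 2^-1 by rewrite /x ler_pdivrMr //; lra.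
have lx : 1 - x <= lam (n, m).
  rewrite /wlam /= cos2sin2 lerB //.
  have t0 : 0 <= pi / m.+2%:R :> R by rewrite divr_ge0 // ltW.
  apply: (@le_trans _ _ ((pi / m.+2%:R) ^+ 2)).
    rewrite lerXn2r ?nnegrE ?sin_le_id //; apply: sin_ge0_pi; rewrite t0 ler_pdivrMr ?ltr0n //.
    by rewrite ler_peMr ?(ltW pi0) // ler1n.
  rewrite (_ : x = (pi / p n ^+ 4) ^+ 2); last by rewrite /x expr_div_n -exprM.
  rewrite lerXn2r ?nnegrE ?divr_ge0 ?(ltW pi0) ?(ltW p4) // ler_pM2l // lef_pV2 ?posrE ?ltr0n //.
  by rewrite (le_trans (ltW m2)) // ler_nat.
have ex := expR_le_1B (_ : 0 <= x <= 2^-1).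
apply: (@le_trans _ _ (expR (- (x + 2 * x ^+ 2)) ^+ n)); last first.
  rewrite lerXn2r ?nnegrE ?expR_ge0 ?wlam_ge0 // (le_trans _ lx) // ex //.
  by rewrite x0 x1.
(* [n x = mu p ^ 4 / 2] and [2 n x ^ 2 = mu pi ^ 2 / p ^ 4]; the latter is at most [mu pi ^ 2]. *)
rewrite -expRM_natl ler_expR (wscale_natE hmu n) /x.
have pn0 := gt_eqF pi0; have ps0 := gt_eqF s0.
rewrite (_ : _ * - _ = - mu * (p n ^+ 4 / 2 + pi ^+ 2 / p n ^+ 4)); last first.
  by move: (pi : R) pn0 (p n) ps0 => P pn0 s ps0; field; rewrite ?pn0 ?ps0.
rewrite !mulNr lerN2 ler_pM2l // lerD2l ler_pdivrMr // ler_peMr ?sqr_ge0 //.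
by rewrite exprn_ege1 //; lra.
Unshelve. all: by end_near. Qed.

Lemma cvg_out_bound k e : (n + e).+1%:R * out_bound k n / wtotal n @[n --> \oo] --> (0 : R).
Proof.
have pi0 : 0 < pi :> R := pi_gt0 R.
pose c := mu / (2 * pi ^+ 2) + e.+1%:R.
(* The number of terms and the inverse of the amplitude cost [p ^ 12] each; the power 13 of the gap
   [mu p ^ 2 / 2] gains [p ^ 26], which leaves [p ^- 2]. *)
pose C := c * (4 ^+ k * expR (3 * mu)) * expR (mu * pi ^+ 2) * (13`!%:R / (mu / 2) ^+ 13).
have cb : C * (p n)^-1 ^+ 2 @[n --> \oo] --> (0 : R).
  rewrite (_ : 0 = C * 0 ^+ 2); last by rewrite expr0n mulr0.
  by apply: cvgM; [exact: cvg_cst|apply: cvg_exp; exact: wscaleV0].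
apply: (@squeeze_cvgr _ _ _ _ (fun=> 0) (fun n => C * (p n)^-1 ^+ 2)) => //; last exact: cvg_cst.
have Ht := near_wtotal_ge.
near=> n.
have p1 : 1 <= p n by near: n; exact: wscale_ge.
have s0 : 0 < p n by lra.
have tn : (p n)^-1 ^+ 12 * expR (- mu * (3 / 2 * p n ^+ 4 + pi ^+ 2)) <= wtotal n by near: n.
set L := _ * expR _ in tn.
have L0 : 0 < L by rewrite mulr_gt0 ?expR_gt0 // exprn_gt0 // invr_gt0.
have t0 : 0 < wtotal n by apply: lt_le_trans tn.
rewrite divr_ge0 ?mulr_ge0 ?out_bound_ge0 ?(ltW t0) //=.
apply: (@le_trans _ _ ((n + e).+1%:R * out_bound k n / L)).
  by rewrite ler_wpM2l ?mulr_ge0 ?out_bound_ge0 // lef_pV2 ?posrE.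
have nb : (n + e).+1%:R <= c * p n ^+ 12.
  rewrite -addnS natrD (wscale_natE hmu n) /c [leRHS]mulrDl lerD2l ler_peMr // exprn_ege1 //.
have y0 : 0 < mu / 2 * p n ^+ 2 by rewrite mulr_gt0 ?divr_gt0 ?exprn_gt0.
have eb := expRN_le 13 y0.
have -> : out_bound k n = 4 ^+ k * expR (3 * mu) * (expR (- (mu / 2 * p n ^+ 2)) *
    (expR (mu * pi ^+ 2) * expR (- mu * (3 / 2 * p n ^+ 4 + pi ^+ 2)))).
  by rewrite /out_bound -!expRD; congr (_ * expR _); field.
rewrite /L; have E0 := gt_eqF (expR_gt0 (- mu * (3 / 2 * p n ^+ 4 + pi ^+ 2))).
move: (expR (- mu * (3 / 2 * p n ^+ 4 + pi ^+ 2))) E0 => E E0.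
rewrite (_ : _ / _ = (n + e).+1%:R * (4 ^+ k * expR (3 * mu) * expR (mu * pi ^+ 2) * p n ^+ 12) *
    expR (- (mu / 2 * p n ^+ 2))); last first.
  move: (4 ^+ k : R) (expR (3 * mu)) (expR (- (mu / 2 * p n ^+ 2))) (expR (mu * pi ^+ 2)) ((n + e).+1%:R : R) (p n) (gt_eqF s0) => a b d f N s s1.
  by field; rewrite ?E0 ?s1.
rewrite (_ : C * _ = (c * p n ^+ 12) * (4 ^+ k * expR (3 * mu) * expR (mu * pi ^+ 2) * p n ^+ 12) *
    (13`!%:R / (mu / 2 * p n ^+ 2) ^+ 13)); last first.
  rewrite /C; move: (4 ^+ k : R) (expR (3 * mu)) (expR (mu * pi ^+ 2)) (13`!%:R : R) (p n) (gt_eqF s0) (gt_eqF hmu) => a b d f s s1 m1.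
  by field; rewrite ?s1 ?m1.
apply: ler_pM => //; rewrite ?mulr_ge0 ?expR_ge0 ?exprn_ge0 ?(ltW s0) //.
by rewrite ler_wpM2r // ?mulr_ge0 ?expR_ge0 ?exprn_ge0 ?(ltW s0).
Unshelve. all: by end_near. Qed.

Lemma q_lt1 : 0 < q < 1.
Proof. by rewrite expR_gt0 expR_lt1 oppr_lt0. Qed.

Lemma cvg_growth k e :
  growth q k (n + e) / 4 ^+ (n + e) / wtotal n @[n --> \oo] --> ((1 - q) * hlim mu k : R).
Proof.
have /andP[q0 q1] := q_lt1.
apply/cvgrPdist_le => d d0.
have d2 : 0 < d / 2 by rewrite divr_gt0.
have H1 : \forall n \near \oo, forall m, win mu n m ->
   `|(hser R m ^+ k) (n + e)%N / 4 ^+ (n + e) / (wamp R (n, m) * lam (n, m) ^+ n) - hlim mu k| < d / 2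
  := cvg_winF_dist (@cvg_hser_ratio R mu hmu k e) d2.
have H2 : \forall n \near \oo, `|(n + e).+1%:R * out_bound k n / wtotal n| < d / 2.
  by have /cvgrPdist_lt /(_ _ d2) := cvg_out_bound k e; apply: filterS => n; rewrite sub0r normrN.
have Hlt := near_win_lt; have Hw := near_wweight_gt0; have Ht := near_wtotal_ge.
near=> n.
have p1 : 1 <= p n by near: n; exact: wscale_ge.
have nlt : forall m, win mu n m -> (m < n)%N by near: n.
have nw : forall m, win mu n m -> 0 < wweight n m by near: n.
have nd : forall m, win mu n m ->
  `|(hser R m ^+ k) (n + e)%N / 4 ^+ (n + e) / (wamp R (n, m) * lam (n, m) ^+ n) - hlim mu k| < d / 2 by near: n.
have nb : `|(n + e).+1%:R * out_bound k n / wtotal n| < d / 2 by near: n.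
have t0 : 0 < wtotal n.
  apply: (@lt_le_trans _ _ ((p n)^-1 ^+ 12 * expR (- mu * (3 / 2 * p n ^+ 4 + pi ^+ 2)))); last by near: n.
  by rewrite mulr_gt0 ?expR_gt0 // exprn_gt0 // invr_gt0; lra.
pose h m := (hser R m ^+ k) (n + e)%N / 4 ^+ (n + e).
have h0 m : 0 <= h m by rewrite divr_ge0 ?hser_exp_ge0 ?exprn_ge0.
have gE : growth q k (n + e) / 4 ^+ (n + e) =
    (1 - q) * \sum_(0 <= m < n + e) q ^+ m * h m + q ^+ (n + e) * h (n + e)%N.
  rewrite /growth /growth_upto mulrDl; congr (_ + _); last by rewrite [RHS]mulrA.
  rewrite -[LHS]mulrA mulr_suml big_mkord; congr (_ * _).
  by apply: eq_bigr => m _; rewrite [RHS]mulrA.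
have sE : \sum_(0 <= m < n + e) q ^+ m * h m =
   \sum_(0 <= m < n | win mu n m) q ^+ m * h m + \sum_(0 <= m < n + e | ~~ win mu n m) q ^+ m * h m.
  rewrite (bigID (win mu n)) /=; congr (_ + _).
  rewrite (big_cat_nat (n := n)) ?leq_addr //= [X in _ + X]big1_seq ?addr0 // => m /andP[/nlt hm].
  by rewrite mem_index_iota leqNgt hm.
set A := \sum_(0 <= m < n | _) _ in sE; set B := \sum_(0 <= m < n + e | ~~ _) _ in sE.
have B0 : 0 <= B by apply: sumr_ge0 => m _; rewrite mulr_ge0 // exprn_ge0 // ltW.
have Bb : B <= (n + e)%:R * out_bound k n.
  apply: (@le_trans _ _ (\sum_(0 <= m < n + e) out_bound k n)).
    rewrite /B big_mkcond /=; apply: ler_sum => m _; case: ifP => hm; last exact: out_bound_ge0.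
    exact: out_window_le.
  by rewrite sumr_const_nat subn0 -[leLHS]mulr_natl.
(* The boundary term of the sum by parts is one more term outside the window, whence the factor
   [(n + e).+1]. *)
have nwin : ~~ win mu n (n + e) by apply/negP => /nlt; rewrite ltnNge leq_addr.
have lb : q ^+ (n + e) * h (n + e)%N <= out_bound k n by exact: out_window_le.
have l0 : 0 <= q ^+ (n + e) * h (n + e)%N by rewrite mulr_ge0 // exprn_ge0 // ltW.
have Ab : `|A - hlim mu k * wtotal n| <= d / 2 * wtotal n.
  rewrite /A /wtotal !mulr_sumr -sumrB; apply: (le_trans (ler_norm_sum _ _ _)).
  apply: ler_sum => m hm; have w0 := nw m hm.
  have wE : q ^+ m * h m = wweight n m * (h m / (wamp R (n, m) * lam (n, m) ^+ n)).
    rewrite /wweight in w0 *.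
    have : wamp R (n, m) * lam (n, m) ^+ n != 0.
      by apply: contraTN w0 => /eqP ->; rewrite mulr0 ltxx.
    by move: (_ * _) => a a0; field.
  rewrite wE mulrC -mulrBl normrM [X in _ * X]ger0_norm ?(ltW w0) //.
  rewrite ler_wpM2r ?(ltW w0) //; apply/ltW; exact: nd.
rewrite -(ler_pM2r t0) -[X in _ * X <= _]gtr0_norm // -normrM mulrBl divfK ?gt_eqF //.
rewrite gE sE.
have -> : (1 - q) * hlim mu k * wtotal n - ((1 - q) * (A + B) + q ^+ (n + e) * h (n + e)%N) =
  - ((1 - q) * (A - hlim mu k * wtotal n)) - ((1 - q) * B + q ^+ (n + e) * h (n + e)%N) by ring.
apply: (le_trans (ler_normB _ _)).
have -> : d * wtotal n = d / 2 * wtotal n + d / 2 * wtotal n by field.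
apply: lerD.
  rewrite normrN normrM ger0_norm ?subr_ge0 ?(ltW q1) // (le_trans _ Ab) // ler_piMl //.
rewrite ger0_norm; last by rewrite addr_ge0 // mulr_ge0 // subr_ge0 ltW.
apply: (@le_trans _ _ ((n + e).+1%:R * out_bound k n)).
  rewrite -[(n + e).+1%:R]natr1 [leRHS]mulrDl mul1r; apply: lerD => //.
  by rewrite (le_trans _ Bb) // ler_piMl // gerBl ltW.
rewrite -ler_pdivrMr // (le_trans (ler_norm _)) // ltW //.
Unshelve. all: by end_near. Qed.

Lemma hlim1 : hlim mu 1 = 2.
Proof. by rewrite /hlim 2!big_ord_recl big_ord0 /= bin0 bin1 expr1 mul1r expr0 fact0 divr1 !addr0 add0r !mulr1. Qed.

Lemma cvg_growth_ratio k e :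
  growth q k (n + e) / growth q 1 n @[n --> \oo] --> (4 ^+ e * (hlim mu k / 2) : R).
Proof.
have /andP[q0 q1] := q_lt1.
have H : (growth q k (n + e) / 4 ^+ (n + e) / wtotal n) * (growth q 1 (n + 0) / 4 ^+ (n + 0) / wtotal n)^-1 * 4 ^+ e
   @[n --> \oo] --> ((1 - q) * hlim mu k * ((1 - q) * hlim mu 1)^-1 * 4 ^+ e : R).
  apply: cvgM; last exact: cvg_cst.
  apply: cvgM; first exact: cvg_growth.
  apply: cvgV; last exact: cvg_growth.
  by rewrite hlim1 mulf_neq0 // subr_eq0 gt_eqF.
rewrite (_ : _ * 4 ^+ e = 4 ^+ e * (hlim mu k / 2)) in H; last first.
  rewrite hlim1; have : 1 - q != 0 by rewrite subr_eq0 gt_eqF.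
  by move: (1 - q) (4 ^+ e : R) => a b a0; field.
apply: cvg_near_eq H; have Ht := near_wtotal_ge.
near=> n; rewrite addn0.
have t0 : wtotal n != 0.
  rewrite gt_eqF //; apply: (@lt_le_trans _ _ ((p n)^-1 ^+ 12 * expR (- mu * (3 / 2 * p n ^+ 4 + pi ^+ 2)))); last by near: n.
  rewrite mulr_gt0 ?expR_gt0 // exprn_gt0 // invr_gt0 (@lt_le_trans _ _ 1) //.
  by near: n; exact: wscale_ge.
have g0 : growth q 1 n != 0 by rewrite gt_eqF // growth_gt0.
rewrite exprD; have f0 : 4 ^+ n != 0 :> R by rewrite expf_neq0.
have f1 : 4 ^+ e != 0 :> R by rewrite expf_neq0.
move: (growth q k _) (growth q 1 n) g0 (wtotal n) t0 (4 ^+ n : R) f0 (4 ^+ e : R) f1 => a b b0 c c0 x x0 y y0.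
by field; rewrite ?b0 ?c0 ?x0 ?y0.
Unshelve. all: by end_near. Qed.

End GrowthAsymptotics.

(** * Cylinders and one-level extensions *)

Lemma mem_fset_set (X : choiceType) (A : set X) x : finite_set A -> x \in fset_set A <-> A x.
Proof. by move=> fA; rewrite in_fset_set //; split => [/set_mem|/mem_set]. Qed.

Section Trees.
Implicit Types (T : ptree) (w v : seq nat) (r h : nat).

Lemma ptree_eq T T' : verts T = verts T' -> T = T'.
Proof.
by case: T T' => [v a1 a2 a3 a4 a5 a6] [v' b1 b2 b3 b4 b5 b6] /= E; subst v';
  congr PTree; exact: Prop_irrelevance.
Qed.

Lemma verts_catl T w v : verts T (w ++ v) -> verts T w.
Proof.
by elim/last_ind: v => [|v i IH]; rewrite ?cats0 // -rcons_cat => /verts_prefix.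
Qed.

Lemma verts_take T w k : verts T w -> verts T (take k w).
Proof. by rewrite -{1}(cat_take_drop k w) => /verts_catl. Qed.

Lemma nchild_exists T w : exists n, forall i, verts T (rcons w i) <-> (i < n)%N.
Proof.
have [b hb] := verts_locfin T w.
have ex : exists n, `[< ~ verts T (rcons w n) >].
  by exists b; apply/asboolP => /hb; rewrite ltnn.
case: (ex_minnP ex) => n /asboolP nn nmin; exists n => i; split => [vi|i_n].
  by rewrite ltnNge; apply/negP => ni; exact: (nn (verts_sibling ni vi)).
by apply: contrapT => /asboolP /nmin; rewrite leqNgt i_n.
Qed.

Definition nchild T w := projT1 (cid (nchild_exists T w)).

Lemma nchildE T w i : verts T (rcons w i) <-> (i < nchild T w)%N.
Proof. exact: projT2 (cid (nchild_exists T w)) i. Qed.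

Lemma finite_ball T r : finite_set [set w | verts T w /\ (size w <= r)%N].
Proof.
elim: r => [|r IH].
  by apply: (sub_finite_set _ (finite_set1 [::])) => w [_]; rewrite leqn0 => /nilP ->.
pose A := [set w | verts T w /\ (size w <= r)%N].
apply: (@sub_finite_set _ _ (A `|` \bigcup_(w in A) [set rcons w i | i in `I_(nchild T w)])).
  move=> w [vw sw]; have [sr|rs] := leqP (size w) r; first by left.
  case/lastP: w vw sw rs => // w i vw; rewrite size_rcons ltnS => sw _; right.
  exists w; first by split => //; exact: verts_prefix vw.
  by exists i => //=; apply/nchildE.
rewrite finite_setU; split => //; apply: bigcup_finite => // w _.
by apply: finite_image; exact: finite_II.
Qed.

Lemma theight_ge T w : tfinite T -> verts T w -> (size w <= theight T)%N.
Proof.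
by move=> fT vw; apply: (@leq_bigmax_seq _ _ xpredT size); rewrite //; apply/mem_fset_set.
Qed.

Lemma theight_attained T : tfinite T -> exists2 w, verts T w & size w = theight T.
Proof.
move=> fT; rewrite /theight.
have H (s : seq (seq nat)) : s != [::] -> exists2 w, w \in s & size w = \max_(w <- s) size w.
  elim: s => // a s IH _; rewrite big_cons.
  have [->|/IH[w ws sw]] := eqVneq s [::]; first by exists a; rewrite ?mem_head // big_nil maxn0.
  rewrite -sw; have [aw|wa] := leqP (size a) (size w).
    by exists w; rewrite ?inE ?ws ?orbT.
  by exists a; rewrite ?mem_head.
have [|w ws sw] := H (fset_set (verts T)).
  have : [::] \in fset_set (verts T) by apply/mem_fset_set => //; exact: verts_root.
  move=> h; apply/eqP => E.
  have : [::] \in enum_fset (fset_set (verts T)) by exact: h.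
  by rewrite E.
by exists w => //; apply/mem_fset_set.
Qed.

Lemma theight_gt0 T : tfinite T -> (0 < theight T)%N.
Proof. by move=> fT; exact: (theight_ge fT (verts_root_child T)). Qed.

Lemma theightP T h : tfinite T -> (forall w, verts T w -> (size w <= h)%N) ->
  (exists2 w, verts T w & size w = h) -> theight T = h.
Proof.
move=> fT hT [w vw sw]; apply/eqP; rewrite eqn_leq -{2}sw theight_ge // andbT.
by have [v vv <-] := theight_attained fT; exact: hT.
Qed.

Definition trunc_verts r T : set (seq nat) := [set w | verts T w /\ (size w <= r.+1)%N].

Lemma trunc_root r T : trunc_verts r T [::].
Proof. by split => //; exact: verts_root. Qed.
Lemma trunc_prefix r T w i : trunc_verts r T (rcons w i) -> trunc_verts r T w.
Proof. by move=> [/verts_prefix vw]; rewrite size_rcons => /ltnW sw; split. Qed.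
Lemma trunc_sibling r T w i j : (j <= i)%N ->
  trunc_verts r T (rcons w i) -> trunc_verts r T (rcons w j).
Proof.
by move=> ji [vi]; rewrite size_rcons => si; split; rewrite ?size_rcons //; exact: verts_sibling vi.
Qed.
Lemma trunc_locfin r T w : exists n, forall i, trunc_verts r T (rcons w i) -> (i < n)%N.
Proof. by have [n hn] := verts_locfin T w; exists n => i [/hn]. Qed.
Lemma trunc_root_child r T : trunc_verts r T [:: 0%N].
Proof. by split => //; exact: verts_root_child. Qed.
Lemma trunc_root_deg1 r T : ~ trunc_verts r T [:: 1%N].
Proof. by move=> [/verts_root_deg1]. Qed.

(* The ball of radius [r + 1]: the radius is positive because the root has a child. *)
Definition trunc r T : ptree := PTree (trunc_root r T) (@trunc_prefix r T) (@trunc_sibling r T)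
  (trunc_locfin r T) (trunc_root_child r T) (@trunc_root_deg1 r T).

Lemma trunc_finite r T : tfinite (trunc r T). Proof. exact: finite_ball. Qed.

Lemma trunc_cyl r T w : verts T w -> size w = r.+1 ->
  theight (trunc r T) = r.+1 /\ tcyl (trunc r T) T.
Proof.
move=> vw sw; have hr : theight (trunc r T) = r.+1.
  apply: theightP; [exact: trunc_finite|by move=> v []|].
  by exists w => //; split; rewrite ?sw.
by split => // v; rewrite hr.
Qed.

Lemma tcyl_refl T : tfinite T -> tcyl T T.
Proof. by move=> fT w; split => [vw|[]//]; split => //; exact: theight_ge. Qed.

Lemma tcyl_le T0 T : tfinite T0 -> tfinite T -> tcyl T0 T -> (theight T0 <= theight T)%N.
Proof.
by move=> f0 fT cT; have [w /cT[vw _] <-] := theight_attained f0; exact: theight_ge.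
Qed.

Lemma tcyl_inj T1 T2 T : theight T1 = theight T2 -> tcyl T1 T -> tcyl T2 T -> T1 = T2.
Proof.
move=> h c1 c2; apply/ptree_eq/seteqP; split => w; first by rewrite c1 c2 h.
by rewrite c1 c2 h.
Qed.

Lemma tcyl_trans T0 T1 T : (theight T0 <= theight T1)%N -> tcyl T0 T1 -> tcyl T1 T -> tcyl T0 T.
Proof.
move=> h c0 c1 w; rewrite c0 c1; split=> [[[] //]|[vw sw]]; split => //.
by split => //; exact: leq_trans h.
Qed.

Lemma tcyl_between T0 T1 T : (theight T0 <= theight T1)%N -> tcyl T0 T -> tcyl T1 T -> tcyl T0 T1.
Proof.
move=> h c0 c1 w; rewrite c0 c1; split=> [[vw sw]|[[] //]]; split => //.
by split => //; exact: leq_trans h.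
Qed.

Definition text T0 : set ptree :=
  [set T1 | [/\ tfinite T1, tcyl T0 T1 & theight T1 = (theight T0).+1]].

(** Either [T] has a vertex one level above [T0], and its ball of that radius is the extension, or
    nothing is left of [T] outside [T0]. *)
Lemma tcyl_split T0 T : tfinite T0 -> tcyl T0 T ->
  T = T0 \/ exists2 T1, text T0 T1 & tcyl T1 T.
Proof.
move=> f0 c0; have [[w vw sw]|nw] := pselect (exists2 w, verts T w & size w = (theight T0).+1).
  right; have [h1 c1] := trunc_cyl vw sw; exists (trunc (theight T0) T) => //.
  split => //; first exact: trunc_finite.
  by apply: tcyl_between c0 c1; rewrite h1.
left; apply/ptree_eq/seteqP; split => w; last by move=> /c0[].
move=> vw; apply/c0; split => //; rewrite leqNgt; apply/negP => hw; apply: nw.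
by exists (take (theight T0).+1 w); [exact: verts_take|rewrite size_takel].
Qed.

Lemma text_not_cyl T0 T1 : tfinite T0 -> text T0 T1 -> ~ tcyl T1 T0.
Proof.
move=> f0 [f1 c0 h1] c1; have [w /c1[vw _] sw] := theight_attained f1.
by have := theight_ge f0 vw; rewrite sw h1 ltnn.
Qed.

Lemma finite_level T r : finite_set (level T r).
Proof. by apply: sub_finite_set (finite_ball T r) => w [vw sw]; split => //; rewrite sw. Qed.

Definition lsize T := #|` fset_set (level T (theight T))|%fset.

Lemma lsize_gt0 T : tfinite T -> (0 < lsize T)%N.
Proof.
move=> fT; have [w vw sw] := theight_attained fT.
rewrite cardfs_gt0; apply/fset0Pn; exists w.
by apply/mem_fset_set; [exact: finite_level|split].
Qed.

Lemma tedges_card T : tfinite T -> #|` fset_set (verts T)|%fset = (tedges T).+1.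
Proof.
move=> fT; rewrite /tedges subn1 prednK // cardfs_gt0; apply/fset0Pn; exists [::].
by apply/mem_fset_set => //; exact: verts_root.
Qed.

Lemma tedges_gt0 T : tfinite T -> (0 < tedges T)%N.
Proof.
move=> fT; rewrite -ltnS -tedges_card //.
have <- : #|` [fset [::]; [:: 0%N]] |%fset = 2%N by rewrite cardfs2.
apply: fsubset_leq_card; apply/fsubsetP => w; rewrite !inE => wE; apply/mem_fset_set => //; case/orP: wE => /eqP ->.
  exact: verts_root.
exact: verts_root_child.
Qed.

Lemma tedges_ext T0 T1 : tfinite T0 -> text T0 T1 -> tedges T1 = (tedges T0 + lsize T1)%N.
Proof.
move=> f0 [f1 c01 h1]; apply/succn_inj; rewrite -addSn -!tedges_card //.
have fl : finite_set (level T1 (theight T1)) by exact: finite_level.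
rewrite /lsize -cardfsUI (_ : _ `&` _ = fset0)%fset; last first.
  apply/fsetP => w; rewrite !inE; apply/negP => /andP[].
  move=> /(mem_fset_set _ f0) /c01[_ s0] /(mem_fset_set _ fl)[_ s1].
  by move: s0; rewrite s1 h1 ltnn.
rewrite cardfs0 addn0; congr (#|` _|)%fset; apply/fsetP => w; rewrite !inE.
apply/idP/orP => [/(mem_fset_set _ f1) vw|[/(mem_fset_set _ f0)/c01[vw _]|/(mem_fset_set _ fl)[vw _]]].
- have := theight_ge f1 vw; rewrite leq_eqVlt => /orP[/eqP sw|].
    by right; apply/mem_fset_set => //; split.
  by rewrite h1 ltnS => sw; left; apply/mem_fset_set => //; apply/c01.
- exact/mem_fset_set.
- exact/mem_fset_set.
Qed.

Lemma tedges_le_ext T0 T1 : tfinite T0 -> text T0 T1 -> (tedges T0 < tedges T1)%N.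
Proof.
by move=> f0 e1; rewrite (tedges_ext f0 e1) -[X in (X < _)%N]addn0 ltn_add2l lsize_gt0 //; case: e1.
Qed.

End Trees.

(** * One-level extensions parametrised by numbers of children *)

Lemma uniq_children (d : seq nat -> nat) (l : seq (seq nat)) : uniq l ->
  uniq (flatten [seq [seq rcons v i | i <- iota 0 (d v)] | v <- l]).
Proof.
elim: l => //= v l IH /andP[vl ul].
rewrite cat_uniq map_inj_uniq ?iota_uniq //=; last by move=> i j /rcons_inj[].
rewrite IH // andbT; apply/hasPn => w /flatten_mapP[v' vl' /mapP[i _ ->]].
by apply/negP => /mapP[j _ /rcons_inj[E _]]; move: vl; rewrite -E vl'.
Qed.

Section Extension.
Variables (T0 : ptree) (f0 : tfinite T0).
Implicit Types c : nat -> nat.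

Let lv : seq (seq nat) := fset_set (level T0 (theight T0)).

Lemma mem_top w : (w \in lv) = `[< verts T0 w /\ size w = theight T0 >].
Proof.
have fl := finite_level T0 (theight T0).
by apply/idP/asboolP => [/(mem_fset_set _ fl)|h] //; apply/(mem_fset_set _ fl).
Qed.

Lemma lsizeE : lsize T0 = size lv. Proof. by []. Qed.

Lemma index_top k : (k < lsize T0)%N -> index (nth [::] lv k) lv = k.
Proof. by move=> kl; rewrite index_uniq //; exact: fset_uniq. Qed.

(** Numbering the top vertices by their position in [lv] makes [c] a plain sequence of numbers, so
    that counting extensions becomes counting tuples of given sum. *)
Definition ext_verts c : set (seq nat) := [set w | verts T0 w \/
  exists v i, [/\ w = rcons v i, v \in lv & (i < c (index v lv))%N]].

Lemma ext_root c : ext_verts c [::]. Proof. by left; exact: verts_root. Qed.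
Lemma ext_prefix c w i : ext_verts c (rcons w i) -> ext_verts c w.
Proof.
move=> [/verts_prefix vw|[v [j [/rcons_inj[-> _] + _]]]]; first by left.
by rewrite mem_top => /asboolP[]; left.
Qed.
Lemma ext_sibling c w i j : (j <= i)%N -> ext_verts c (rcons w i) -> ext_verts c (rcons w j).
Proof.
move=> ji [vw|[v [k [/rcons_inj[wv ik] vl kc]]]]; first by left; exact: verts_sibling vw.
subst v k.
by right; exists w, j; split => //; exact: leq_ltn_trans kc.
Qed.
Lemma ext_locfin c w : exists n, forall i, ext_verts c (rcons w i) -> (i < n)%N.
Proof.
have [n hn] := verts_locfin T0 w; exists (n + c (index w lv))%N => i.
move=> [/hn /leq_trans|[v [k [/rcons_inj[wv ik] vl kc]]]]; first by apply; exact: leq_addr.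
subst v k.
exact: leq_trans kc (leq_addl _ _).
Qed.
Lemma ext_root_child c : ext_verts c [:: 0%N]. Proof. by left; exact: verts_root_child. Qed.
Lemma ext_root_deg1 c : ~ ext_verts c [:: 1%N].
Proof.
move=> [/verts_root_deg1//|[v [k [E + _]]]].
have -> : v = [::] by move: E; rewrite -[[:: 1%N]]/(rcons [::] 1%N) => /rcons_inj[].
by rewrite mem_top => /asboolP[_]; have := theight_gt0 f0 => + /esym; case: theight.
Qed.

Definition ext_tree c : ptree := PTree (ext_root c) (@ext_prefix c) (@ext_sibling c)
  (ext_locfin c) (ext_root_child c) (@ext_root_deg1 c).

Lemma ext_tree_sizeP c v i : v \in lv -> verts (ext_tree c) (rcons v i) <-> (i < c (index v lv))%N.
Proof.
move=> vl; split => [|ic]; last by right; exists v, i.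
move=> [vv|[v' [i' [/rcons_inj[<- <-] _ //]]]].
move: vl; rewrite mem_top => /asboolP[_ sv].
by have := theight_ge f0 vv; rewrite size_rcons sv ltnn.
Qed.

Lemma ext_tree_level c : level (ext_tree c) (theight T0).+1 =
  [set w | exists v i, [/\ w = rcons v i, v \in lv & (i < c (index v lv))%N]].
Proof.
apply/seteqP; split => w.
  by move=> [[vw|//] sw]; have := theight_ge f0 vw; rewrite sw ltnn.
move=> [v [i [-> vl ic]]]; split; first by right; exists v, i.
by move: vl; rewrite mem_top => /asboolP[_ sv]; rewrite size_rcons sv.
Qed.

Lemma ext_tree_le c w : verts (ext_tree c) w -> (size w <= (theight T0).+1)%N.
Proof.
move=> [/(theight_ge f0)/leqW//|[v [i [-> + _]]]].
by rewrite mem_top => /asboolP[_ sv]; rewrite size_rcons sv.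
Qed.

Lemma ext_tree_finite c : tfinite (ext_tree c).
Proof.
apply: sub_finite_set (finite_ball (ext_tree c) (theight T0).+1) => w vw; split => //.
exact: ext_tree_le vw.
Qed.

Lemma ext_treeP c k : (k < lsize T0)%N -> (0 < c k)%N -> text T0 (ext_tree c).
Proof.
move=> kl ck; have hE : theight (ext_tree c) = (theight T0).+1.
  apply: theightP; [exact: ext_tree_finite|exact: ext_tree_le|].
  have vl : nth [::] lv k \in lv by rewrite mem_nth.
  exists (rcons (nth [::] lv k) 0%N).
    by apply/ext_tree_sizeP => //; rewrite index_top.
  by move: vl; rewrite mem_top => /asboolP[_ sv]; rewrite size_rcons sv.
split => //; first exact: ext_tree_finite.
move=> w; split => [vw|[[//|]]]; first by split; [left|exact: theight_ge].
move=> [v [i [-> vl _]]]; rewrite size_rcons.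
by move: vl; rewrite mem_top => /asboolP[_ ->]; rewrite ltnn.
Qed.

Lemma ext_tree_inj c c' k : (k < lsize T0)%N -> ext_tree c = ext_tree c' -> c k = c' k.
Proof.
move=> kl E; have vl : nth [::] lv k \in lv by rewrite mem_nth.
have H i : (i < c k)%N <-> (i < c' k)%N.
  have := @ext_tree_sizeP c _ i vl; have := @ext_tree_sizeP c' _ i vl.
  by rewrite index_top // -E => <- <-.
apply/eqP; rewrite eqn_leq; apply/andP; split; rewrite leqNgt; apply/negP => /H; rewrite ltnn //.
Qed.

Lemma tsum_nat_eq0 n (c : nat -> nat) : (0 < \sum_(0 <= k < n) c k)%N -> exists2 k, (k < n)%N & (0 < c k)%N.
Proof.
elim: n => [|n IH]; first by rewrite big_geq.
rewrite big_nat_recr //= addn_gt0 => /orP[/IH[k kn ck]|cn]; last by exists n.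
by exists k => //; exact: ltnW.
Qed.

Lemma card_ext_level c : #|` fset_set (level (ext_tree c) (theight T0).+1)|%fset =
  (\sum_(0 <= k < lsize T0) c k)%N.
Proof.
rewrite ext_tree_level; pose s := flatten [seq [seq rcons v i | i <- iota 0 (c (index v lv))] | v <- lv].
have us : uniq s by apply: (uniq_children (fun v => c (index v lv))); exact: fset_uniq.
rewrite (_ : [set w | _] = [set` [fset w in s]%fset]); last first.
  apply/seteqP; split => w /=; rewrite inE.
    move=> [v [i [-> vl ic]]]; apply/flatten_mapP; exists v => //.
    by apply: map_f; rewrite mem_iota.
  move=> /flatten_mapP[v vl /mapP[i]]; rewrite mem_iota => ic ->.
  by exists v, i.
rewrite set_fsetK card_fseq undup_id // size_flatten /shape -map_comp sumnE big_map.
rewrite (big_nth [::]) lsizeE big_nat [RHS]big_nat; apply: eq_bigr => k /andP[_ kl].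
by rewrite /= size_map size_iota index_top.
Qed.

Lemma ext_tree_nchild T1 : text T0 T1 -> T1 = ext_tree (fun k => nchild T1 (nth [::] lv k)).
Proof.
move=> [f1 c01 h1]; apply/ptree_eq/seteqP; split => w.
  move=> vw; have := theight_ge f1 vw; rewrite h1 leq_eqVlt => /orP[/eqP sw|]; last first.
    by rewrite ltnS => sw; left; apply/c01.
  case/lastP: w sw vw => // w i; rewrite size_rcons => -[sw] vw; right; exists w, i.
  have wl : w \in lv.
    by rewrite mem_top; apply/asboolP; split => //; apply/c01; split; rewrite ?sw //; exact: verts_prefix vw.
  by split => //; rewrite nth_index //; apply/nchildE.
move=> [/c01[]//|[v [i [-> vl]]]]; rewrite nth_index // => /nchildE.
by [].
Qed.

End Extension.

(** * Sums over extensions and over the trees of a cylinder *)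

Lemma esum_bigcup_disj (R : realType) (T1 T2 : choiceType) (I : set T1) (J : T1 -> set T2)
    (a : T2 -> \bar R) : trivIset setT J -> (forall x, 0 <= a x)%E ->
  (\esum_(x in \bigcup_(i in I) J i) a x = \esum_(i in I) \esum_(x in J i) a x)%E.
Proof.
move=> tJ a0; rewrite esum_esum //; apply: reindex_esum => //; split.
- by move=> [/= i j] [Ki Jij]; exists i.
- move=> [/= i1 j1] [/= i2 j2] /set_mem[K1 J1] /set_mem[K2 J2] /= j12; subst j2.
  by congr (_, _); apply: (@tJ i1 i2) => //; exists j1.
- by move=> j [i Ki Jij] /=; exists (i, j).
Qed.

Section ExtensionSums.
Variable R : realType.
Implicit Types (T : ptree) (N j n : nat).

Lemma ext_tree_eq T0 (f0 : tfinite T0) c c' : (forall k, (k < lsize T0)%N -> c k = c' k) ->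
  ext_tree f0 c = ext_tree f0 c'.
Proof.
move=> cc; apply/ptree_eq/seteqP; split => w [vw|[v [i [-> vl ic]]]]; try by left.
  by right; exists v, i; split => //; rewrite -cc // index_mem.
by right; exists v, i; split => //; rewrite cc // index_mem.
Qed.

Definition text_lev T0 j : set ptree := [set T1 | text T0 T1 /\ lsize T1 = j].

(** The form counted by [card_ord_partitions]: [K.-1.+1] is [K] for positive [K], and entries below
    [j.+2] are no restriction when the sum is [j.+1]. *)
Definition comps K j : set (K.-1.+1.-tuple 'I_j.+2) :=
  [set c : K.-1.+1.-tuple 'I_j.+2 | (\sum_(i <- c) i)%N == j.+1].

Lemma text_lev_bij T0 (f0 : tfinite T0) j :
  set_bij (@comps (lsize T0) j) (text_lev T0 j.+1)
    (fun c : (lsize T0).-1.+1.-tuple 'I_j.+2 => ext_tree f0 (fun k => nth ord0 c k)).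
Proof.
have K0 : (lsize T0).-1.+1 = lsize T0 by rewrite prednK // lsize_gt0.
have sumE (c : (lsize T0).-1.+1.-tuple 'I_j.+2) :
    (\sum_(i <- c) i = \sum_(0 <= k < lsize T0) nth ord0 c k)%N.
  by rewrite (big_nth ord0) (_ : size c = lsize T0) // size_tuple.
split.
- move=> c /eqP cj; rewrite sumE in cj.
  have [k kl ck] : exists2 k, (k < lsize T0)%N & (0 < (nth ord0 c k : nat))%N.
    by apply: (@tsum_nat_eq0 _ (fun k => nth ord0 c k : nat)); rewrite cj.
  have e1 := @ext_treeP _ f0 (fun k => nth ord0 c k : nat) _ kl ck; split => //.
  rewrite /lsize; have [_ _ ->] := e1.
  by rewrite card_ext_level cj.
- move=> c c' _ _ E; apply/val_inj/(@eq_from_nth _ ord0); rewrite ?size_tuple // => k kl'; have kl : (k < lsize T0)%N by rewrite -K0.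
  by apply/val_inj; exact: (ext_tree_inj kl E).
- move=> T1 [e1 l1]; have E := ext_tree_nchild f0 e1; set d := (fun k => _) in E.
  have sd : (\sum_(0 <= k < lsize T0) d k = j.+1)%N.
    by rewrite -(card_ext_level f0) -E -l1 /lsize; case: e1 => _ _ ->.
  have dj k : (k < lsize T0)%N -> (d k < j.+2)%N.
    move=> kl; rewrite ltnS -sd big_mkord (bigD1 (Ordinal kl)) //=; exact: leq_addr.
  pose c : (lsize T0).-1.+1.-tuple 'I_j.+2 := [tuple inord (d k) | k < (lsize T0).-1.+1].
  have cE k : (k < lsize T0)%N -> nth ord0 c k = d k :> nat.
    move=> kl; have kl' : (k < (lsize T0).-1.+1)%N by rewrite K0.
    by rewrite -(tnth_nth _ c (Ordinal kl')) tnth_mktuple inordK // dj.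
  exists c; last by rewrite [RHS]E; exact: ext_tree_eq.
  apply/eqP; rewrite sumE; transitivity (\sum_(0 <= k < lsize T0) d k)%N => //; rewrite [LHS]big_nat [RHS]big_nat; apply: eq_bigr => k /andP[_ kl].
  exact: cE.
Qed.

Lemma finite_text_lev T0 j : tfinite T0 -> finite_set (text_lev T0 j).
Proof.
move=> f0; case: j => [|j].
  apply: sub_finite_set (finite_set0 ptree) => T1 [[f1 _ _]] l1.
  by have := lsize_gt0 f1; rewrite l1.
have [_ _ h] := text_lev_bij f0 j.
by apply: sub_finite_set h _; apply: finite_image; exact: finite_finset.
Qed.

Lemma text_bigcup T0 : text T0 = \bigcup_j text_lev T0 j.+1.
Proof.
apply/seteqP; split => [T1 e1|T1 [j _ []] //]; exists (lsize T1).-1 => //.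
by split => //; rewrite prednK // lsize_gt0 //; case: e1.
Qed.

Lemma esum_text_lev T0 j (a : R) : tfinite T0 -> 0 <= a ->
  (\esum_(T1 in text_lev T0 j.+1) a%:E = ('C(lsize T0 + j, j.+1)%:R * a)%:E)%E.
Proof.
move=> f0 a0; rewrite (reindex_esum _ _ _ _ (text_lev_bij f0 j)).
rewrite esum_fset; last 2 first.
- exact: finite_finset.
- by move=> c _; rewrite lee_fin.
rewrite fsbig_finite /=; last exact: finite_finset.
rewrite sumEFin big_const_seq count_predT iter_addr_0 mulr_natl.
suff -> : size (fset_set (@comps (lsize T0) j)) = 'C(lsize T0 + j, j.+1) by [].
have -> : size (fset_set (@comps (lsize T0) j)) =
    #|[set t : (lsize T0).-1.+1.-tuple 'I_j.+2 | (\sum_(i <- t) i == j.+1)%N]%SET|.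
  rewrite cardE; apply/perm_size/uniq_perm; rewrite ?enum_uniq ?fset_uniq // => c.
  rewrite mem_enum inE; have fc : finite_set (@comps (lsize T0) j) by exact: finite_finset.
  by apply/idP/idP => [/(mem_fset_set _ fc)//|cj]; apply/(mem_fset_set _ fc).
have := card_ord_partitions (lsize T0).-1 j.+1 => ->.
have -> : ((lsize T0).-1 + j.+1 = lsize T0 + j)%N by rewrite addnS -addSn prednK // lsize_gt0.
rewrite -bin_sub; last by rewrite -[X in (X <= _)%N](addn0) leq_add // leq_pred.
by congr 'C(_, _); have := lsize_gt0 f0; lia.
Qed.

Lemma esum_text T0 (phi : nat -> R) : tfinite T0 -> (forall j, 0 <= phi j) ->
  (\esum_(T1 in text T0) (phi (lsize T1))%:E =
   \sum_(0 <= j <oo) ('C(lsize T0 + j, j.+1)%:R * phi j.+1)%:E)%E.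
Proof.
move=> f0 p0; rewrite text_bigcup nneseries_sum_bigcup; last 2 first.
- by move=> i j _ _ [T1 [[_ l1] [_]]]; rewrite l1 => -[].
- by move=> T1; rewrite lee_fin.
apply: eq_eseriesr => j _; rewrite -esum_text_lev //.
by apply: eq_esum => T1 [_ ->].
Qed.

Lemma eseries_fin (f : nat -> R) n : (forall j, 0 <= f j) -> (forall j, (n <= j)%N -> f j = 0) ->
  (\sum_(0 <= j <oo) (f j)%:E = (\sum_(0 <= j < n) f j)%:E)%E.
Proof.
move=> f0 fn; rewrite (nneseries_split 0 n) //; last by move=> k _; rewrite lee_fin.
rewrite add0n sumEFin [X in (_ + X)%E]eseries0 ?adde0 // => j nj _.
by rewrite fn.
Qed.

Lemma tcyl_tedges_le T0 T : tfinite T0 -> tfinite T -> tcyl T0 T -> (tedges T0 <= tedges T)%N.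
Proof.
move=> f0 fT c0; rewrite -ltnS -!tedges_card //; apply: fsubset_leq_card.
apply/fsubsetP => w /(mem_fset_set _ f0) /c0[vw _]; exact/mem_fset_set.
Qed.

Definition tcylN T0 N : set ptree := treesN N `&` tcyl T0.

Lemma tcylN_lt T0 N : tfinite T0 -> (N < tedges T0)%N -> tcylN T0 N = set0.
Proof.
move=> f0 Nl; apply/seteqP; split => // T [[fT eT] c0].
by have := tcyl_tedges_le f0 fT c0; rewrite eT leqNgt Nl.
Qed.

Lemma tcylN_eq T0 : tfinite T0 -> tcylN T0 (tedges T0) = [set T0].
Proof.
move=> f0; apply/seteqP; split => [T [[fT eT] c0]|_ ->]; last by split => //; exact: tcyl_refl.
have [//|[T1 e1 c1]] := tcyl_split f0 c0.
have f1 : tfinite T1 by case: e1.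
by have := leq_trans (tedges_le_ext f0 e1) (tcyl_tedges_le f1 fT c1); rewrite eT ltnn.
Qed.

Lemma tcylN_gt T0 N : tfinite T0 -> (tedges T0 < N)%N ->
  tcylN T0 N = \bigcup_(T1 in setT) [set T | text T0 T1 /\ tcylN T1 N T].
Proof.
move=> f0 Nl; apply/seteqP; split => [T [[fT eT] c0]|T [T1 _ [e1 [tN c1]]]].
  have [TT0|[T1 e1 c1]] := tcyl_split f0 c0; first by move: Nl; rewrite -eT TT0 ltnn.
  by exists T1.
split => //; case: e1 => _ c01 h1; apply: tcyl_trans c01 c1.
by rewrite h1 leqnSn.
Qed.

(** Induction on the edges left to place, since an extension uses at least one and has finitely many
    shapes of given size. Finiteness makes the sums over [treesN] genuine ones. *)
Lemma finite_tcylN T0 N : tfinite T0 -> finite_set (tcylN T0 N).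
Proof.
move En : (N - tedges T0)%N => n f0.
elim/ltn_ind: n T0 En f0 => n IH T0 En f0.
have [Nl|] := ltnP N (tedges T0); first by rewrite tcylN_lt //; exact: finite_set0.
rewrite leq_eqVlt => /orP[/eqP <-|Nl]; first by rewrite tcylN_eq //; exact: finite_set1.
rewrite tcylN_gt //.
apply: (@sub_finite_set _ _ (\bigcup_(T1 in \bigcup_(j in `I_N.+1) text_lev T0 j)
   [set T | text T0 T1 /\ tcylN T1 N T])).
  move=> T [T1 _ [e1 [[fT eT] c1]]]; exists T1 => //; exists (lsize T1) => //=.
  have f1 : tfinite T1 by case: e1.
  rewrite ltnS -eT (leq_trans _ (tcyl_tedges_le f1 fT c1)) //.
  by rewrite (tedges_ext f0 e1) leq_addl.
apply: bigcup_finite.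
  by apply: bigcup_finite; [exact: finite_II|move=> j _; exact: finite_text_lev].
move=> T1 [j _ [e1 _]]; apply: (@sub_finite_set _ _ (tcylN T1 N)); first by move=> T [].
have lt1 := tedges_le_ext f0 e1.
by apply: (IH (N - tedges T1)%N) => //; [lia|case: e1].
Qed.

Variable (mu : R).
Local Notation q := (expR (- mu)).

Lemma tweightE T : tweight mu T = q ^+ theight T.
Proof. by rewrite /tweight -expRM_natl mulrC. Qed.

(** Splitting over the one-level extensions reproduces the recursion [growthS]: an extension with
    [j + 1] new vertices uses [j + 1] edges and one unit of height, and there are ['C(K + j, j + 1)]
    of them. *)
Lemma esum_tcylN T0 N : tfinite T0 ->
  (\esum_(T in tcylN T0 N) (tweight mu T)%:E =
   (if (tedges T0 <= N)%N then q ^+ theight T0 * growth q (lsize T0) (N - tedges T0) else 0)%:E)%E.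
Proof.
move En : (N - tedges T0)%N => n f0.
elim/ltn_ind: n T0 En f0 => n IH T0 En f0.
have w0 T : (0 <= (tweight mu T)%:E)%E by rewrite lee_fin expR_ge0.
have [Nl|] := ltnP N (tedges T0); first by rewrite tcylN_lt // esum_set0.
rewrite leq_eqVlt => /orP[/eqP NE|Nl].
  by rewrite -NE tcylN_eq // esum_set1 // -En -NE subnn growth0 mulr1 tweightE.
rewrite (tcylN_gt f0 Nl) esum_bigcup_disj //; last first.
  move=> T1 T2 _ _ [T [[[_ _ h1] [_ c1]] [[_ _ h2] [_ c2]]]].
  by apply: tcyl_inj c1 c2; rewrite h1 h2.
have g0 k m : 0 <= growth q k.+1 m by rewrite ltW // growth_gt0 // expR_gt0.
(* The contribution of an extension depends only on its number [j] of top vertices; the value at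
   [j = 0] is a default, an extension having at least one. *)
pose phi j : R := if (j <= n)%N then (if j is i.+1 then q ^+ (theight T0).+1 * growth q j (n - j) else 0) else 0.
have p0 j : 0 <= phi j.
  by rewrite /phi; case: ifP => // _; case: j => // j; rewrite mulr_ge0 // exprn_ge0 // expR_ge0.
transitivity (\esum_(T1 in text T0) (phi (lsize T1))%:E)%E.
  rewrite [RHS]esum_mkcond; apply: eq_esum => T1 _.
  case: ifPn => [/set_mem e1|/negP e1]; last first.
    rewrite (_ : [set _ | _] = set0) ?esum_set0 //.
    by apply/seteqP; split => // T [e2 _]; apply: e1; exact: mem_set.
  have lt1 := tedges_le_ext f0 e1; have E1 := tedges_ext f0 e1.
  have f1 : tfinite T1 by case: e1.
  rewrite (_ : [set _ | _] = tcylN T1 N); last by apply/seteqP; split => [T []|].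
  rewrite (IH (N - tedges T1)%N) //; last lia.
  have h1 : theight T1 = (theight T0).+1 by case: e1.
  have l1 := lsize_gt0 f1.
  have -> : (tedges T1 <= N)%N = (lsize T1 <= n)%N by rewrite E1; lia.
  have -> : (N - tedges T1 = n - lsize T1)%N by rewrite E1; lia.
  by rewrite /phi h1; case: (lsize T1) l1.
rewrite esum_text // (@eseries_fin _ n); first last.
- by move=> j nj; rewrite /phi ltnNge nj /= mulr0.
- by move=> j; rewrite mulr_ge0.
case: n {IH} En @phi p0 => [|n] En phi p0; first by lia.
rewrite growthS big_mkord; congr EFin.
rewrite [in RHS]mulrA [X in _ = X * _]mulrC -exprS mulr_sumr.
apply: eq_bigr => j _; rewrite /phi ltn_ord.
by rewrite mulrCA subSS.
Qed.

End ExtensionSums.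

(** * The one-edge tree, partition function and cylinder probabilities *)

Lemma edge_tree_finite : tfinite edge_tree.
Proof.
apply: (@sub_finite_set _ _ [set [::]; [:: 0%N]]); last by rewrite finite_setU; split; exact: finite_set1.
by move=> w [] ->; [left|right].
Qed.

Lemma theight_edge_tree : theight edge_tree = 1%N.
Proof.
apply: theightP; [exact: edge_tree_finite|by move=> w [] ->|].
by exists [:: 0%N] => //; right.
Qed.

(** All trees share the same ball of radius 1, so [ZN] and the total mass are particular cases of
    the cylinder formulas. *)
Lemma tcyl_edge_tree : tcyl edge_tree = setT.
Proof.
apply/seteqP; split => // T _ w; rewrite theight_edge_tree; split.
  by move=> [] ->; split => //; [exact: verts_root|exact: verts_root_child].
move=> [vw]; case: w vw => [|[|i] [|? ?]] // vw _; [by left|by right|].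
by have := @verts_sibling T [::] i.+1 1%N isT vw; move/verts_root_deg1.
Qed.

Lemma level_edge_tree : level edge_tree 1 = [set [:: 0%N]].
Proof. by apply/seteqP; split => [w [[] -> //]|_ ->]; split => //; right. Qed.

Lemma lsize_edge_tree : lsize edge_tree = 1%N.
Proof. by rewrite /lsize theight_edge_tree level_edge_tree fset_set1 cardfs1. Qed.

Lemma tedges_edge_tree : tedges edge_tree = 1%N.
Proof.
apply/succn_inj; rewrite -tedges_card; last exact: edge_tree_finite.
rewrite (_ : verts edge_tree = [set [::]] `|` [set [:: 0%N]]); last first.
  by apply/seteqP; split => w -[->|->]; by [left|right].
by rewrite fset_setU ?fset_set1 ?cardfs2 //; exact: finite_set1.
Qed.

Lemma tcylN_edge_tree N : tcylN edge_tree N = treesN N.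
Proof. by rewrite /tcylN tcyl_edge_tree setIT. Qed.

Lemma finite_treesN N : finite_set (treesN N).
Proof. by rewrite -tcylN_edge_tree; apply: finite_tcylN; exact: edge_tree_finite. Qed.

Section Cylinders.
Variables (R : realType) (mu : R).
Local Notation q := (expR (- mu)).

Lemma sum_tcylN T0 N : tfinite T0 ->
  \sum_(T \in tcylN T0 N) tweight mu T =
  if (tedges T0 <= N)%N then q ^+ theight T0 * growth q (lsize T0) (N - tedges T0) else 0.
Proof.
move=> f0; apply: EFin_inj; rewrite -esum_tcylN //; have fN := finite_tcylN N f0.
rewrite esum_fset //; last by move=> T _; rewrite lee_fin expR_ge0.
by rewrite -fsumEFin.
Qed.

Lemma ZNS n : ZN mu n.+1 = q * growth q 1 n.
Proof.
rewrite /ZN -tcylN_edge_tree sum_tcylN; last exact: edge_tree_finite.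
by rewrite theight_edge_tree lsize_edge_tree tedges_edge_tree /= expr1 subn1.
Qed.

Lemma ZN_gt0 n : 0 < ZN mu n.+1.
Proof. by rewrite ZNS mulr_gt0 ?expR_gt0 // growth_gt0 // expR_gt0. Qed.

Lemma nuN_ge0 N T : 0 <= nuN mu N T.
Proof.
(* No tree has 0 edges, so [ZN mu 0] is an empty sum. *)
rewrite divr_ge0 ?expR_ge0 //; case: N => [|n]; last exact: ltW (ZN_gt0 n).
rewrite /ZN -tcylN_edge_tree sum_tcylN; last exact: edge_tree_finite.
by rewrite tedges_edge_tree.
Qed.

Lemma sum_nuN n : \sum_(T \in treesN n.+1) nuN mu n.+1 T = 1.
Proof.
by rewrite /nuN -mulr_fsuml -?/(ZN mu n.+1) ?divff // gt_eqF // ZN_gt0.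
Qed.

Lemma sum_nuN_cyl T0 a : tfinite T0 ->
  \sum_(T \in tcylN T0 (a + tedges T0)) nuN mu (a + tedges T0) T =
  q ^+ (theight T0).-1 * (growth q (lsize T0) a / growth q 1 (a + (tedges T0).-1)).
Proof.
move=> f0; have e0 := tedges_gt0 f0; have h0 := theight_gt0 f0.
rewrite /nuN -mulr_fsuml.
rewrite sum_tcylN // leq_addl addnK.
have -> : (a + tedges T0 = (a + (tedges T0).-1).+1)%N by rewrite -addnS prednK.
rewrite ZNS -{1}(prednK h0) exprS.
have gn0 : growth q 1 (a + (tedges T0).-1) != 0 by rewrite gt_eqF // growth_gt0 // expR_gt0.
have q0 : q != 0 by rewrite gt_eqF // expR_gt0.
by field; rewrite gn0.
Qed.

Lemma cyl_valueE T0 : tfinite T0 ->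
  cyl_value mu T0 = q ^+ (theight T0).-1 * 4 ^- tedges T0 * 2 * hlim mu (lsize T0).
Proof.
move=> f0; rewrite /cyl_value -/(lsize T0) /hlim -expRM_natl [_.-1%:R * _]mulrC.
rewrite exprS !mulrA; congr (_ * _); last first.
  rewrite -(big_mkord xpredT (fun i => 'C(_, i)%:R * vlim mu i)) big_nat_recl //= mulr0 add0r big_add1; apply: eq_bigr => i _.
  by rewrite mulrA.
Qed.

Hypothesis hmu : 0 < mu.

(** Numerator and denominator of [sum_nuN_cyl] have different sizes; both are compared with
    [growth q 1 a], which produces the power of 4. *)
Lemma cvg_nuN_cyl T0 : tfinite T0 ->
  \sum_(T \in tcylN T0 N) nuN mu N T @[N --> \oo] --> cyl_value mu T0.
Proof.
move=> f0; have e0 := tedges_gt0 f0; rewrite -(cvg_shiftn (tedges T0)) /=.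
under eq_fun do rewrite sum_nuN_cyl //.
rewrite cyl_valueE // -2!mulrA; apply: cvgM; first exact: cvg_cst.
have c1 := @cvg_growth_ratio _ _ hmu (lsize T0) 0; have c2 := @cvg_growth_ratio _ _ hmu 1 (tedges T0).-1.
rewrite expr0 mul1r in c1; rewrite hlim1 divff // mulr1 in c2.
have -> : 4 ^- tedges T0 * (2 * hlim mu (lsize T0)) =
  (hlim mu (lsize T0) / 2) / 4 ^+ (tedges T0).-1.
  by rewrite -{1}(prednK e0) exprS invfM; field; rewrite expf_neq0.
have -> : (fun a => growth q (lsize T0) a / growth q 1 (a + (tedges T0).-1)) =
   (fun a => growth q (lsize T0) (a + 0) / growth q 1 a * (growth q 1 (a + (tedges T0).-1) / growth q 1 a)^-1).
  apply/funext => a; rewrite addn0.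
  have g0 b : growth q 1 b != 0 by rewrite gt_eqF // growth_gt0 // expR_gt0.
  by field; rewrite !g0.
by apply: cvgM => //; apply: cvgV => //; rewrite expf_neq0.
Qed.

End Cylinders.

(** * Consistency of the limiting values *)

Lemma mul_bin_trinomial k m i : (i <= m)%N ->
  ('C(k + m, m) * 'C(m, i) = 'C(k + i, i) * 'C(k + m, m - i))%N.
Proof.
move=> im; have F a b : ('C(a + b, b) * (b`! * a`!) = (a + b)`!)%N.
  by have := bin_fact (leq_addl a b); rewrite addnK.
have d0 : (0 < i`! * (m - i)`! * k`!)%N by rewrite !muln_gt0 !fact_gt0.
apply/eqP; rewrite -(eqn_pmul2r d0); apply/eqP.
have Fm := bin_fact im; have F1 := F k m; have F2 := F k i; have F3 := F (k + i)%N (m - i)%N.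
rewrite -addnA subnKC // in F3.
transitivity ('C(k + m, m) * ('C(m, i) * (i`! * (m - i)`!) * k`!))%N; first by ring.
rewrite Fm F1 -F3 -F2; ring.
Qed.

Section Consistency.
Variable R : realType.
Implicit Types (f : nat -> R) (c : nat -> nat -> R).

Lemma nneseries_cvg f x : series f @ \oo --> x -> (\sum_(0 <= k <oo) (f k)%:E = x%:E)%E.
Proof.
move=> fx; apply: cvg_lim => //.
rewrite (_ : (fun n => _) = EFin \o series f); last by apply/funext => n /=; rewrite sumEFin.
by apply: cvg_EFin => //; apply: nearW.
Qed.

Lemma nneseries_diag c : (forall i l, 0 <= c i l) ->
  (\sum_(0 <= m <oo) (\sum_(i < m.+1) c i (m - i)%N)%:E =
   \sum_(0 <= i <oo) \sum_(0 <= l <oo) (c i l)%:E)%E.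
Proof.
move=> c0; pose d m i := if (i <= m)%N then c i (m - i)%N else 0.
have d0 m i : 0 <= d m i by rewrite /d; case: ifP.
transitivity (\sum_(0 <= m <oo) \sum_(0 <= i <oo) (d m i)%:E)%E.
  apply: eq_eseriesr => m _; rewrite (@eseries_fin _ _ m.+1) //.
    by rewrite big_mkord; congr EFin; apply: eq_bigr => i _; rewrite /d -ltnS ltn_ord.
  by move=> j mj; rewrite /d leqNgt mj.
rewrite nneseries_interchange; last by move=> m i; rewrite lee_fin.
apply: eq_eseriesr => i _; rewrite (nneseries_split 0 i) ?add0n; last by move=> m _; rewrite lee_fin.
rewrite big_nat big1 ?add0e; last by move=> m /= im; rewrite /d leqNgt im.
rewrite -nneseries_addn; last by move=> m; rewrite lee_fin.
by apply: eq_eseriesr => l _; rewrite /d leq_addl addnK.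
Qed.

Lemma nneseries_shift1 (f : nat -> \bar R) : (forall j, 0 <= f j)%E ->
  (\sum_(0 <= j <oo) f j = f 0%N + \sum_(0 <= j <oo) f j.+1)%E.
Proof.
move=> f0; rewrite (nneseries_split 0 1) // big_nat1 -nneseries_addn //.
by congr (_ + _)%E; apply: eq_eseriesr => j _; rewrite add0n addn1.
Qed.

Lemma nneseries_exp x : 0 <= x -> (\sum_(0 <= l <oo) (x ^+ l / l`!%:R : R)%:E = (expR x)%:E)%E.
Proof. by move=> x0; apply: nneseries_cvg; exact: is_cvg_series_exp_coeff. Qed.

(** The negative binomial series of [(1 - x) ^- (L + 1)] at [x = 1 / 2]. The hockey-stick identity
    turns each step in [L] into a Cauchy product with the geometric series. *)
Lemma nneseries_negbin L : (\sum_(0 <= l <oo) ('C(L + l, l)%:R / 2 ^+ l : R)%:E = (2 ^+ L.+1)%:E)%E.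
Proof.
have half0 n : (0 : R) <= 2 ^- n by rewrite invr_ge0 exprn_ge0.
have geo : (\sum_(0 <= l <oo) (2 ^- l : R)%:E = 2%:E)%E.
  apply: nneseries_cvg; have h : `|2^-1 : R| < 1 by rewrite ger0_norm //; lra.
  have := @cvg_geometric_series R 1 _ h; rewrite (_ : 1 / (1 - 2^-1) = 2); last by field.
  suff -> : geometric 1 2^-1 = (fun k => 2 ^- k : R) by [].
  by apply/funext => k; rewrite /= mul1r exprVn.
elim: L => [|L IH].
  by rewrite expr1 -geo; apply: eq_eseriesr => l _; rewrite add0n binn mul1r.
pose c i l : R := 'C(L + i, i)%:R / 2 ^+ i * 2 ^- l.
have c0 i l : 0 <= c i l by rewrite !mulr_ge0.
transitivity (\sum_(0 <= m <oo) (\sum_(i < m.+1) c i (m - i)%N)%:E)%E.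
  apply: eq_eseriesr => m _; congr EFin.
  rewrite (_ : 'C(L.+1 + m, m) = \sum_(i < m.+1) 'C(L + i, i))%N; last first.
    elim: m => [|m IHm]; first by rewrite big_ord_recr big_ord0 /= !bin0.
    by rewrite big_ord_recr /= -IHm addSnnS addnS binS addnC -addSnnS.
  rewrite natr_sum mulr_suml; apply: eq_bigr => i _; rewrite /c -mulrA -invfM -exprD subnKC //.
  by rewrite -ltnS.
rewrite nneseries_diag //.
transitivity (\sum_(0 <= i <oo) (2%:E * ('C(L + i, i)%:R / 2 ^+ i : R)%:E))%E.
  apply: eq_eseriesr => i _; rewrite muleC -geo -nneseriesZl; last by move=> l _; rewrite lee_fin.
  by apply: eq_eseriesr => l _.
by rewrite nneseriesZl ?IH -?EFinM -?exprS // => i _; rewrite lee_fin mulr_ge0.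
Qed.

Variables (mu : R).
Hypothesis hmu : 0 <= mu.

Lemma vlim_ge0 i : 0 <= vlim mu i.
Proof. by case: i => //= i; rewrite divr_ge0 ?exprn_ge0. Qed.

Lemma hlim_ge0 k : 0 <= hlim mu k.
Proof.
rewrite /hlim mulr_ge0 ?exprn_ge0 //; apply: sumr_ge0 => i _.
by rewrite mulr_ge0 // vlim_ge0.
Qed.

(** Vandermonde splits the binomial as a sum of ['C(k.+1, r.+1) * 'C(m, r)], and ['C(m, r) / m!]
    separates [r] from [m - r]: the series is the product of that of [exp mu] and a finite sum. *)
Lemma nneseries_bin_vlim k :
  (\sum_(0 <= i <oo) ('C(k + i, i)%:R * vlim mu i)%:E =
   (expR mu * \sum_(i < k.+2) 'C(k.+1, i)%:R * vlim mu i)%:E)%E.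
Proof.
rewrite nneseries_shift1 /=; last by move=> i; rewrite lee_fin mulr_ge0 // vlim_ge0.
rewrite mulr0 add0e.
pose c r l : R := 'C(k.+1, r.+1)%:R * (mu ^+ r / r`!%:R) * (mu ^+ l / l`!%:R).
have e0 l : 0 <= mu ^+ l / l`!%:R :> R by rewrite divr_ge0 ?exprn_ge0.
transitivity (\sum_(0 <= m <oo) (\sum_(r < m.+1) c r (m - r)%N)%:E)%E.
  apply: eq_eseriesr => m _; congr EFin.
  have -> : 'C(k + m.+1, m.+1) = (\sum_(r < m.+1) 'C(k.+1, r.+1) * 'C(m, r))%N.
    rewrite -addSnnS -binomial.Vandermonde big_ord_recl subn0 (bin_small (ltnSn m)) muln0 add0n.
    apply: eq_bigr => r _; rewrite lift0 subSS bin_sub //; by rewrite -ltnS.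
  rewrite natr_sum mulr_suml; apply: eq_bigr => r _; rewrite /c.
  have rm : (r <= m)%N by rewrite -ltnS.
  have Fm : m`!%:R = 'C(m, r)%:R * (r`!%:R * (m - r)`!%:R) :> R by rewrite -!natrM bin_fact.
  have n0 n : n`!%:R != 0 :> R by rewrite pnatr_eq0 -lt0n fact_gt0.
  have b0 : 'C(m, r)%:R != 0 :> R by rewrite pnatr_eq0 -lt0n bin_gt0.
  have -> : mu ^+ m = mu ^+ r * mu ^+ (m - r) by rewrite -exprD subnKC.
  rewrite Fm natrM; field; by rewrite b0 !n0.
rewrite nneseries_diag; last by move=> r l; rewrite /c -mulrA mulr_ge0 ?ler0n // mulr_ge0.
transitivity (\sum_(0 <= r <oo) ((expR mu)%:E * ('C(k.+1, r.+1)%:R * vlim mu r.+1)%:E))%E.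
  apply: eq_eseriesr => r _; rewrite muleC -nneseries_exp // -nneseriesZl; last by move=> l _; rewrite lee_fin.
  by apply: eq_eseriesr => l _.
rewrite nneseriesZl; last by move=> i _; rewrite lee_fin mulr_ge0 ?ler0n ?vlim_ge0.
rewrite (@eseries_fin _ _ k.+1); last 2 first.
- by move=> r; rewrite mulr_ge0 ?ler0n ?vlim_ge0.
- by move=> r kr; rewrite bin_small ?mul0r.
rewrite -EFinM big_mkord [in RHS]big_ord_recl /= mulr0 add0r; congr (_ * _)%:E.
Qed.

(** After expanding [hlim] and setting [j + 1 = i + l], the sum over [l] is a negative binomial
    series worth [2 ^ (k + i + 1)], and the remaining sum over [i] is [nneseries_bin_vlim]. The
    added term of index 0 vanishes because [vlim mu 0 = 0]. *)
Lemma hlim_consistent K : (0 < K)%N ->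
  (\sum_(0 <= j <oo) ('C(K + j, j.+1)%:R * (4 ^- j.+1 * hlim mu j.+1))%:E =
   (expR mu * hlim mu K)%:E)%E.
Proof.
case: K => // k _; have half0 n : (0 : R) <= 2 ^- n by rewrite invr_ge0 exprn_ge0.
pose c i l : R := 'C(k + i, i)%:R * vlim mu i / 2 ^+ i * ('C(k + i + l, l)%:R / 2 ^+ l).
have c0 i l : 0 <= c i l by rewrite !mulr_ge0 // vlim_ge0.
transitivity (\sum_(0 <= m <oo) (\sum_(i < m.+1) c i (m - i)%N)%:E)%E.
  rewrite [RHS]nneseries_shift1; last by move=> m; rewrite lee_fin sumr_ge0.
  rewrite big_ord_recr big_ord0 /= /c mulr0 !mul0r addr0 add0e.
  apply: eq_eseriesr => j _; congr EFin; rewrite /hlim !mulr_sumr; apply: eq_bigr => i _.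
  have im : (i <= j.+1)%N by rewrite -ltnS.
  rewrite -addnA subnKC // addSnnS (_ : 4 = 2 * 2 :> R); last by ring.
  have E : 'C(k + j.+1, j.+1)%:R * 'C(j.+1, i)%:R = 'C(k + i, i)%:R * 'C(k + j.+1, j.+1 - i)%:R :> R.
    by rewrite -!natrM mul_bin_trinomial.
  have two0 n : 2 ^+ n != 0 :> R by rewrite expf_neq0.
  transitivity ('C(k + j.+1, j.+1)%:R * 'C(j.+1, i)%:R * vlim mu i / 2 ^+ j.+1).
    by rewrite exprMn; field.
  rewrite E (_ : 2 ^+ j.+1 = 2 ^+ i * 2 ^+ (j.+1 - i)); last by rewrite -exprD subnKC.
   by field; rewrite !two0.
rewrite nneseries_diag //.
transitivity (\sum_(0 <= i <oo) ((2 ^+ k.+1)%:E * ('C(k + i, i)%:R * vlim mu i)%:E))%E.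
  apply: eq_eseriesr => i _.
  under eq_eseriesr do rewrite /c EFinM.
  rewrite nneseriesZl; last by move=> l _; rewrite lee_fin mulr_ge0.
  rewrite nneseries_negbin -!EFinM; congr EFin; rewrite -addSn exprD.
  by field; rewrite expf_neq0.
rewrite nneseriesZl; last by move=> i _; rewrite lee_fin mulr_ge0 // vlim_ge0.
by rewrite nneseries_bin_vlim -EFinM /hlim mulrCA.
Qed.

Lemma cyl_value_ge0 T0 : tfinite T0 -> 0 <= cyl_value mu T0.
Proof. by move=> f0; rewrite cyl_valueE // mulr_ge0 ?hlim_ge0 // mulr_ge0 ?ler0n // mulr_ge0 //. Qed.

Lemma esum_cyl_value_ext T0 : tfinite T0 ->
  (\esum_(T1 in text T0) (cyl_value mu T1)%:E = (cyl_value mu T0)%:E)%E.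
Proof.
move=> f0; have h0 := theight_gt0 f0.
pose a := expR (- mu) ^+ theight T0 * 4 ^- tedges T0 * 2.
have a0 : 0 <= a by rewrite !mulr_ge0 ?exprn_ge0 ?expR_ge0 // invr_ge0 exprn_ge0.
transitivity (\esum_(T1 in text T0) (a * (4 ^- lsize T1 * hlim mu (lsize T1)))%:E)%E.
  apply: eq_esum => T1 e1; have [f1 _ h1] := e1.
  rewrite cyl_valueE // h1 (tedges_ext f0 e1) exprD invfM /a /=; congr EFin; ring.
have p0 j : 0 <= 4 ^- j * hlim mu j by rewrite mulr_ge0 ?hlim_ge0 // invr_ge0 exprn_ge0.
rewrite (esum_text (phi := fun j => a * (4 ^- j * hlim mu j))) //; last by move=> j; rewrite mulr_ge0.
under eq_eseriesr do rewrite mulrCA EFinM.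
rewrite nneseriesZl; last by move=> l _; rewrite lee_fin mulr_ge0.
rewrite hlim_consistent ?lsize_gt0 // -EFinM cyl_valueE //; congr EFin.
rewrite /a -{1}(prednK h0) exprSr expRN; have := expR_gt0 mu; move: (expR mu) => t t0.
have f4 : 4 ^+ tedges T0 != 0 :> R by rewrite expf_neq0.
move: (t^-1 ^+ _) => u; field; by rewrite f4 gt_eqF.
Qed.

End Consistency.

(* Nested half-open subintervals of [0, 1[ of lengths [p s]; the head of [s] is the last choice made. *)
Section NestedIntervals.
Variables (R : realType) (p : seq nat -> R).
Hypothesis p_ge0 : forall s, 0 <= p s.
Hypothesis p_nil : p [::] = 1.
Hypothesis p_sum : forall s, (\sum_(0 <= n <oo) (p (n :: s))%:E = (p s)%:E)%E.

Fixpoint itv_left (s : seq nat) : R :=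
  if s is n :: s' then itv_left s' + \sum_(0 <= i < n) p (i :: s') else 0.

Definition nitv (s : seq nat) : set R := [set x | itv_left s <= x < itv_left s + p s].

Lemma nitv_itv s : nitv s = [set` `[itv_left s, itv_left s + p s[].
Proof. by apply/seteqP; split => x /=; rewrite in_itv. Qed.

Lemma p_sum_le s n : \sum_(0 <= i < n) p (i :: s) <= p s.
Proof.
rewrite -lee_fin -p_sum -sumEFin; apply: nneseries_lim_ge => i _; by rewrite lee_fin.
Qed.

Lemma p_sum_lt s (y : R) : y < p s -> exists n, y < \sum_(0 <= i < n) p (i :: s).
Proof.
move=> yp; apply: contrapT => /forallNP H.
suff : ((p s)%:E <= y%:E)%E by rewrite lee_fin leNgt yp.
rewrite -p_sum; apply: lime_le; first by apply: is_cvg_nneseries => i _; rewrite lee_fin.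
apply: nearW => n; rewrite sumEFin lee_fin leNgt; exact/negP/H.
Qed.

Lemma nitv_sub n s : nitv (n :: s) `<=` nitv s.
Proof.
move=> x /= /andP[h1 h2]; apply/andP; split.
  by apply: le_trans h1; rewrite lerDl sumr_ge0.
apply: lt_le_trans h2 _; rewrite -addrA lerD2l.
by have := p_sum_le s n.+1; rewrite big_nat_recr.
Qed.

Lemma nitv_next s x : nitv s x -> exists n, nitv (n :: s) x.
Proof.
move=> /andP[h1 h2]; pose P n := x - itv_left s < \sum_(0 <= i < n) p (i :: s).
have ex : exists n, P n by apply: p_sum_lt; rewrite ltrBlDl.
(* The least number of lengths whose sum exceeds the offset of [x] is positive, and its predecessor
   is the child containing [x]. *)
case: (ex_minnP ex) => -[|n] Pn nmin.
  by move: Pn; rewrite /P big_geq // subr_lt0 ltNge h1.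
exists n; apply/andP; split => /=.
  rewrite -lerBrDl leNgt; apply/negP => Pn'.
  by have := nmin n Pn'; rewrite ltnn.
by rewrite -addrA -big_nat_recr //= -ltrBlDl.
Qed.

Lemma nitv_inj m n s x : nitv (m :: s) x -> nitv (n :: s) x -> m = n.
Proof.
suff H i j : nitv (i :: s) x -> nitv (j :: s) x -> (i <= j)%N.
  by move=> hm hn; apply/eqP; rewrite eqn_leq !H.
move=> /= /andP[h1 _] /andP[_ h2]; rewrite leqNgt; apply/negP => ji.
have := le_lt_trans h1 h2; rewrite -addrA ltrD2l -big_nat_recr //= ltNge => /negP; apply.
by rewrite [leRHS](@big_cat_nat _ _ _ j.+1) //= lerDl sumr_ge0.
Qed.

Definition path_next x s := xget 0%N [set n | nitv (n :: s) x].

Fixpoint path_of x k : seq nat :=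
  if k is k'.+1 then path_next x (path_of x k') :: path_of x k' else [::].

Lemma size_path_of x k : size (path_of x k) = k.
Proof. by elim: k => //= k ->. Qed.

Lemma nitv_path_of x k : 0 <= x < 1 -> nitv (path_of x k) x.
Proof.
move=> x01; elim: k => [|k IH]; first by rewrite /nitv /= p_nil add0r.
rewrite /= /path_next; have [n xn] := nitv_next IH.
by have := @xgetPex _ 0%N [set n | nitv (n :: path_of x k) x] (ex_intro _ n xn).
Qed.

Lemma nitv_nil_sub s : nitv s `<=` nitv [::].
Proof. by elim: s => // n s IH x /nitv_sub/IH. Qed.

Lemma path_of_eq s x : nitv s x -> path_of x (size s) = s.
Proof.
elim: s => // n s IH /= xs; rewrite (IH (nitv_sub xs)); congr (_ :: _).
have x01 : 0 <= x < 1 by have := nitv_nil_sub xs; rewrite /nitv /= p_nil add0r.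
by have := nitv_path_of (size s).+1 x01; rewrite /= (IH (nitv_sub xs)) => /nitv_inj/(_ xs).
Qed.

Lemma nitv_p_gt0 s x : nitv s x -> 0 < p s.
Proof. by move=> /andP[h1 h2]; have := le_lt_trans h1 h2; rewrite ltrDl. Qed.

Lemma lebesgue_nitv s : lebesgue_measure (nitv s) = (p s)%:E.
Proof.
rewrite nitv_itv lebesgue_measure_itv /= lte_fin ltrDl.
have := p_ge0 s; rewrite le_eqVlt => /orP[/eqP <-|ps]; first by rewrite ltxx.
by rewrite ps -EFinD addrAC subrr add0r.
Qed.

Lemma measurable_nitv s : measurable (nitv s).
Proof. by rewrite nitv_itv; exact: measurable_itv. Qed.

End NestedIntervals.

(** * The Borel sets of the space of trees *)

Definition tcode (T : ptree) : nat := choice.pickle (enum_fset (fset_set (verts T))).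

Lemma tcode_inj T T' : tfinite T -> tfinite T' -> tcode T = tcode T' -> T = T'.
Proof.
move=> fT fT' /(pcan_inj choice.pickleK) E; apply/ptree_eq/seteqP.
have H A B : tfinite A -> tfinite B -> enum_fset (fset_set (verts A)) = enum_fset (fset_set (verts B)) -> verts A `<=` verts B.
  move=> fA fB EAB w /(mem_fset_set w fA) wA; apply/(mem_fset_set w fB).
  have h : w \in enum_fset (fset_set (verts A)) := wA.
  by rewrite EAB in h.
by split; apply: H.
Qed.

(** The default [edge_tree] makes every number decode to a finite tree, so countable unions over
    finite trees can range over all of [nat]. *)
Definition tdec (n : nat) : ptree := xget edge_tree [set T | tfinite T /\ tcode T = n].

Lemma tcodeK T : tfinite T -> tdec (tcode T) = T.
Proof.
move=> fT; have [fD cD] := @xgetPex _ edge_tree [set T' | tfinite T' /\ tcode T' = tcode T] (ex_intro _ T (conj fT erefl)).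
exact: tcode_inj.
Qed.

Lemma tdec_finite n : tfinite (tdec n).
Proof. by rewrite /tdec; case: xgetP => [T _ []//|_]; exact: edge_tree_finite. Qed.

Lemma ball_eq_le r r' T T' : (r <= r')%N -> ball_eq r' T T' -> ball_eq r T T'.
Proof. by move=> rr b w sw; apply: b; exact: leq_trans rr. Qed.

Lemma ball_eq1 T T' : ball_eq 1 T T'.
Proof.
move=> w sw; have : tcyl edge_tree T by rewrite tcyl_edge_tree.
have : tcyl edge_tree T' by rewrite tcyl_edge_tree.
by move=> /(_ w) h' /(_ w) h; rewrite theight_edge_tree in h h'; tauto.
Qed.

Lemma ball_trunc r T : ball_eq r.+1 (trunc r T) T.
Proof. by move=> w sw; split=> [[]//|vw]; split. Qed.

Section Distance.
Variable R : realType.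
Implicit Types (T : ptree) (r : nat).

Let has_lb T T' : has_lbound [set (r%:R : R)^-1 | r in [set r : nat | (0 < r)%N /\ ball_eq r T T']].
Proof. by exists 0 => _ [r _ <-]; rewrite invr_ge0. Qed.

Lemma tdist_le T T' r : (0 < r)%N -> ball_eq r T T' -> (tdist T T' : R) <= r%:R^-1.
Proof. by move=> r0 b; apply: ge_inf; [exact: has_lb|exists r]. Qed.

Lemma tdist_lt_ball T T' r : (0 < r)%N -> (tdist T T' : R) < r%:R^-1 -> ball_eq r T T'.
Proof.
(* The infimum is over a nonempty set since any two trees agree up to height 1. *)
move=> r0 d; have hi : [set (r%:R : R)^-1 | r in [set r : nat | (0 < r)%N /\ ball_eq r T T']] !=set0.
  by exists 1%:R^-1, 1%N => //; split => //; exact: ball_eq1.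
have [_ [r' [r'0 b] <-] lt] := inf_lt hi d.
by apply: ball_eq_le b; rewrite -(ler_nat R) -lef_pV2 ?posrE ?ltr0n // ltW.
Qed.

Lemma topenP (U : set ptree) :
  @topen R U <-> forall T, U T -> exists r, forall T', ball_eq r.+1 T T' -> U T'.
Proof.
split => [oU T /oU[e e0 he]|oU T /oU[r hr]]; last first.
  exists (r.+1%:R^-1); first by rewrite invr_gt0 ltr0n.
  by move=> T' /tdist_lt_ball b; apply/hr/b.
have [r re] : exists r, (r.+1%:R : R)^-1 < e.
  by have [r _ hr] := @near_infty_natSinv_lt R (PosNum e0); exists r; exact: (hr r (leqnn r)).
by exists r => T' b; apply: he; apply: le_lt_trans re; exact: tdist_le.
Qed.

Lemma tcyl_open T0 : tfinite T0 -> @topen R (tcyl T0).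
Proof.
move=> f0; apply/topenP => T c0; exists (theight T0) => T' b w; rewrite c0.
by split=> -[vw sw]; split => //; apply/b => //; exact: leqW.
Qed.

Lemma measurable_tcyl T0 : tfinite T0 -> measurable (tcyl T0 : set (tree_borel R)).
Proof. by move=> f0; apply: sub_sigma_algebra; exact: tcyl_open. Qed.

Definition tcyls : set (set ptree) := [set A | A = set0 \/ exists2 T0, tfinite T0 & A = tcyl T0].

Lemma tcyls_tcyl T0 : tfinite T0 -> tcyls (tcyl T0).
Proof. by move=> f0; right; exists T0. Qed.

(** As in any ultrametric space, two cylinders are disjoint or nested; the taller tree has the
    smaller one. *)
Lemma setI_closed_tcyls : setI_closed tcyls.
Proof.
move=> A B [->|[T1 f1 ->]]; first by rewrite set0I; left.
move=> [->|[T2 f2 ->]]; first by rewrite setI0; left.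
have [[T [c1 c2]]|n] := pselect (exists T, tcyl T1 T /\ tcyl T2 T); last first.
  by left; apply/seteqP; split => // T [c1 c2]; apply: n; exists T.
have [h|/ltnW h] := leqP (theight T1) (theight T2).
  right; exists T2 => //; apply/seteqP; split => [T' []//|T' c']; split => //.
  exact: tcyl_trans (tcyl_between h c1 c2) c'.
right; exists T1 => //; apply/seteqP; split => [T' []//|T' c']; split => //.
exact: tcyl_trans (tcyl_between h c2 c1) c'.
Qed.

(** A finite tree is what its cylinder retains once the cylinders of its countably many extensions
    are removed. *)
Lemma sigma_single T0 : tfinite T0 -> <<s tcyls >> [set T0].
Proof.
move=> f0; pose F n := if `[< text T0 (tdec n) >] then tcyl (tdec n) else set0.
rewrite (_ : [set T0] = tcyl T0 `\` \bigcup_n F n); last first.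
  apply/seteqP; split => [_ ->|T [c0 nF]].
    split; first exact: tcyl_refl.
    by move=> [n _]; rewrite /F; case: asboolP => // e1; exact: text_not_cyl.
  have [//|[T1 e1 c1]] := tcyl_split f0 c0; case: nF; exists (tcode T1) => //.
  rewrite /F tcodeK; last by case: e1.
  by case: asboolP.
apply: (@measurableD _ (g_sigma_algebraType tcyls)).
  by apply: sub_sigma_algebra; exact: tcyls_tcyl.
apply: sigma_algebra_bigcup => n; apply: sub_sigma_algebra; rewrite /F; case: ifP => _; last by left.
by apply: tcyls_tcyl; exact: tdec_finite.
Qed.

(** If [T0] reaches height [r.+1] its ball is a cylinder; otherwise a tree agreeing with it has
    stopped growing as well and equals [T0]. *)
Lemma sigma_ball T0 r : tfinite T0 -> <<s tcyls >> [set T | ball_eq r.+1 T0 T].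
Proof.
move=> f0; pose T1 := trunc r T0; have f1 : tfinite T1 by exact: trunc_finite.
have b1 := @ball_trunc r T0.
have [[w vw sw]|nw] := pselect (exists2 w, verts T0 w & size w = r.+1).
  have [h1 c1] := trunc_cyl vw sw.
  rewrite (_ : [set _ | _] = tcyl T1); first by apply: sub_sigma_algebra; exact: tcyls_tcyl.
  apply/seteqP; split => [T b v|T c v sv].
    rewrite c1; rewrite h1; split=> -[vv sv]; split => //; by apply/(b v sv).
  have := c v; rewrite h1 => cv; have := b1 v sv => <-; rewrite cv; tauto.
rewrite (_ : [set _ | _] = [set T0]); first exact: sigma_single.
apply/seteqP; split => [T b|_ ->] //; apply/ptree_eq/seteqP.
have hT : forall v, verts T v -> (size v <= r)%N.
  move=> v vv; rewrite leqNgt; apply/negP => sv; apply: nw; exists (take r.+1 v); last by rewrite size_takel.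
  by apply/b; [rewrite size_takel|exact: verts_take].
have h0 : forall v, verts T0 v -> (size v <= r)%N.
  move=> v vv; rewrite leqNgt; apply/negP => sv; apply: nw; exists (take r.+1 v); last by rewrite size_takel.
  exact: verts_take.
by split => v vv; apply/b => //; apply: leqW; [exact: hT|exact: h0].
Qed.

(** Truncations are dense, so an open set is the union of the balls about finite trees that it
    contains, and these are countably many. *)
Lemma tree_borelE : @measurable _ (tree_borel R) = <<s tcyls >>.
Proof.
apply/seteqP; split; last first.
  apply: smallest_sub; first exact: sigma_algebra_measurable.
  by move=> _ [->|[T0 f0 ->]]; [exact: measurable0|exact: measurable_tcyl].
apply: smallest_sub; first exact: smallest_sigma_algebra.
move=> U /topenP oU.
pose F n r := if `[< [set T | ball_eq r.+1 (tdec n) T] `<=` U >] then [set T | ball_eq r.+1 (tdec n) T] else set0.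
rewrite (_ : U = \bigcup_n \bigcup_r F n r); last first.
  apply/seteqP; split => [T UT|T [n _ [r _]]]; last by rewrite /F; case: asboolP => // sub /sub.
  have [r hr] := oU T UT; exists (tcode (trunc r T)) => //; exists r => //.
  rewrite /F tcodeK; last exact: trunc_finite.
  case: asboolP => [_|[]]; first exact: ball_trunc.
  by move=> T' b; apply: hr => w sw; rewrite -(b w sw); apply: iff_sym; exact: ball_trunc.
apply: sigma_algebra_bigcup => n; apply: sigma_algebra_bigcup => r.
rewrite /F; case: ifP => _; last exact: sigma_algebra0.
by apply: sigma_ball; exact: tdec_finite.
Qed.

Lemma tree_borel_unique (m1 m2 : probability (tree_borel R) R) :
  (forall T0, tfinite T0 -> m1 (tcyl T0) = m2 (tcyl T0)) ->
  forall A : set (tree_borel R), measurable A -> m1 A = m2 A.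
Proof.
move=> H; apply: (@measure_unique _ R (tree_borel R) tcyls (fun=> setT)).
- exact: tree_borelE.
- exact: setI_closed_tcyls.
- by move=> _; rewrite -tcyl_edge_tree; apply: tcyls_tcyl; exact: edge_tree_finite.
- by rewrite bigcup_const //; exists 0%N.
- by move=> A [->|[T0 f0 ->]]; [rewrite !measure0|exact: H].
- by move=> _; apply: le_lt_trans (ltry 1); apply: (probability_le1 m1); exact: measurableT.
Qed.

End Distance.

(** * The limiting measure *)

(* A list [s] of codes stands for a chain of one-level extensions of [edge_tree], last tree first. *)
Definition tnode (s : seq nat) : ptree := if s is n :: _ then tdec n else edge_tree.

(** The last condition keeps a single code per tree, so that a sum over codes is a sum over
    extensions without repetition. *)
Fixpoint tvalid (s : seq nat) : Prop :=
  if s is n :: s' then [/\ tvalid s', text (tnode s') (tdec n) & tcode (tdec n) = n] else True.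

Lemma tnode_finite s : tfinite (tnode s).
Proof. by case: s => [|n s]; [exact: edge_tree_finite|exact: tdec_finite]. Qed.

Lemma theight_tnode s : tvalid s -> theight (tnode s) = (size s).+1.
Proof.
elim: s => [|n s IH] /=; first by rewrite theight_edge_tree.
by move=> [/IH hs [_ _ ->] _]; rewrite hs.
Qed.

Lemma tnode_inj s s' : tvalid s -> tvalid s' -> tnode s = tnode s' -> s = s'.
Proof.
elim: s s' => [|n s IH] [|n' s'] //.
- by move=> v v' E; have := theight_tnode v; rewrite E (theight_tnode v').
- by move=> v v' E; have := theight_tnode v; rewrite E (theight_tnode v').
move=> [v e c] [v' e' c'] /= E; congr (_ :: _); first by rewrite -c -c' E.
apply: IH => //; case: e => _ ce he; case: e' => _ ce' he'.
by apply: tcyl_inj ce _; rewrite ?E // ; apply/succn_inj; rewrite -he -he' E.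
Qed.

Lemma tnode_surj T0 : tfinite T0 -> exists s, tvalid s /\ tnode s = T0.
Proof.
move En : (theight T0) => k f0; elim: k T0 f0 En => [|k IH] T0 f0 hk.
  by have := theight_gt0 f0; rewrite hk.
case: k IH hk => [_|k IH] hk.
  exists [::]; split => //=; have c0 : tcyl edge_tree T0 by rewrite tcyl_edge_tree.
  have [//|[T1 [f1 _ h1] /(tcyl_le f1 f0)]] := tcyl_split edge_tree_finite c0.
  by rewrite h1 theight_edge_tree hk.
have [w vw sw] := theight_attained f0; rewrite hk in sw.
have vw' := verts_take k.+1 vw.
have [h1 c1] := trunc_cyl vw' (size_takel (leq_trans (leqnSn _) (eq_leq (esym sw)))).
have [s [vs Es]] := IH _ (@trunc_finite k T0) h1.
exists (tcode T0 :: s); rewrite /= tcodeK //; split => //; split => //; rewrite Es.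
by split => //; rewrite hk h1.
Qed.

(** In the application [S k] has height [k + 1], so [S (size w)] already decides whether [w] is a
    vertex. *)
Definition limit_verts (S : nat -> ptree) : set (seq nat) := [set w | verts (S (size w)) w].

Section Limit.
Variable S : nat -> ptree.
Hypothesis fS : forall k, tfinite (S k).
Hypothesis hS : forall k, theight (S k) = k.+1.
Hypothesis cS : forall k, tcyl (S k) (S k.+1).

Lemma limit_cyl k m : (k <= m)%N -> tcyl (S k) (S m) \/ k = m.
Proof.
elim: m => [|m IH]; first by rewrite leqn0 => /eqP; right.
rewrite leq_eqVlt => /orP[/eqP ->|]; [by right|rewrite ltnS => km; left].
have [c|->] := IH km; last exact: cS.
by apply: tcyl_trans c (cS m); rewrite !hS.
Qed.

Lemma limit_vertsE k w : (size w <= k.+1)%N -> limit_verts S w <-> verts (S k) w.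
Proof.
move=> sw; have H i j : (i <= j)%N -> (size w <= i.+1)%N -> verts (S i) w <-> verts (S j) w.
  move=> ij si; have [c|->//] := limit_cyl ij.
  by rewrite c hS; split=> [[]//|vw]; split.
rewrite /limit_verts /=; have [h|/ltnW h] := leqP (size w) k; first by apply: H => //; exact: leqW.
by apply: iff_sym; apply: H.
Qed.

Lemma limit_root : limit_verts S [::]. Proof. exact: verts_root. Qed.
Lemma limit_prefix w i : limit_verts S (rcons w i) -> limit_verts S w.
Proof.
rewrite (@limit_vertsE (size w)) ?size_rcons // (@limit_vertsE (size w)) //; exact: verts_prefix.
Qed.
Lemma limit_sibling w i j : (j <= i)%N -> limit_verts S (rcons w i) -> limit_verts S (rcons w j).
Proof. by rewrite /limit_verts /= !size_rcons; exact: verts_sibling. Qed.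
Lemma limit_locfin w : exists n, forall i, limit_verts S (rcons w i) -> (i < n)%N.
Proof.
have [n hn] := verts_locfin (S (size w).+1) w; exists n => i.
by rewrite /limit_verts /= size_rcons; exact: hn.
Qed.
Lemma limit_root_child : limit_verts S [:: 0%N]. Proof. exact: verts_root_child. Qed.
Lemma limit_root_deg1 : ~ limit_verts S [:: 1%N]. Proof. exact: verts_root_deg1. Qed.

Lemma limit_tree_ex : exists T, forall k, tcyl (S k) T.
Proof.
exists (PTree limit_root limit_prefix limit_sibling limit_locfin limit_root_child limit_root_deg1).
move=> k w /=; rewrite hS; split => [vw|[+ sw]]; last by rewrite (limit_vertsE sw).
have sw : (size w <= k.+1)%N by rewrite -hS; exact: theight_ge.
by rewrite (limit_vertsE sw).
Qed.

End Limit.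

Lemma pushforward_measure_ex (d d' : measure_display) (T1 : measurableType d) (T2 : measurableType d')
    (R : realType) (m : {measure set T1 -> \bar R}) (f : T1 -> T2) : measurable_fun setT f ->
  exists m' : {measure set T2 -> \bar R}, forall A, m' A = m (f @^-1` A).
Proof.
move=> mf; unshelve refine (ex_intro _ (pushforward m f : {measure set T2 -> \bar R}) _) => //.
Qed.

Section LimitMeasure.
Variables (R : realType) (mu : R).
Hypothesis hmu : 0 < mu.

(** Invalid chains get empty intervals, so the construction can be indexed by all lists. *)
Definition tprob (s : seq nat) : R := if `[< tvalid s >] then cyl_value mu (tnode s) else 0.

Lemma tprob_ge0 s : 0 <= tprob s.
Proof.
by rewrite /tprob; case: ifP => // _; apply: cyl_value_ge0; [exact: ltW|exact: tnode_finite].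
Qed.

Lemma tprob_nil : tprob [::] = 1.
Proof.
rewrite /tprob; case: asboolP => [_|/(_ I)//]; rewrite cyl_valueE; last exact: tnode_finite.
rewrite /tnode.
rewrite theight_edge_tree tedges_edge_tree lsize_edge_tree hlim1 expr0 expr1; lra.
Qed.

Lemma tprob_sum s : (\sum_(0 <= n <oo) (tprob (n :: s))%:E = (tprob s)%:E)%E.
Proof.
rewrite {2}/tprob; case: asboolP => [vs|nv]; last first.
  by apply: eseries0 => n _ _; rewrite /tprob; case: asboolP => //= -[].
rewrite nneseries_esumT; last by move=> n; rewrite lee_fin tprob_ge0.
rewrite -(esum_cyl_value_ext (ltW hmu) (tnode_finite s)).
pose D := [set n | tvalid (n :: s)].
rewrite (reindex_esum D (text (tnode s)) tdec); last first.
  split.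
  - by move=> n [_ e _].
  - by move=> n n' /set_mem[_ _ c] /set_mem[_ _ c'] E; rewrite -c -c' E.
  - move=> T e; have [fT _ _] := e; exists (tcode T); last exact: tcodeK.
    by split; rewrite ?tcodeK.
rewrite [RHS]esum_mkcond; apply: eq_esum => n _; rewrite /tprob.
by case: asboolP => [v|nv]; [rewrite mem_set|rewrite memNset].
Qed.

Local Notation itv01 := [set x : R | 0 <= x < 1].

(** Repeating [0 <= x < 1] inside the set forces the default value elsewhere, which keeps [tlim]
    measurable on the whole line. *)
Definition tlim (x : R) : ptree :=
  xget edge_tree [set T | 0 <= x < 1 /\ forall k, tcyl (tnode (path_of tprob x k)) T].

Lemma tvalid_path x k : 0 <= x < 1 -> tvalid (path_of tprob x k).
Proof.
move=> /(nitv_path_of tprob_ge0 tprob_nil tprob_sum)-/(_ k)/nitv_p_gt0.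
by rewrite {1}/tprob; case: asboolP => //; rewrite ltxx.
Qed.

Lemma tlimP x k : 0 <= x < 1 -> tcyl (tnode (path_of tprob x k)) (tlim x).
Proof.
move=> x01; pose S k := tnode (path_of tprob x k).
have [T hT] : exists T, forall k, tcyl (S k) T.
  apply: limit_tree_ex => {}k; first exact: tnode_finite.
    by rewrite theight_tnode ?size_path_of //; exact: tvalid_path.
  by have [_ []] := tvalid_path k.+1 x01.
by have [_ /(_ k)] := @xgetPex _ edge_tree [set T | 0 <= x < 1 /\ forall k, tcyl (S k) T] (ex_intro _ T (conj x01 hT)).
Qed.

Lemma tlim_cylE x T0 s : 0 <= x < 1 -> tvalid s -> tnode s = T0 ->
  tcyl T0 (tlim x) <-> nitv tprob s x.
Proof.
move=> x01 vs Es; have vp := tvalid_path (size s) x01; have cp := tlimP (size s) x01.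
split => [c0|xs]; last first.
  by move: cp; rewrite (path_of_eq tprob_ge0 tprob_nil tprob_sum xs) Es.
suff <- : path_of tprob x (size s) = s by apply: nitv_path_of; [exact: tprob_ge0|exact: tprob_nil|exact: tprob_sum|].
apply: tnode_inj => //; rewrite Es; apply: tcyl_inj cp c0.
by rewrite -Es !theight_tnode // size_path_of.
Qed.

Lemma measurable_itv01 : measurable itv01.
Proof.
rewrite (_ : itv01 = [set` `[0%R, 1%R[]); first exact: measurable_itv.
by apply/seteqP; split => x /=; rewrite in_itv.
Qed.

Lemma tlim_preimage T0 : tfinite T0 -> exists2 s, tprob s = cyl_value mu T0 &
  tlim @^-1` tcyl T0 `&` itv01 = nitv tprob s.
Proof.
move=> f0; have [s [vs Es]] := tnode_surj f0; exists s.
  by rewrite /tprob; case: asboolP => //; rewrite Es.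
apply/seteqP; split => x.
  by move=> [c x01]; apply/(tlim_cylE x01 vs Es).
move=> xs; have x01 : 0 <= x < 1.
  by have := nitv_nil_sub tprob_ge0 tprob_sum xs; rewrite /nitv /= tprob_nil add0r.
by split => //; apply/(tlim_cylE x01 vs Es).
Qed.

Lemma measurable_tlim : measurable_fun setT (tlim : R -> tree_borel R).
Proof.
apply: (@measurability _ _ R (tree_borel R) setT tlim tcyls); first exact: tree_borelE.
move=> _ [A GA <-]; rewrite setTI; case: GA => [->|[T0 f0 ->]].
  by rewrite preimage_set0; exact: measurable0.
have [s _ E] := tlim_preimage f0.
(* Inside the unit interval the preimage is a nested interval; outside it [tlim] is constant. *)
rewrite -(setUIDK (tlim @^-1` tcyl T0) itv01) E; apply: measurableU.
  exact: measurable_nitv.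
rewrite (_ : _ `\` _ = if `[< tcyl T0 edge_tree >] then ~` itv01 else set0).
  by case: ifP => _; [apply: measurableC; exact: measurable_itv01|exact: measurable0].
have out x : ~ 0 <= x < 1 -> tlim x = edge_tree by move=> nx; apply: xgetPN => T [].
case: asboolP => c; apply/seteqP; split => x //=; first by case.
  by move=> nx; split => //; rewrite /preimage /= out.
by move=> [c' nx]; move: c'; rewrite /preimage /= out.
Qed.

Lemma limit_measure_ex : exists nu : probability (tree_borel R) R,
  forall T0, tfinite T0 -> nu (tcyl T0) = (cyl_value mu T0)%:E.
Proof.
pose nu := pushforward (mrestr lebesgue_measure measurable_itv01) (tlim : R -> tree_borel R).
have [m mE] := pushforward_measure_ex (mrestr lebesgue_measure measurable_itv01) measurable_tlim.
have nuE T0 : tfinite T0 -> nu (tcyl T0) = (cyl_value mu T0)%:E.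
  move=> f0; have [s ps E] := tlim_preimage f0.
  rewrite /nu /pushforward /mrestr /= E lebesgue_nitv ?ps //; exact: tprob_ge0.
have nu1 : nu setT = 1%E.
  rewrite -tcyl_edge_tree nuE; last exact: edge_tree_finite.
  by have := tprob_nil; rewrite /tprob; case: asboolP => [_ ->|/(_ I)].
have m1 : m setT = 1%E by rewrite mE.
have mcyl T0 : tfinite T0 -> m (tcyl T0) = (cyl_value mu T0)%:E by move=> f0; rewrite mE -nuE.
(* The mass is already 1; normalising only supplies the structure of a probability. *)
exists (mnormalize m (dirac (edge_tree : tree_borel R))) => T0 f0.
by rewrite /= /mnormalize m1 /= orbF onee_eq0 invr1 mule1 mcyl.
Qed.

End LimitMeasure.

(** * Weak convergence *)

Section WeakConvergence.
Variables (R : realType) (mu : R) (nu : probability (tree_borel R) R).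
Hypothesis hmu : 0 < mu.
Hypothesis nu_cyl : forall T0, tfinite T0 -> nu (tcyl T0) = (cyl_value mu T0)%:E.

Lemma measurable_tree1 T0 : tfinite T0 -> measurable ([set T0] : set (tree_borel R)).
Proof. by move=> f0; rewrite tree_borelE; exact: sigma_single. Qed.

(** By consistency the disjoint cylinders of the extensions carry all the mass of [tcyl T0], and
    [T0] is what remains. *)
Lemma nu_tree1 T0 : tfinite T0 -> nu [set T0] = 0%E.
Proof.
move=> f0; have [s [vs Es]] := tnode_surj f0.
pose F n : set (tree_borel R) := if `[< tvalid (n :: s) >] then tcyl (tdec n) else set0.
have mF n : measurable (F n).
  rewrite /F; case: ifP => _; last exact: measurable0.
  by apply: measurable_tcyl; exact: tdec_finite.
have tF : trivIset setT F.
  move=> n n' _ _ [T []]; rewrite /F; case: asboolP => // -[_ e c]; case: asboolP => // -[_ e' c'] c1 c2.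
  rewrite -c -c'; congr tcode; apply: tcyl_inj c1 c2.
  by case: e => _ _ ->; case: e' => _ _ ->.
have FU : nu (\bigcup_n F n) = (cyl_value mu T0)%:E.
  rewrite measure_bigcup //; under eq_eseriesl do rewrite in_setT.
  transitivity (\sum_(0 <= n <oo) (tprob mu (n :: s))%:E)%E.
    apply: eq_eseriesr => n _; rewrite /F /tprob; case: asboolP => _; last exact: measure0.
    exact: nu_cyl (tdec_finite n).
  rewrite (tprob_sum hmu) /tprob; case: asboolP => // _; by rewrite Es.
have mU : measurable (\bigcup_n F n) by exact: bigcup_measurable.
have FT : \bigcup_n F n `<=` tcyl T0.
  move=> T [n _]; rewrite /F; case: asboolP => // -[_ [_ c h] _]; rewrite Es in c h.
  by apply: tcyl_trans c; rewrite h.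
rewrite (_ : [set T0] = tcyl T0 `\` \bigcup_n F n).
  rewrite measureD //; last 2 first.
  - exact: measurable_tcyl.
  - by apply: le_lt_trans (ltry 1); apply: (probability_le1 nu); exact: measurable_tcyl.
  have E1 : nu (tcyl T0 `&` \bigcup_n F n) = (cyl_value mu T0)%:E by rewrite setIidr.
  apply: etrans (_ : (cyl_value mu T0)%:E - (cyl_value mu T0)%:E = 0)%E; last by rewrite subee.
  by congr (_ - _)%E; [exact: nu_cyl|exact: E1].
apply/seteqP; split => [_ ->|T [c0 nF]].
  split; first exact: tcyl_refl.
  move=> [n _]; rewrite /F; case: asboolP => // -[_ e _]; rewrite Es in e; exact: text_not_cyl.
have [//|[T1 e1 c1]] := tcyl_split f0 c0; case: nF; exists (tcode T1) => //.
have f1 : tfinite T1 by case: e1.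
rewrite /F; case: asboolP => [|[]]; first by rewrite tcodeK.
by rewrite /= tcodeK // Es.
Qed.

Lemma measurable_tcontinuous (f : ptree -> R) : tcontinuous f ->
  measurable_fun setT (f : tree_borel R -> R).
Proof.
move=> cf; apply: (@measurability _ _ (tree_borel R) R setT f (@RGenOInfty.G R)).
  exact: RGenOInfty.measurableE.
move=> _ [_ [x ->] <-]; rewrite setTI; apply: sub_sigma_algebra => T /=.
rewrite in_itv /= andbT => xf.
have xf' : 0 < f T - x by rewrite subr_gt0.
have [d d0 hd] := cf T _ xf'.
exists d => // T' /hd; rewrite /= in_itv /= andbT => /ltr_normlW; lra.
Qed.

Definition nuN_sum N (g : ptree -> R) := \sum_(T \in treesN N) g T * nuN mu N T.

Lemma nuN_sumE N g : nuN_sum N g = \sum_(T <- fset_set (treesN N)) g T * nuN mu N T.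
Proof. by rewrite /nuN_sum fsbig_finite //; exact: finite_treesN. Qed.

Definition nuint (g : ptree -> R) : R := (\int[nu]_(x in setT) (g : tree_borel R -> R) x)%R.

Definition nuintegrable (g : ptree -> R) := nu.-integrable setT (EFin \o (g : tree_borel R -> R)).

Definition wconv (g : ptree -> R) : Prop :=
  nuintegrable g /\ nuN_sum N g @[N --> \oo] --> nuint g.

Lemma wconvD g h : wconv g -> wconv h -> wconv (fun T => g T + h T).
Proof.
move=> [ig cg] [ih ch]; split; first exact: (integrableD measurableT ig ih).
rewrite /nuint RintegralD //.
have -> : (fun N => nuN_sum N (fun T => g T + h T)) = (fun N => nuN_sum N g + nuN_sum N h).
  by apply/funext => N; rewrite !nuN_sumE -big_split /=; apply: eq_bigr => T _; rewrite mulrDl.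
exact: cvgD.
Qed.

Lemma wconvZ a g : wconv g -> wconv (fun T => a * g T).
Proof.
move=> [ig cg]; split; first exact: (integrableZl measurableT a ig).
rewrite /nuint RintegralZl //.
have -> : (fun N => nuN_sum N (fun T => a * g T)) = (fun N => a * nuN_sum N g).
  by apply/funext => N; rewrite !nuN_sumE mulr_sumr; apply: eq_bigr => T _; rewrite mulrA.
by apply: cvgM => //; exact: cvg_cst.
Qed.

Lemma wconv_cst a : wconv (fun=> a).
Proof.
split; first by apply: finite_measure_integrable_cst.
have -> : nuint (fun=> a) = a.
  rewrite /nuint Rintegral_cst //; apply: etrans (_ : a * fine 1%E = a); last by rewrite mulr1.
  congr (a * fine _); exact: (probability_setT nu).
apply: cvg_near_eq; last exact: cvg_cst.
(* Only from [N = 1] on do the weights add up to 1. *)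
exists 1%N => // -[//|n] _ /=; rewrite /nuN_sum -mulr_fsumr sum_nuN mulr1 //.
Qed.

Lemma wconv_sum n (g : nat -> ptree -> R) : (forall k, wconv (g k)) ->
  wconv (fun T => \sum_(k < n) g k T).
Proof.
move=> wg; elim: n => [|n IH].
  by rewrite (_ : (fun _ => _) = fun=> 0); [exact: wconv_cst|apply/funext => T; rewrite big_ord0].
rewrite (_ : (fun _ => _) = fun T => \sum_(k < n) g k T + g n T); first exact: wconvD.
by apply/funext => T; rewrite big_ord_recr.
Qed.

Lemma nuint_indic (A : set (tree_borel R)) : measurable A -> (nuint \1_A)%:E = nu A.
Proof.
move=> mA; rewrite /nuint /Rintegral fineK; first by rewrite integral_indic // setIT.
by rewrite integral_indic // setIT fin_num_measure.
Qed.

Lemma wconv_tcyl T0 : tfinite T0 -> wconv \1_(tcyl T0).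
Proof.
move=> f0; split; first by apply: integrable_indic; exact: measurable_tcyl.
have -> : nuint \1_(tcyl T0) = cyl_value mu T0.
  by apply: EFin_inj; rewrite nuint_indic ?nu_cyl //; exact: measurable_tcyl.
have -> : (fun N => nuN_sum N \1_(tcyl T0)) = (fun N => \sum_(T \in tcylN T0 N) nuN mu N T).
  apply/funext => N; rewrite /nuN_sum /tcylN [RHS]fsbig_mkcondr; apply: eq_fsbigr => T _.
  by rewrite indicE; case: (T \in _); rewrite ?mul1r ?mul0r.
exact: cvg_nuN_cyl.
Qed.

Definition finunion (A : nat -> set ptree) n : set ptree := \bigcup_(k in `I_n) A k.

Lemma finunionS A n : finunion A n.+1 = finunion A n `|` A n.
Proof. by rewrite /finunion IIS bigcup_setU bigcup_set1. Qed.

(** Inclusion-exclusion: adding [A n] creates the correction for the union of the sets [A k]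
    intersected with [A n], again a union of [n] sets of the pi-system. The induction is therefore
    over all families at once. *)
Lemma wconv_finunion A n : (forall k, tcyls (A k)) -> wconv \1_(finunion A n).
Proof.
have w1 B : tcyls B -> wconv \1_B.
  move=> [->|[T0 f0 ->]]; last exact: wconv_tcyl.
  by rewrite indic0; exact: wconv_cst.
elim: n A => [|n IH] A hA.
  by rewrite /finunion II0 bigcup_set0 indic0; exact: wconv_cst.
have -> : \1_(finunion A n.+1) = (fun T => (\1_(finunion A n) T + \1_(A n) T) +
     (-1) * \1_(finunion (fun k => A k `&` A n) n) T) :> (ptree -> R).
  rewrite finunionS; apply/funext => T; rewrite /finunion -setI_bigcupl !indicE in_setU in_setI.
  by do 2 case: (_ \in _); rewrite /= ; lra.
apply: wconvD; first by apply: wconvD; [exact: IH|exact: w1].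
by apply: wconvZ; apply: IH => k; exact: setI_closed_tcyls.
Qed.

Variable f : ptree -> R.
Hypothesis cf : tcontinuous f.
Variable M : R.
Hypothesis fM : forall T, `|f T| <= M.

Lemma nuintegrable_f : nuintegrable f.
Proof.
apply: measurable_bounded_integrable => //.
- by apply: le_lt_trans (ltry 1); apply: (probability_le1 nu); exact: measurableT.
- exact: measurable_tcontinuous.
exists M; split; first exact: num_real.
by move=> y My T _ /=; apply: le_trans (fM T) (ltW My).
Qed.

Definition goodcyl e n : set ptree :=
  if `[< forall T, tcyl (tdec n) T -> `|f T - f (tdec n)| <= e >] then tcyl (tdec n) else set0.

Lemma goodcyl_tcyls e n : tcyls (goodcyl e n).
Proof. by rewrite /goodcyl; case: ifP => _; [apply: tcyls_tcyl; exact: tdec_finite|left]. Qed.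

Lemma goodcylP e n T : goodcyl e n T -> `|f T - f (tdec n)| <= e.
Proof. by rewrite /goodcyl; case: asboolP => // H /H. Qed.

(** An infinite tree has vertices at every height, so its small balls are cylinders. For a finite
    tree they shrink to a singleton, which is why only infinite trees are covered. *)
Lemma goodcyl_cover e T : 0 < e -> ~ tfinite T -> exists n, goodcyl e n T.
Proof.
move=> e0 nT; have e20 : 0 < e / 2 by lra.
have [d d0 hd] := cf T e20.
have [r hr] : exists r, (r.+1%:R : R)^-1 < d.
  by have [r _ hr] := @near_infty_natSinv_lt R (PosNum d0); exists r; exact: (hr r (leqnn r)).
have [w vw sw] : exists2 w, verts T w & size w = r.+1.
  apply: contrapT => nw; apply: nT; apply: sub_finite_set (finite_ball T r) => w vw.
  split => //; rewrite leqNgt; apply/negP => sw; apply: nw; exists (take r.+1 w).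
    exact: verts_take.
  by rewrite size_takel.
have [h1 c1] := trunc_cyl vw sw; have f1 := @trunc_finite r T.
exists (tcode (trunc r T)); rewrite /goodcyl tcodeK //; case: asboolP => // -[] T' c'.
have D T1 : tcyl (trunc r T) T1 -> `|f T - f T1| < e / 2.
  move=> c2; apply: hd; apply: le_lt_trans hr; apply: tdist_le => // v sv.
  have := c1 v; have := c2 v; rewrite h1; tauto.
have := D T' c'; have := D _ (tcyl_refl f1).
have := ler_distD (f T) (f T') (f (trunc r T)); rewrite (distrC (f T') (f T)); lra.
Qed.

Lemma nu_goodcyl e : 0 < e -> nu (finunion (goodcyl e) n) @[n --> \oo] --> 1%E.
Proof.
move=> e0; pose U := finunion (goodcyl e).
have mG n : measurable (goodcyl e n : set (tree_borel R)).
  by rewrite tree_borelE; apply: sub_sigma_algebra; exact: goodcyl_tcyls.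
have UG : \bigcup_n U n = \bigcup_n goodcyl e n.
  apply/seteqP; split => [T [n _ [k _ kT]]|T [n _ nT]]; first by exists k.
  by exists n.+1 => //; exists n => //=.
have mU : measurable (\bigcup_n goodcyl e n : set (tree_borel R)) by exact: bigcup_measurable.
have <- : nu (\bigcup_n U n) = 1%E.
  rewrite UG -[X in nu X]setCK; apply: etrans (probability_setC nu (measurableC mU)) _.
  apply: etrans (_ : 1 - 0 = 1)%E; last by rewrite sube0.
  congr (1 - _)%E.
  apply: measure_negligible; first exact: measurableC.
  apply: (@negligibleS _ _ _ nu (\bigcup_n [set tdec n])).
    move=> T nT; have fT : tfinite T.
      by apply: contrapT => /(goodcyl_cover e0)[n gT]; apply: nT; exists n.
    by exists (tcode T) => //=; rewrite tcodeK.
  apply: negligible_bigcup => n; apply/negligibleP; [apply: measurable_tree1|apply: nu_tree1]; exact: tdec_finite.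
apply: nondecreasing_cvg_mu.
- by move=> n; apply: bigcup_measurable => k _.
- by rewrite UG.
- by move=> m n mn; apply/subsetPset => T [k km kT]; exists k => //=; exact: leq_trans mn.
Qed.

(** On each good cylinder minus the preceding ones this is the value of [f] at its tree. Taking
    differences of indicators of growing unions makes the pieces disjoint while staying within reach
    of [wconv_finunion]. *)
Definition gstep e n (T : ptree) : R :=
  \sum_(k < n) f (tdec k) * (\1_(finunion (goodcyl e) k.+1) T + (-1) * \1_(finunion (goodcyl e) k) T).

Definition gerr e n (T : ptree) : R := (e + M) + (- M) * \1_(finunion (goodcyl e) n) T.

Lemma wconv_gstep e n : wconv (gstep e n).
Proof.
apply: (@wconv_sum n (fun k T => f (tdec k) *
  (\1_(finunion (goodcyl e) k.+1) T + (-1) * \1_(finunion (goodcyl e) k) T))) => k.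
have w j := wconv_finunion j (goodcyl_tcyls e).
exact: wconvZ (wconvD (w k.+1) (wconvZ (-1) (w k))).
Qed.

Lemma wconv_gerr e n : wconv (gerr e n).
Proof.
exact: wconvD (wconv_cst _) (wconvZ _ (wconv_finunion n (goodcyl_tcyls e))).
Qed.

Lemma gstep_err e n T : 0 < e -> `|f T - gstep e n T| <= gerr e n T.
Proof.
move=> e0; rewrite /gerr indicE; pose U := finunion (goodcyl e).
(* The vanishing outside the union is carried along because the next cylinder may cover [T] for the
   first time. *)
suff : if T \in U n then is_true (`|f T - gstep e n T| <= e) else gstep e n T = 0.
  rewrite -/(U n); case: ifP => _ /=; first by move=> h; lra.
  by move=> ->; rewrite subr0; have := fM T; lra.
rewrite /gstep; elim: n => [|n IH].
  by rewrite /U /finunion II0 bigcup_set0 in_set0 big_ord0.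
rewrite big_ord_recr /= !indicE -/(U n) -/(U n.+1) [U n.+1]finunionS in_setU -/(U n).
move: IH; case: (T \in U n) => /= IH; first by rewrite mulN1r subrr mulr0 addr0.
rewrite IH; case: (boolP (T \in _)) => [/set_mem/goodcylP|_] /=.
  by rewrite mulr0 addr0 mulr1 add0r.
by rewrite mulr0 addr0 mulr0 addr0.
Qed.

Lemma nuN_sum_le N g h : (forall T, g T <= h T) -> nuN_sum N g <= nuN_sum N h.
Proof. by move=> gh; rewrite !nuN_sumE; apply: ler_sum => T _; rewrite ler_wpM2r // nuN_ge0. Qed.

Lemma nuN_sumB N g h : nuN_sum N (fun T => g T - h T) = nuN_sum N g - nuN_sum N h.
Proof. by rewrite !nuN_sumE -sumrB; apply: eq_bigr => T _; rewrite mulrBl. Qed.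

Lemma nuN_sum_dist N e n : 0 < e -> `|nuN_sum N f - nuN_sum N (gstep e n)| <= nuN_sum N (gerr e n).
Proof.
move=> e0; rewrite -nuN_sumB ler_norml; apply/andP; split.
  rewrite lerNl -[leLHS]add0r -[X in X - _](_ : nuN_sum N (fun=> 0) = 0).
    rewrite -nuN_sumB; apply: nuN_sum_le => T; have := gstep_err n T e0.
    by rewrite ler_norml => /andP[]; lra.
  by rewrite nuN_sumE big1 // => T _; rewrite mul0r.
by apply: nuN_sum_le => T; have := gstep_err n T e0; rewrite ler_norml => /andP[].
Qed.

Lemma nuint_dist e n : 0 < e -> `|nuint f - nuint (gstep e n)| <= nuint (gerr e n).
Proof.
move=> e0; have [igs _] := wconv_gstep e n; have [ie _] := wconv_gerr e n.
have ifs := integrableB measurableT nuintegrable_f igs.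
rewrite /nuint -RintegralB //; last exact: nuintegrable_f.
apply: le_trans (le_normr_Rintegral _ _) _ => //.
apply: le_Rintegral => //; first exact: integrable_norm ifs.
by move=> T _; exact: gstep_err.
Qed.

Lemma nuint_gerr e : 0 < e -> exists n, nuint (gerr e n) < e + e.
Proof.
move=> e0; pose U := finunion (goodcyl e).
have mU n : measurable (U n : set (tree_borel R)).
  apply: bigcup_measurable => k _.
  by rewrite tree_borelE; apply: sub_sigma_algebra; exact: goodcyl_tcyls.
have E n : nuint (gerr e n) = (e + M) - M * nuint \1_(U n).
  have [ie _] := wconv_cst (e + M).
  have [iU _] := wconv_finunion n (goodcyl_tcyls e).
  have [iMU _] := wconvZ (- M) (wconv_finunion n (goodcyl_tcyls e)).
  rewrite /nuint /gerr RintegralD // RintegralZl // Rintegral_cst //.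
  rewrite mulNr; congr (_ - _).
  apply: etrans (_ : (e + M) * fine 1%E = _); last by rewrite mulr1.
  by congr (_ * fine _); exact: (probability_setT nu).
have c1 : nuint \1_(U n) @[n --> \oo] --> (1 : R).
  have := nu_goodcyl e0; rewrite -/U.
  rewrite (_ : (fun n => nu (U n)) = EFin \o (fun n => nuint \1_(U n))).
    by move/fine_cvg.
  by apply/funext => n /=; rewrite nuint_indic.
have c2 : nuint (gerr e n) @[n --> \oo] --> e.
  rewrite (_ : (fun n => nuint (gerr e n)) = fun n => (e + M) - M * nuint \1_(U n)); last exact/funext.
  suff : e + M - M * nuint \1_(U n) @[n --> \oo] --> e + M - M * 1 by rewrite mulr1 addrK.
  by apply: cvgB; [exact: cvg_cst|apply: cvgM => //; exact: cvg_cst].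
have /cvgrPdist_lt/(_ e e0)[n _ hn] := c2; exists n.
by have := hn n (leqnn n); rewrite /= distrC => /ltr_normlW; lra.
Qed.

Lemma cvg_nuN_sum : nuN_sum N f @[N --> \oo] --> nuint f.
Proof.
(* Six parts: [2 e] for approximating the limit integral, [e] for the convergence on [gstep], and
   [3 e] for the approximation under [nuN], namely [2 e] plus [e] for the convergence on [gerr]. *)
apply/cvgrPdist_lt => eps eps0; pose e := eps / 6; have e0 : 0 < e by rewrite /e; lra.
have [n hn] := nuint_gerr e0; have hJ := nuint_dist n e0.
have [_ /cvgrPdist_lt/(_ e e0) cs] := wconv_gstep e n.
have [_ /cvgrPdist_lt/(_ e e0) ce] := wconv_gerr e n.
near=> N; have hI := nuN_sum_dist N n e0.
have h1 : `|nuint (gstep e n) - nuN_sum N (gstep e n)| < e by near: N.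
have h2 : `|nuint (gerr e n) - nuN_sum N (gerr e n)| < e by near: N.
rewrite distrC in h2; have h3 := ltr_normlW h2.
have t1 := ler_distD (nuint (gstep e n)) (nuint f) (nuN_sum N f).
have t2 := ler_distD (nuN_sum N (gstep e n)) (nuint (gstep e n)) (nuN_sum N f).
rewrite (distrC (nuN_sum N (gstep e n)) (nuN_sum N f)) in t2.
have -> : eps = 6 * e by rewrite /e; field.
lra.
Unshelve. all: by end_near. Qed.

End WeakConvergence.

Theorem mainTheorem13 (R : realType) (mu : R) (hmu : 0 < mu) :
  exists nu : probability (tree_borel R) R,
    weak_conv_nuN mu nu /\
    (forall T0 : ptree, tfinite T0 ->
       measurable (tcyl T0 : set (tree_borel R)) /\
       nu (tcyl T0) = (cyl_value mu T0)%:E) /\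
    (forall nu' : probability (tree_borel R) R,
       (forall T0 : ptree, tfinite T0 -> nu' (tcyl T0) = (cyl_value mu T0)%:E) ->
       forall A : set (tree_borel R), measurable A -> nu' A = nu A).
Proof.
have [nu hnu] := limit_measure_ex hmu; exists nu; split; last split.
- move=> f cf [M fM].
  have -> : (\int[nu]_(x in setT) (f x)%:E)%E = (nuint nu f)%:E.
    rewrite /nuint /Rintegral fineK //; apply: integrable_fin_num => //.
    exact: (nuintegrable_f nu cf fM).
  apply: cvg_EFin; first by apply: nearW.
  exact: (cvg_nuN_sum hmu hnu cf fM).
- by move=> T0 f0; split; [exact: measurable_tcyl|exact: hnu].
- by move=> nu' hnu'; apply: tree_borel_unique => T0 f0; rewrite hnu' // hnu.
Qed.
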